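(* For each $v\in V$ let $\mu_v:\mathbb{C}^{F_v}\to\mathfrak{t}^*$ be defined by $|z_f|^2/2-\lambda_f=\langle X_f,\mu_v(z)\rangle$ for all $z\in\mathbb{C}^{F_v}$, $f\in F_v$ (this is a momentum mapping for the Hamiltonian $T$-action via $\mathbb{R}^{F_v}/\mathbb{Z}^{F_v}$ on the symplectic vector space $\mathbb{C}^{F_v}$). Define $U_v:=\mu_v^{-1}(\Delta_v)$. If also $w\in V$, define $$U_{v,w}:=\{z^v\in U_v\mid z^v_f\neq0\text{ for every }f\in F_v\setminus F_w\},$$ and, if $z^v\in U_{v,w}$, define $\varphi_{w,v}(z^v):=z^w$, where $z^w\in\mathbb{C}^{F_w}$ is given by $$z^w_g=\prod_{f\in F_v}(z^v_f)^{(w)_f^g}\Big/\prod_{f\in F_v\setminus F_w}|z^v_f|^{(w)_f^g}\quad\text{if } g\in F_w\cap F_v,$$ $$z^w_g=\prod_{f\in F_v}(z^v_f)^{(w)_f^g}\; r_g(\mu_v(z^v))\Big/\prod_{f\in F_v\setminus F_w}|z^v_f|^{(w)_f^g}\quad\text{if } g\in F_w\setminus F_v.$$ Then $\varphi_{w,v}$ is a $T$-equivariant symplectomorphism from $U_{v,w}$ onto $U_{w,v}$ such that $\mu_w=\mu_v\circ\varphi_{v,w}$ on $U_{w,v}$. The $\varphi_{w,v}$ satisfy the cocycle condition $\varphi_{w,v}\circ\varphi_{v,u}=\varphi_{w,u}$ where the left hand side is defined. Gluing together the Hamiltonian $T$-spaces $U_v$, $v\in V$, with the momentum maps $\mu_v$,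 by means of the gluing maps $\varphi_{w,v}$, $v,w\in V$, we obtain a compact connected smooth symplectic manifold $\widetilde{M}$ with an effective Hamiltonian $T$-action with a common momentum map $\widetilde{\mu}:\widetilde{M}\to\mathfrak{t}^*$ such that $\widetilde{\mu}(\widetilde{M})=\Delta$. In other words, $\widetilde{M}$ is a Delzant space for the Delzant polytope $\Delta$.
   Context: For a finite set $B$ and a set $A$, $A^B$ is the set of functions $B\to A$; for $z\in A^B$ write $z_f=z(f)$. Let $T$ be an $n$-dimensional torus (compact, connected, commutative Lie group) with Lie algebra $\mathfrak{t}$, exponential map $\exp:\mathfrak{t}\to T$, and integral lattice $\mathfrak{t}_{\mathbb{Z}}:=\ker(\exp)$. Let $\Delta\subset\mathfrak{t}^*$ be an $n$-dimensional convex polytope, $F$ the set of its codimension one faces, $V$ the set of its vertices, and $F_v=\{f\in F\mid v\in f\}$ for $v\in V$. Assume $\Delta$ is a Delzant polytope: (i) for each $f\in F$ there are $X_f\in\mathfrak{t}$, $\lambda_f\in\mathbb{R}$ such that the hyperplane containing $f$ is $\{\xi\mid\langle X_f,\xi\rangle+\lambda_f=0\}$ and $\Delta\subset\{\xi\mid\langle X_f,\xi\rangle+\lambda_f\ge 0\}$ (with $X_f$ normalized to be primitive in $\mathfrak{t}_{\mathbb{Z}}$, which makes $X_f,\lambda_f$ unique); (ii) for every $v\in V$ the $X_f$, $f\in F_v$, form a $\mathbb{Z}$-basis of $\mathfrak{t}_{\mathbb{Z}}$. Hence $\#F_v=n$ and $\Delta=\{\xi\in\mathfrak{t}^*\mid\langle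 X_f,\xi\rangle+\lambda_f\ge0\ \forall f\in F\}$. For $v\in V$ put $\Delta_v:=\Delta\setminus\bigcup_{f'\in F\setminus F_v}f'$. For $f\in F$ let $r_f:\Delta\to\mathbb{R}_{\ge0}$, $r_f(\xi)=(2(\langle X_f,\xi\rangle+\lambda_f))^{1/2}$. For $w\in V$ and $f\in F$, the integers $(w)_f^g$, $g\in F_w$, are the unique integers with $X_f=\sum_{g\in F_w}(w)_f^g X_g$; if $f\in F_w$ they are $1$ for $g=f$ and $0$ otherwise, and the convention $0^0=1$ is used in products. $\mathbb{C}^{F_v}$ carries the symplectic form $\frac{1}{2\pi}\sum_{f\in F_v}dx_f\wedge dy_f$, $z_f=x_f+iy_f$. The map $t\mapsto\exp(\sum_{f\in F_v}t_fX_f)$ induces an isomorphism $\mathbb{R}^{F_v}/\mathbb{Z}^{F_v}\to T$, and $T$ acts on $\mathbb{C}^{F_v}$ through its inverse and the action $(t\cdot z)_f=e^{2\pi i t_f}z_f$. Sign convention for a momentum map $\mu$: $\iota_{Y_M}\sigma=-d\langle Y,\mu\rangle$, where $Y_M$ is the infinitesimal action of $Y$. A Delzant space for $\Delta$ is a compact connected symplectic manifold of dimension $2n=2\dim T$ with an effective Hamiltonian $T$-action whose momentum map has image $\Delta$. Gluing means taking the quotient of the disjoint union of the $U_v$ by the identifications $z\sim\varphi_{w,v}(z)$, $z\in U_{v,w}$. *)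

(* Defs.v *)
From HB Require Import structures.
From mathcomp Require Import all_boot all_order all_algebra.
From mathcomp Require Import generic_quotient.
From mathcomp Require Import all_classical all_reals all_analysis.
From mathcomp Require Import complex.
From Stdlib Require Import Relation_Operators.

Set Implicit Arguments.
Unset Strict Implicit.
Unset Printing Implicit Defensive.

Import Order.TTheory GRing.Theory Num.Theory.
Import numFieldNormedType.Exports.

Local Open Scope classical_set_scope.
Local Open Scope quotient_scope.
Local Open Scope complex_scope.
Local Open Scope ring_scope.

(** * Smooth maps between open subsets of R^m *)

Section SmoothEuclidean.
Context {R : realType}.

(* C^k on U, for U open *)
Fixpoint Ck (k m : nat) (U : set 'rV[R]_m) (f : 'rV[R]_m -> R) : Prop :=
  match k with
  | 0 => forall x, U x -> {for x, continuous f}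
  | k'.+1 => (forall x, U x -> differentiable f x) /\
             forall i : 'I_m, Ck k' U (fun x => 'D_(delta_mx 0 i) f x)
  end.

Definition smooth_on m (U : set 'rV[R]_m) (f : 'rV[R]_m -> R) : Prop :=
  open U /\ forall k, Ck k U f.

Definition smooth_to m p (U : set 'rV[R]_m) (f : 'rV[R]_m -> 'rV[R]_p) : Prop :=
  open U /\ forall j : 'I_p, smooth_on U (fun x => f x 0 j).

End SmoothEuclidean.

(** * Manifolds, given by an atlas *)

(* The value of a chart map matters only on its domain; the dimension may a
   priori depend on the chart, and is fixed in [is_manifold]. *)
Record atlas (R : realType) (M : Type) := Atlas {
  chart_idx : Type;
  chart_dim : chart_idx -> nat;
  chart_dom : chart_idx -> set M;
  chart : forall a : chart_idx, M -> 'rV[R]_(chart_dim a) }.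

Section Manifolds.
Context {R : realType}.

Definition prod_atlas (M N : Type) (A : atlas R M) (B : atlas R N) :
    atlas R (M * N) :=
  @Atlas R (M * N) (chart_idx A * chart_idx B)%type
    (fun ab => chart_dim ab.1 + chart_dim ab.2)%N
    (fun ab => [set p | chart_dom ab.1 p.1 /\ chart_dom ab.2 p.2])
    (fun ab p => row_mx (chart ab.1 p.1) (chart ab.2 p.2)).

Definition vect_atlas (E : vectType R) : atlas R E :=
  @Atlas R E unit (fun=> dim E) (fun=> setT) (fun=> @VectorInternalTheory.v2r R E).

(* [g] is the expression of [f], restricted to [U], in the charts [a] and [b] *)
Definition represents (M N : Type) (A : atlas R M) (B : atlas R N) (U : set M)
    (f : M -> N) (a : chart_idx A) (b : chart_idx B)
    (g : 'rV[R]_(chart_dim a) -> 'rV[R]_(chart_dim b)) : Prop :=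
  forall x, U x -> chart_dom a x -> chart_dom b (f x) ->
    chart b (f x) = g (chart a x).

(* As [smooth_to] requires an open domain, this also forces [U] to be open and
   [f] to be continuous on [U]. *)
Definition smooth_map (M N : Type) (A : atlas R M) (B : atlas R N) (U : set M)
    (f : M -> N) : Prop :=
  forall (a : chart_idx A) (b : chart_idx B),
    exists2 g, represents U f (a := a) (b := b) g &
      smooth_to (chart a @` [set x | [/\ U x, chart_dom a x
                                       & chart_dom b (f x)]]) g.

Definition represents_fun (M : Type) (A : atlas R M) (f : M -> R)
    (a : chart_idx A) (g : 'rV[R]_(chart_dim a) -> R) : Prop :=
  forall x, chart_dom a x -> f x = g (chart a x).

Definition smooth_fun (M : Type) (A : atlas R M) (f : M -> R) : Prop :=
  forall a : chart_idx A, exists2 g, represents_fun f (a := a) g &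
    smooth_on (chart a @` chart_dom a) g.

Definition diffeo (M N : Type) (A : atlas R M) (B : atlas R N)
    (U : set M) (U' : set N) (f : M -> N) : Prop :=
  [/\ set_bij U U' f, smooth_map A B U f &
      exists2 h, smooth_map B A U' h & forall x, U x -> h (f x) = x].

Record is_manifold (d : nat) (M : topologicalType) (A : atlas R M) : Prop := {
  manifold_hausdorff : hausdorff_space M;
  manifold_second_countable : @second_countable M;
  manifold_dim : forall a : chart_idx A, chart_dim a = d;
  manifold_cover : forall x : M, exists a : chart_idx A, chart_dom a x;
  chart_open_dom : forall a : chart_idx A, open (chart_dom a);
  chart_inj : forall a : chart_idx A, set_inj (chart_dom a) (chart a);
  chart_continuous : forall (a : chart_idx A) (x : M), chart_dom a x ->
    {for x, continuous (chart a)};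
  chart_open_map : forall (a : chart_idx A) (O : set M),
    open O -> O `<=` chart_dom a -> open (chart a @` O);
  chart_transition : smooth_map A A setT id }.

(** ** 2-forms *)

(* A 2-form in charts: [s a x i j] is its value on the i-th and j-th coordinate
   vector fields of the chart [a], at the point with coordinates [x]. *)
Definition form2 (M : Type) (A : atlas R M) :=
  forall a : chart_idx A, 'rV[R]_(chart_dim a) -> 'M[R]_(chart_dim a).

(* f^* t = s on U.  With ['D_v g x = v *m 'J g x], pulling back the matrix S
   gives J S J^T. *)
Definition preserves_form (M N : Type) (A : atlas R M) (B : atlas R N)
    (s : form2 A) (t : form2 B) (U : set M) (f : M -> N) : Prop :=
  forall (a : chart_idx A) (b : chart_idx B) g,
    represents U f (a := a) (b := b) g ->
    forall x, U x -> chart_dom a x -> chart_dom b (f x) ->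
      s a (chart a x) =
      'J g (chart a x) *m t b (chart b (f x)) *m ('J g (chart a x))^T.

Definition symplectomorphism (M N : Type) (A : atlas R M) (B : atlas R N)
    (s : form2 A) (t : form2 B) (U : set M) (U' : set N) (f : M -> N) : Prop :=
  diffeo A B U U' f /\ preserves_form s t U f.

Record is_symplectic (M : Type) (A : atlas R M) (s : form2 A) : Prop := {
  form_smooth : forall (a : chart_idx A) i j,
    smooth_on (chart a @` chart_dom a) (fun x => s a x i j);
  form_compatible : preserves_form s s setT id;
  form_antisymmetric : forall (a : chart_idx A) x, chart_dom a x ->
    (s a (chart a x))^T = - s a (chart a x);
  form_nondegenerate : forall (a : chart_idx A) x, chart_dom a x ->
    s a (chart a x) \in unitmx;
  form_closed : forall (a : chart_idx A) x i j k, chart_dom a x ->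
    'D_(delta_mx 0 i) (fun y => s a y j k) (chart a x) +
    'D_(delta_mx 0 j) (fun y => s a y k i) (chart a x) +
    'D_(delta_mx 0 k) (fun y => s a y i j) (chart a x) = 0 }.

End Manifolds.

(** * Tori and Hamiltonian actions *)

Section Tori.
Context {R : realType} {t : vectType R} {T : topologicalZmodType}.

(* [T], written additively, is a compact connected commutative Lie group with
   Lie algebra [t].  As [T] is commutative, its exponential map is a smooth
   homomorphism which is a local diffeomorphism at 0, the differential at 0
   being the identification of [t] with the tangent space of [T] at its
   identity; conversely a smooth homomorphism [t -> T] that is a local
   diffeomorphism at 0 is the exponential map for this identification.
   The integral lattice is the kernel of [exp]. *)
Record is_torus (n : nat) (AT : atlas R T) (exp : {additive t -> T}) : Prop := {
  torus_lie_dim : \dim {:t} = n;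
  torus_manifold : is_manifold n AT;
  torus_compact : compact [set: T];
  torus_connected : connected [set: T];
  torus_smooth_sub : smooth_map (prod_atlas AT AT) AT setT (fun p => p.1 - p.2);
  torus_smooth_exp : smooth_map (vect_atlas t) AT setT exp;
  torus_local_diffeo : exists W O,
    W (0 : t) /\ diffeo (vect_atlas t) AT W O exp }.

Section Hamiltonian.
Variables (AT : atlas R T) (exp : {additive t -> T}).
Variables (M : Type) (A : atlas R M) (s : form2 A).
Arguments s : clear implicits.
Variables (act : T -> M -> M) (mu : M -> 'Hom(t, R^o)).

Definition infinitesimal_action (Y : t) (a : chart_idx A) (x : M) :
    'rV[R]_(chart_dim a) :=
  derive1 (fun h : R => chart a (act (exp (h *: Y)) x)) 0.
Arguments infinitesimal_action : clear implicits.

(* Sign convention: the contraction of the form with Y_M is - d<Y, mu>. *)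
Record is_hamiltonian : Prop := {
  act_0 : forall x, act 0 x = x;
  act_add : forall g h x, act (g + h) x = act g (act h x);
  act_smooth : smooth_map (prod_atlas AT A) A setT (fun p => act p.1 p.2);
  act_symplectic : forall g, preserves_form s s setT (act g);
  momentum_smooth : forall Y, smooth_fun A (fun x => mu x Y);
  momentum_invariant : forall g x, mu (act g x) = mu x;
  momentum_eq : forall (Y : t) (a : chart_idx A) f,
    represents_fun (fun x => mu x Y) (a := a) f ->
    forall x, chart_dom a x ->
      infinitesimal_action Y a x *m s a (chart a x) =
      - \row_k 'D_(delta_mx 0 k) f (chart a x) }.

End Hamiltonian.

Definition effective (M : Type) (act : T -> M -> M) : Prop :=
  forall g, (forall x, act g x = x) -> g = 0.

Record is_delzant_space (n : nat) (AT : atlas R T) (exp : {additive t -> T})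
    (Delta : set 'Hom(t, R^o)) (M : topologicalType) (A : atlas R M)
    (s : form2 A) (act : T -> M -> M) (mu : M -> 'Hom(t, R^o)) : Prop := {
  delzant_space_manifold : is_manifold (2 * n) A;
  delzant_space_compact : compact [set: M];
  delzant_space_connected : connected [set: M];
  delzant_space_symplectic : is_symplectic s;
  delzant_space_hamiltonian : is_hamiltonian AT exp s act mu;
  delzant_space_effective : effective act;
  delzant_space_image : mu @` setT = Delta }.

End Tori.

(** * Delzant polytopes *)

Section ConvexGeometry.
Context {R : realType}.

Definition convex_hull (E : vectType R) (s : seq E) : set E :=
  [set x | exists a : 'I_(size s) -> R,
    [/\ forall i, 0 <= a i, \sum_i a i = 1 & x = \sum_i a i *: s`_i]].

(* [S] is nonempty and its affine hull has dimension [k] *)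
Definition has_affine_dim (E : vectType R) (S : set E) (k : nat) : Prop :=
  exists x0 (D : {vspace E}),
    [/\ S x0, \dim D = k, forall x, S x -> x - x0 \in D &
        forall D' : {vspace E}, (forall x, S x -> x - x0 \in D') -> (D <= D')%VS].

(* A face is the nonempty set of minimizers of a linear functional. *)
Definition is_face (t : vectType R) (P G : set 'Hom(t, R^o)) : Prop :=
  G !=set0 /\ exists (Y : t) (c : R),
    (forall xi, P xi -> 0 <= xi Y + c) /\ G = P `&` [set xi | xi Y + c = 0].

End ConvexGeometry.

(* [normal f] is X_f and [offset f] is lambda_f; [is_delzant_polytope] says that
   [facet] and [vertex] enumerate the facets and vertices of [polytope_set]. *)
Record polytope (R : realType) (t : vectType R) := Polytope {
  polytope_set : set 'Hom(t, R^o);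
  facets : finType;
  vertices : finType;
  facet : facets -> set 'Hom(t, R^o);
  vertex : vertices -> 'Hom(t, R^o);
  normal : facets -> t;
  offset : facets -> R }.

Section Delzant.
Context {R : realType} {t : vectType R} {T : topologicalZmodType}.
Variables (exp : {additive t -> T}) (D : polytope t).
Implicit Types (v w : vertices D) (xi : 'Hom(t, R^o)).

Definition Fset v : {set facets D} := [set f | `[< facet f (vertex v) >]].
Arguments Fset : clear implicits.

Definition Fv v : finType := {f : facets D | f \in Fset v}.
Arguments Fv : clear implicits.

Definition primitive (Y : t) : Prop :=
  exp Y = 0 /\
  forall (k : int) (Z : t), exp Z = 0 -> Y = Z *~ k -> `|k|%N = 1%N.

Record is_delzant_polytope (n : nat) : Prop := {
  delzant_convex : exists p : seq 'Hom(t, R^o), polytope_set D = convex_hull p;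
  delzant_dim : has_affine_dim (polytope_set D) n;
  facet_inj : injective (@facet _ _ D);
  facetsP : forall G, (exists f : facets D, facet f = G) <->
    is_face (polytope_set D) G /\ exists2 k, k.+1 = n & has_affine_dim G k;
  vertex_inj : injective (@vertex _ _ D);
  verticesP : forall xi, (exists v : vertices D, vertex v = xi) <->
    is_face (polytope_set D) [set xi];
  normal_primitive : forall f : facets D, primitive (normal f);
  facet_hyperplane : forall (f : facets D) xi, facet f xi ->
    xi (normal f) + offset f = 0;
  delzant_halfspace : forall (f : facets D) xi, polytope_set D xi ->
    0 <= xi (normal f) + offset f;
  delzant_basis : forall v (Y : t), exp Y = 0 ->
    exists! c : {ffun Fv v -> int}, Y = \sum_f normal (val f) *~ c f }.

(* the integers (w)_f^g, extended by 0 to g outside F_w *)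
Definition zcoef (w : vertices D) (f : facets D) : {ffun facets D -> int} :=
  xget 0 [set c : {ffun facets D -> int} |
    normal f = \sum_(g in Fset w) normal g *~ c g /\
    forall g, g \notin Fset w -> c g = 0].
Arguments zcoef : clear implicits.

Definition Delta_v v : set 'Hom(t, R^o) :=
  polytope_set D `\` \bigcup_(f in [set f | f \notin Fset v]) facet f.
Arguments Delta_v : clear implicits.

Definition r_ (f : facets D) xi : R := Num.sqrt (2 * (xi (normal f) + offset f)).
Arguments r_ : clear implicits.

End Delzant.

(** * The symplectic vector space C^I *)

Section ComplexSpace.
Context {R : realType}.

Definition cspace (I : finType) : Type := I -> R[i].

Definition coords (I : finType) (z : cspace I) : 'rV[R]_(#|I| + #|I|) :=
  row_mx (\row_k complex.Re (z (enum_val k))) (\row_k complex.Im (z (enum_val k))).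

HB.instance Definition _ (I : finType) := Choice.copy (cspace I) (I -> R[i]).
HB.instance Definition _ (I : finType) :=
  Topological.copy (cspace I) (initial_topology (@coords I)).

Definition cspace_atlas (I : finType) : atlas R (cspace I) :=
  @Atlas R (cspace I) unit (fun=> #|I| + #|I|)%N (fun=> setT)
    (fun=> @coords I).

(* (2 pi)^-1 \sum_f dx_f /\ dy_f, in the coordinates [coords] *)
Definition std_form (m : nat) : 'M[R]_(m + m) :=
  (2 * pi)^-1 *: block_mx 0 1%:M (- 1%:M) 0.

Definition cspace_form (I : finType) : form2 (cspace_atlas I) :=
  fun _ _ => std_form #|I|.

Definition cis (x : R) : R[i] := cos (2 * pi * x) +i* sin (2 * pi * x).

End ComplexSpace.
Arguments cspace R I : clear implicits.
Arguments cspace_form R I a x : clear implicits.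

(** * The charts U_v, the maps phi_{w,v} and the glued space *)

Section Gluing.
Context {R : realType} {t : vectType R} {T : topologicalZmodType}.
Variables (exp : {additive t -> T}) (D : polytope t).
Implicit Types (v w : vertices D).

Local Notation C v := (cspace R (Fv v)).

Definition mu_v v (z : C v) : 'Hom(t, R^o) :=
  xget 0 [set xi : 'Hom(t, R^o) |
    forall f : Fv v,
      Normc.normc (z f) ^+ 2 / 2 - offset (val f) = xi (normal (val f))].
Arguments mu_v : clear implicits.

Definition act_v v (g : T) (z : C v) : C v :=
  let s := xget (fun=> 0) [set s : Fv v -> R |
             exp (\sum_f s f *: normal (val f)) = g] in
  fun f => cis (s f) * z f.
Arguments act_v : clear implicits.

Definition U_ v : set (C v) := mu_v v @^-1` Delta_v v.
Arguments U_ : clear implicits.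

Definition Uo v w : set (C v) :=
  [set z | U_ v z /\ forall f : Fv v, val f \notin Fset w -> z f != 0].
Arguments Uo : clear implicits.

Definition phi w v (z : C v) : C w := fun g : Fv w =>
  (\prod_(f : Fv v) z f ^ zcoef w (val f) (val g)) *
  (if val g \in Fset v then 1 else (r_ (val g) (mu_v v z))%:C) /
  \prod_(f : Fv v | val f \notin Fset w) `|z f| ^ zcoef w (val f) (val g).
Arguments phi : clear implicits.

Definition piece v : topologicalType := set_type (U_ v).

Definition pieces : topologicalType := {v : vertices D & piece v}.

Definition glue_step (x y : pieces) : Prop :=
  Uo (tag x) (tag y) (val (tagged x)) /\
  val (tagged y) = phi (tag y) (tag x) (val (tagged x)).

Definition glue_rel : rel pieces :=
  fun x y => `[< clos_refl_sym_trans _ glue_step x y >].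

Lemma glue_refl : reflexive glue_rel.
Proof. by move=> x; apply/asboolP; exact: rst_refl. Qed.

Lemma glue_sym : symmetric glue_rel.
Proof. by move=> x y; apply/asboolP/asboolP => ?; exact: rst_sym. Qed.

Lemma glue_trans : transitive glue_rel.
Proof.
by move=> y x z /asboolP xy /asboolP yz; apply/asboolP; exact: rst_trans xy yz.
Qed.

Canonical glue_equiv := EquivRel glue_rel glue_refl glue_sym glue_trans.

Definition glued : topologicalType := quotient_topology {eq_quot glue_equiv}.

Definition to_glued v (z : piece v) : glued :=
  \pi_glued (existT piece v z).
Arguments to_glued : clear implicits.

(* The chart of the glued space with index v is the inverse of [to_glued v]. *)
Definition glued_chart v (x : glued) : 'rV[R]_(#|Fv v| + #|Fv v|) :=
  coords (xget (fun=> 0) [set val z | z in to_glued v @^-1` [set x]]).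
Arguments glued_chart : clear implicits.

Definition glued_atlas : atlas R glued :=
  @Atlas R glued (vertices D) (fun v => #|Fv v| + #|Fv v|)%N
    (fun v => range (to_glued v)) glued_chart.

Definition glued_form : form2 glued_atlas := fun v _ => std_form #|Fv v|.

End Gluing.

Arguments mu_v {R t D} v z.
Arguments act_v {R t T} exp {D} v g z _.
Arguments U_ {R t D} v _.
Arguments Uo {R t D} v w _.
Arguments phi {R t D} w v z _.
Arguments to_glued {R t D} v z.
Arguments glued_chart {R t D} v x.
Arguments glued_form {R t} D a _.

(* Main.v *)
Require Import Defs.
From HB Require Import structures.
From mathcomp Require Import all_boot all_order all_algebra.
From mathcomp Require Import generic_quotient.
From mathcomp Require Import all_classical all_reals all_analysis.
From mathcomp Require Import complex ring lra.
From Stdlib Require Import Relation_Operators.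

Set Implicit Arguments.
Unset Strict Implicit.
Unset Printing Implicit Defensive.

Import Order.TTheory GRing.Theory Num.Theory.
Import numFieldNormedType.Exports.

Local Open Scope classical_set_scope.
Local Open Scope ring_scope.

(** Everything rests on two descriptions of the polytope and its normals.

    The first is combinatorial.  Farkas' lemma, applied to the points spanning
    the polytope, produces for every point outside it a linear inequality; an
    inequality with as many tight spanning points as possible defines a facet
    ([hull_facet]).  Hence the polytope is cut out by its facet inequalities
    ([polytopeP]), and by moving along lines inside faces one finds below every
    point a vertex lying on all the facets through it ([vertex_below]).  So the
    sets [Delta_v] cover the polytope.

    The second is arithmetic.  The normals at a vertex separate the points of
    the dual space, because the vertex is a face ([normals_separate]); they are
    linearly independent over the reals by Dirichlet's pigeonhole argument,
    because the exponential map is injective near 0 ([normals_free]).  So they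
    are a basis of the Lie algebra, which makes [mu_v] well defined, and the
    torus acts on C^{F_v} through characters that are smooth because they are
    exponentials of linear forms in the exponential chart ([tchar_smooth]).

    Over [Delta_v] the momentum map has the section [rho], z_f = r_f, and every
    point of [U_v] is obtained from a point of the section by the action
    ([rho_orbit]).  The gluing maps are equivariant and carry one section to
    the other ([phi_act], [phi_rho]).  Their bijectivity, the cocycle condition
    and the preservation of the momentum follow formally ([phi_orbit]).

    For the symplectic forms one writes the gluing map as a rotation of the
    coordinates [z_g] or of the radii [r_g] by angles [a_g] ([phiE]).  Rotating
    changes the form dx dy of the coordinate by d(r_g^2/2) d(a_g), and
    r_g^2/2 = <X_g, mu> + lambda_g.  Summing over g, the relations between the
    normals turn this correction into the sum of d(|z_f|^2/2) d(arg z_f) over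
    the facets f of v that do not contain w, which is the missing part of the
    form on C^{F_v} ([phi_symplectic_at]).

    One gluing step is already an equivalence relation, so the pieces embed as
    open subsets of the glued space, namely the preimages of the sets
    [Delta_v] under the common momentum map ([range_to_gluedP]).  Therefore
    points with different momenta are separated by the momentum map and points
    with the same momentum lie in one chart, which gives the Hausdorff
    property.  Compactness holds because finitely many sets
    height >= e > 0 cover the polytope and the momentum maps [mu_v] are proper;
    connectedness because every [U_v] is star-shaped and all of them meet over
    the interior of the polytope. *)

(** * Smooth functions of several variables *)

Section Calculus.
Context {R : realType}.
Implicit Types (m p k : nat).

Lemma near_eq_differentiable (V W : normedModType R) (f g : V -> W) x :
  (\near x, f x = g x) -> differentiable f x -> differentiable g x.
Proof.
move=> fg /diff_locallyP [cf ef].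
have gx : g x = f x by rewrite (nbhs_singleton fg).
have eg : g \o shift x = cst (g x) + 'd f x +o_ (0 : V) id.
  apply/eqaddoP => e e0; move/eqaddoP: ef => /(_ e e0) ef.
  have sh : \forall y \near (0 : V), f (y + x) = g (y + x).
    have cx : (fun y : V => y + x) @ (0 : V) --> x.
      by rewrite -[X in _ --> X]add0r; apply: cvgD; [exact: cvg_id|exact: cvg_cst].
    exact: cx _ fg.
  apply: filterS2 sh ef => y fgy.
  by rewrite !fctE /= gx -fgy.
apply/diff_locallyP.
by rewrite (diff_unique cf eg).
Qed.

Lemma near_open (V : topologicalType) (U : set V) (P : V -> Prop) x :
  open U -> U x -> (forall y, U y -> P y) -> \near x, P x.
Proof. by move=> oU Ux UP; apply: filterS (open_nbhs_nbhs (conj oU Ux)). Qed.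

Lemma near_forall (X : topologicalType) (I : finType) (P : I -> X -> Prop) (x : X) :
  (forall i, \forall y \near x, P i y) -> \forall y \near x, forall i, P i y.
Proof. by move=> Px; apply: filter_forall. Qed.

Lemma near_gt0 (X : topologicalType) (f : X -> R) (x : X) :
  {for x, continuous f} -> 0 < f x -> \forall y \near x, 0 < f y.
Proof.
by move=> cf fx; apply: (cf [set r | 0 < r]); apply: open_nbhs_nbhs; split=> //; exact: open_gt.
Qed.

Lemma differentiable_rowP (V : normedModType R) p (f : V -> 'rV[R]_p) x :
  (forall j, differentiable (fun y => f y 0 j) x) -> differentiable f x.
Proof.
move=> df.
have -> : f = \sum_(j < p) (fun y => f y 0 j *: (delta_mx 0 j : 'rV[R]_p)).
  apply/funext => y; rewrite fct_sumE /=; exact: row_sum_delta.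
by apply: differentiable_sum => j; apply: differentiableZl.
Qed.

Lemma diff_coord (V : normedModType R) p (f : V -> 'rV[R]_p) x v j :
  differentiable f x -> ('d f x v) 0 j = 'D_v (fun y => f y 0 j) x.
Proof.
move=> df; rewrite -deriveE// derive_mx; last exact: diff_derivable.
rewrite mxE; reflexivity.
Qed.

Lemma continuous_rowP (X : topologicalType) p (f : X -> 'rV[R]_p) x :
  (forall j, {for x, continuous (fun y => f y 0 j)}) -> {for x, continuous f}.
Proof.
move=> cf; apply/cvg_ballP => e e0.
have H : \forall y \near x, forall j : 'I_p, ball (f x 0 j) e (f y 0 j).
  by apply: filter_forall => j; move/cvg_ballP: (cf j); exact.
by apply: filterS H => y Hy; split=> // i j; rewrite !ord1.
Qed.

Lemma Ck_sub k m (U V : set 'rV[R]_m) f : V `<=` U -> Ck k U f -> Ck k V f.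
Proof.
move=> VU; elim: k f => [f Uf x /VU|k IH f [df Df]]; first exact: Uf.
by split=> [x /VU|i]; [exact: df|exact: IH (Df i)].
Qed.

(** [Ck] is a condition at the points of the set on the iterated derivatives of
    a total function, so it can be checked on any covering. *)
Lemma Ck_local k m (U : set 'rV[R]_m) f :
  (forall x, U x -> exists2 W, W x & Ck k W f) -> Ck k U f.
Proof.
elim: k f => [f Uf x Ux|k IH f Uf].
  by have [W Wx] := Uf _ Ux; apply.
split=> [x Ux|i]; first by have [W Wx [df _]] := Uf _ Ux; exact: df.
by apply: IH => x Ux; have [W Wx [_ Df]] := Uf _ Ux; exists W => //; exact: Df.
Qed.

Lemma Ck_eq k m (U : set 'rV[R]_m) f g : open U ->
  (forall x, U x -> f x = g x) -> Ck k U f -> Ck k U g.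
Proof.
move=> oU; elim: k f g => [f g fg cf x Ux|k IH f g fg [df Df]].
  have nfg : \near x, f x = g x by exact: (near_open oU).
  have fx : f @ x --> g x by rewrite -(fg _ Ux); exact: cf.
  exact: cvg_trans (near_eq_cvg nfg) fx.
split=> [x Ux|i].
  by apply: near_eq_differentiable (df _ Ux); exact: (near_open oU).
apply: IH (Df i) => x Ux; apply: near_eq_derive; exact: (near_open oU).
Qed.

(** On an open set the derivatives may be replaced by functions that agree with
    them there; all closure properties below are inductions through this. *)
Lemma Ck_S k m (U : set 'rV[R]_m) f (Df : 'I_m -> 'rV[R]_m -> R) : open U ->
  (forall x, U x -> differentiable f x) ->
  (forall i x, U x -> 'D_(delta_mx 0 i) f x = Df i x) ->
  (forall i, Ck k U (Df i)) -> Ck k.+1 U f.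
Proof.
move=> oU df eD cD; split=> // i.
by apply: Ck_eq (cD i) => // x Ux; rewrite eD.
Qed.

Lemma Ck_le k m (U : set 'rV[R]_m) f : Ck k.+1 U f -> Ck k U f.
Proof.
elim: k f => [f [df _] x Ux|k IH f [df Df]].
  exact/differentiable_continuous/df.
by split=> // i; apply: IH; exact: Df.
Qed.

Lemma Ck_cst k m (U : set 'rV[R]_m) (c : R) : open U -> Ck k U (fun=> c).
Proof.
move=> oU; elim: k c => [c x _|k IH c]; first exact: cst_continuous.
apply: (@Ck_S _ _ _ _ (fun _ _ => 0)) => //.
  by move=> i x _; rewrite derive_cst.
Qed.

Lemma derive_coord m (x a : 'rV[R]_m) j : is_derive x a (fun y : 'rV[R]_m => y 0 j) (a 0 j).
Proof.
apply: DeriveDef; first exact/diff_derivable/differentiable_coord.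
have := derive_mx (@derivable_id _ _ x a); rewrite derive_id.
by move=> /(congr1 (fun M : 'rV[R]_m => M 0 j)); rewrite [RHS]mxE => ->.
Qed.

Lemma Ck_coord k m (U : set 'rV[R]_m) j : open U -> Ck k U (fun x => x 0 j).
Proof.
move=> oU; case: k => [x _|k].
  exact/differentiable_continuous/differentiable_coord.
apply: (@Ck_S _ _ _ _ (fun i _ => (delta_mx 0 i : 'rV[R]_m) 0 j)) => //.
- by move=> x _; exact: differentiable_coord.
- by move=> i x _; have [_ ->] := derive_coord x (delta_mx 0 i) j.
- by move=> i; exact: Ck_cst.
Qed.

Lemma CkD k m (U : set 'rV[R]_m) f g : open U ->
  Ck k U f -> Ck k U g -> Ck k U (fun x => f x + g x).
Proof.
move=> oU; elim: k f g => [f g cf cg x Ux|k IH f g [df Df] [dg Dg]].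
  exact: (cvgD (cf _ Ux) (cg _ Ux)).
apply: (@Ck_S _ _ _ _ (fun i x => 'D_(delta_mx 0 i) f x + 'D_(delta_mx 0 i) g x)).
- by [].
- by move=> x Ux; apply: differentiableD; [exact: df|exact: dg].
- move=> i x Ux; apply: deriveD; apply: diff_derivable; [exact: df|exact: dg].
- by move=> i; exact: IH (Df i) (Dg i).
Qed.

Lemma CkM k m (U : set 'rV[R]_m) f g : open U ->
  Ck k U f -> Ck k U g -> Ck k U (fun x => f x * g x).
Proof.
move=> oU; elim: k f g => [f g cf cg x Ux|k IH f g].
  exact: (cvgM (cf _ Ux) (cg _ Ux)).
move=> cf cg; have [df Df] := cf; have [dg Dg] := cg.
apply: (@Ck_S _ _ _ _ (fun i x => f x * 'D_(delta_mx 0 i) g x +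
   g x * 'D_(delta_mx 0 i) f x)).
- by [].
- by move=> x Ux; apply: differentiableM; [exact: df|exact: dg].
- move=> i x Ux; apply: deriveM; apply: diff_derivable; [exact: df|exact: dg].
- by move=> i; apply: CkD => //; apply: IH; [exact: Ck_le|exact: Dg|exact: Ck_le|exact: Df].
Qed.

Lemma Ck_sum k m (U : set 'rV[R]_m) (I : Type) (r : seq I) (P : pred I) f :
  open U -> (forall i, P i -> Ck k U (f i)) ->
  Ck k U (fun x => \sum_(i <- r | P i) f i x).
Proof.
move=> oU cf; elim: r => [|i r IH].
  by apply: (@Ck_eq _ _ _ (fun=> 0)) (Ck_cst _ _ oU) => // x _; rewrite big_nil.
case Pi: (P i).
  apply: (@Ck_eq _ _ _ (fun x => f i x + \sum_(i <- r | P i) f i x)) => //.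
    by move=> x _; rewrite big_cons Pi.
  by apply: CkD => //; exact: cf.
by apply: Ck_eq IH => // x _; rewrite big_cons Pi.
Qed.

(** By the chain rule the derivatives of the composite are sums of products of
    derivatives of the components with composites of one order less. *)
Lemma Ck_comp k m p (U : set 'rV[R]_m) (V : set 'rV[R]_p) (f : 'rV[R]_m -> 'rV[R]_p) h :
  open U -> (forall x, U x -> V (f x)) -> (forall j, Ck k U (fun x => f x 0 j)) ->
  Ck k V h -> Ck k U (h \o f).
Proof.
move=> oU UV; elim: k h => [h cf ch x Ux|k IH h cf ch].
  apply: continuous_comp; last exact/ch/UV.
  by apply: continuous_rowP => j; exact: cf.
have df x : U x -> differentiable f x.
  by move=> Ux; apply: differentiable_rowP => j; have [df _] := cf j; exact: df.
have [dh Dh] := ch.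
apply: (@Ck_S _ _ _ _ (fun i x => \sum_(j < p)
   'D_(delta_mx 0 i) (fun y => f y 0 j) x * ('D_(delta_mx 0 j) h \o f) x)).
- by [].
- by move=> x Ux; apply: differentiable_comp; [exact: df|exact/dh/UV].
- move=> i x Ux.
  have dhf : differentiable h (f x) by exact/dh/UV.
  rewrite deriveE; last by apply: differentiable_comp => //; exact: df.
  rewrite diff_comp //; last exact: df.
  rewrite /= [X in 'd h _ X]row_sum_delta linear_sum.
  by apply: eq_bigr => j _; rewrite linearZ /= -(deriveE _ dhf) (diff_coord _ _ (df _ Ux)).
- move=> i; apply: Ck_sum => // j _; apply: CkM => //.
    by have [_ Dj] := cf j; exact: Dj.
  by apply: IH => //; [move=> l; exact: Ck_le|exact: Dh].
Qed.

Lemma diff_comp1 (V : normedModType R) (h : R -> R) dh (f : V -> R) x :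
  is_derive (f x) 1 h dh -> differentiable f x ->
  differentiable (h \o f) x /\ forall v, 'D_v (h \o f) x = dh * 'D_v f x.
Proof.
move=> [dhf <-] df; have dh' : differentiable h (f x) by apply/derivable1_diffP.
have dhof : differentiable (h \o f) x by exact: differentiable_comp.
split=> // v; rewrite deriveE// diff_comp// /= (deriv1E dhf) -(deriveE _ df).
by rewrite derive1E mulrC.
Qed.

Lemma Ck_chain k m (U : set 'rV[R]_m) (f : _ -> R) (h : R -> R) dh : open U ->
  (forall x, U x -> is_derive (f x) 1 h (dh x)) -> Ck k.+1 U f ->
  Ck k U dh -> Ck k.+1 U (h \o f).
Proof.
move=> oU hd cf cdh; have [df Df] := cf.
apply: (@Ck_S _ _ _ _ (fun i x => dh x * 'D_(delta_mx 0 i) f x)) => //.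
- by move=> x Ux; have [] := diff_comp1 (hd _ Ux) (df _ Ux).
- by move=> i x Ux; have [_ ->] := diff_comp1 (hd _ Ux) (df _ Ux).
- by move=> i; apply: CkM => //; exact: Df.
Qed.

(** The derivative of 1/f is -f'/f^2, so one order of differentiability of 1/f
    follows from the previous one. *)
Lemma CkV k m (U : set 'rV[R]_m) f : open U -> (forall x, U x -> f x != 0) ->
  Ck k U f -> Ck k U (fun x => (f x)^-1).
Proof.
move=> oU f0; elim: k => [cf x Ux|k IH cf].
  exact: (cvgV (f0 _ Ux) (cf _ Ux)).
apply: (@Ck_chain _ _ _ f (fun y => y^-1) (fun x => - 1 * ((f x)^-1 * (f x)^-1))) => //.
  move=> x Ux; apply: DeriveDef.
    by apply: derivableV; [exact: f0|exact: derivable_id].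
  by rewrite deriveV ?derive_id; [rewrite -invfM -expr2 mulN1r scaleNr /GRing.scale /= mulr1
     |exact: f0|exact: derivable_id].
by apply: CkM => //; [exact: Ck_cst|apply: CkM => //; apply: IH; exact: Ck_le].
Qed.

(** The derivative of the root of f is f' divided by twice the root, so one
    order follows from the previous one. *)
Lemma Ck_sqrt k m (U : set 'rV[R]_m) f : open U -> (forall x, U x -> 0 < f x) ->
  Ck k U f -> Ck k U (fun x => Num.sqrt (f x)).
Proof.
move=> oU f0; elim: k => [cf x Ux|k IH cf].
  by apply: continuous_comp; [exact: cf|exact: sqrt_continuous].
apply: (@Ck_chain _ _ _ f Num.sqrt (fun x => (2 * Num.sqrt (f x))^-1)) => //.
  by move=> x Ux; apply: is_derive1_sqrt; exact: f0.
apply: CkV => // [x Ux|].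
  by rewrite mulf_neq0// sqrtr_eq0 -ltNge f0.
by apply: CkM => //; [exact: Ck_cst|apply: IH; exact: Ck_le].
Qed.

Lemma Ck_cos_sin k m (U : set 'rV[R]_m) f : open U -> Ck k U f ->
  Ck k U (fun x => cos (f x)) /\ Ck k U (fun x => sin (f x)).
Proof.
move=> oU; elim: k => [cf|k IH cf].
  by split=> x Ux; apply: continuous_comp;
    [exact: cf|exact: continuous_cos|exact: cf|exact: continuous_sin].
have [cc cs] := IH (Ck_le cf); split.
  apply: (@Ck_chain _ _ _ f cos (fun x => - 1 * sin (f x))) => //.
    by move=> x Ux; rewrite mulN1r; exact: is_derive_cos.
  by apply: CkM => //; exact: Ck_cst.
by apply: (@Ck_chain _ _ _ f sin (fun x => cos (f x))).
Qed.

Lemma smooth_onP m (U : set 'rV[R]_m) f : open U ->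
  (forall x, U x -> exists2 W, W x & smooth_on W f) -> smooth_on U f.
Proof.
move=> oU Uf; split=> // k; apply: Ck_local => x /Uf [W Wx [_ cf]].
by exists W.
Qed.

Lemma smooth_on_eq m (U : set 'rV[R]_m) f g :
  (forall x, U x -> f x = g x) -> smooth_on U f -> smooth_on U g.
Proof. by move=> fg [oU cf]; split=> // k; apply: Ck_eq (cf k). Qed.

Lemma smooth_on_sub m (U V : set 'rV[R]_m) f :
  open V -> V `<=` U -> smooth_on U f -> smooth_on V f.
Proof. by move=> oV VU [_ cf]; split=> // k; apply: Ck_sub (cf k). Qed.

Lemma smooth_cst m (U : set 'rV[R]_m) (c : R) : open U -> smooth_on U (fun=> c).
Proof. by move=> oU; split=> // k; exact: Ck_cst. Qed.

Lemma smooth_coord m (U : set 'rV[R]_m) j : open U -> smooth_on U (fun x => x 0 j).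
Proof. by move=> oU; split=> // k; exact: Ck_coord. Qed.

Lemma smoothD m (U : set 'rV[R]_m) f g :
  smooth_on U f -> smooth_on U g -> smooth_on U (fun x => f x + g x).
Proof. by move=> [oU cf] [_ cg]; split=> // k; exact: CkD. Qed.

Lemma smoothM m (U : set 'rV[R]_m) f g :
  smooth_on U f -> smooth_on U g -> smooth_on U (fun x => f x * g x).
Proof. by move=> [oU cf] [_ cg]; split=> // k; exact: CkM. Qed.

Lemma smoothN m (U : set 'rV[R]_m) f :
  smooth_on U f -> smooth_on U (fun x => - f x).
Proof.
move=> cf; apply: (@smooth_on_eq _ _ (fun x => -1 * f x)).
  by move=> x _; rewrite mulN1r.
by apply: smoothM => //; apply: smooth_cst; case: cf.
Qed.

Lemma smooth_sum m (U : set 'rV[R]_m) (I : Type) (r : seq I) (P : pred I) f :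
  open U -> (forall i, P i -> smooth_on U (f i)) ->
  smooth_on U (fun x => \sum_(i <- r | P i) f i x).
Proof.
by move=> oU cf; split=> // k; apply: Ck_sum => // i /cf [_].
Qed.

Lemma smooth_comp m p (U : set 'rV[R]_m) (V : set 'rV[R]_p) (f : 'rV[R]_m -> 'rV[R]_p) h :
  (forall x, U x -> V (f x)) -> smooth_to U f -> smooth_on V h -> smooth_on U (h \o f).
Proof.
move=> UV [oU cf] [_ ch]; split=> // k; apply: (@Ck_comp _ _ _ _ V) => // j.
by have [_] := cf j.
Qed.

Lemma smoothV m (U : set 'rV[R]_m) f : (forall x, U x -> f x != 0) ->
  smooth_on U f -> smooth_on U (fun x => (f x)^-1).
Proof. by move=> f0 [oU cf]; split=> // k; exact: CkV. Qed.

Lemma smooth_sqrt m (U : set 'rV[R]_m) f : (forall x, U x -> 0 < f x) ->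
  smooth_on U f -> smooth_on U (fun x => Num.sqrt (f x)).
Proof. by move=> f0 [oU cf]; split=> // k; exact: Ck_sqrt. Qed.

Lemma smooth_cos m (U : set 'rV[R]_m) f : smooth_on U f -> smooth_on U (fun x => cos (f x)).
Proof. by move=> [oU cf]; split=> // k; have [] := Ck_cos_sin oU (cf k). Qed.

Lemma smooth_sin m (U : set 'rV[R]_m) f : smooth_on U f -> smooth_on U (fun x => sin (f x)).
Proof. by move=> [oU cf]; split=> // k; have [] := Ck_cos_sin oU (cf k). Qed.

Lemma smooth_differentiable m (U : set 'rV[R]_m) f x :
  smooth_on U f -> U x -> differentiable f x.
Proof. by move=> [_ cf] Ux; have [df _] := cf 1%N; exact: df. Qed.

Lemma smooth_to_differentiable m p (U : set 'rV[R]_m) (f : _ -> 'rV[R]_p) x :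
  smooth_to U f -> U x -> differentiable f x.
Proof.
by move=> [_ cf] Ux; apply: differentiable_rowP => j; exact: smooth_differentiable (cf j) Ux.
Qed.

End Calculus.

(** * Duality in finite dimension *)

Section Duality.
Context {R : realType} {t : vectType R}.
Local Notation H := 'Hom(t, R^o).

Lemma hom_neq0 (u : H) : u != 0 -> exists Z, u Z != 0.
Proof.
move=> u0; apply: contrapT => /forallNP uZ; move/eqP: u0; apply.
by apply/lfunP => Z; rewrite zero_lfunE; apply/eqP/negP => /negP /uZ.
Qed.

Lemma lin_separate (W : vectType R) (D : {vspace W}) (w : W) : w \notin D ->
  exists l : 'Hom(W, R^o), (forall x, x \in D -> l x = 0) /\ l w != 0.
Proof.
move=> wD.
pose q : 'Hom(W, W) := (\1 - projv D)%VF.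
have qw : q w != 0.
  apply: contra wD; rewrite /q !lfunE /= !lfunE /= subr_eq0 => /eqP {1}->.
  exact: memv_proj.
have [i qi] : exists i, coord (vbasis {:W}) i (q w) != 0.
  apply: contrapT => /forallNP ci; move/eqP: qw; apply.
  rewrite (coord_vbasis (memvf (q w))) big1 // => i _.
  by have /negP/negPn/eqP -> := ci i; rewrite scale0r.
pose c : 'Hom(W, R^o) := linfun (coord (vbasis {:W}) i : W -> R^o).
exists (c \o q)%VF; split.
  by move=> x xD; rewrite comp_lfunE /q !lfunE /= !lfunE /= projv_id // subrr linear0.
by rewrite comp_lfunE lfunE.
Qed.

Lemma vec_neq0 (Z : t) : Z != 0 -> exists u : H, u Z != 0.
Proof. by rewrite -memv0 => /lin_separate [u [_ uZ]]; exists u. Qed.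

(** Reflexivity of finite dimensional spaces, in the form in which functionals
    on the dual produce vectors. *)
Lemma hom_eval (l : 'Hom(H, R^o)) : exists Z : t, forall u : H, l u = u Z.
Proof.
pose e i : H := linfun (coord (vbasis {:t}) i : t -> R^o).
exists (\sum_(i < \dim {:t}) l (e i) *: (vbasis {:t})`_i) => u.
rewrite linear_sum /=.
have {1}-> : u = \sum_(i < \dim {:t}) u (vbasis {:t})`_i *: e i.
  apply/lfunP => Y; rewrite {1}(coord_vbasis (memvf Y)) linear_sum sum_lfunE.
  by apply: eq_bigr => i _; rewrite linearZ /= scale_lfunE lfunE /= /GRing.scale /= mulrC.
by rewrite linear_sum; apply: eq_bigr => i _; rewrite !linearZ /= /GRing.scale /= mulrC.
Qed.

(** A complement of the subspace carries a functional that vanishes on the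
    subspace only, and by reflexivity it comes from a vector. *)
Lemma hom_separate (D : {vspace H}) (w : H) : w \notin D ->
  exists Z : t, (forall u, u \in D -> u Z = 0) /\ w Z != 0.
Proof.
move=> /lin_separate [l [lD lw]]; have [Z lZ] := hom_eval l.
by exists Z; split=> [u uD|]; rewrite -lZ // lD.
Qed.

Definition evalh (Y : t) (u : H) : R^o := u Y.

Lemma evalh_is_linear (Y : t) : linear (evalh Y).
Proof. by move=> a u v; rewrite /evalh add_lfunE scale_lfunE. Qed.

HB.instance Definition _ Y := GRing.isLinear.Build R H R^o _ (evalh Y) (evalh_is_linear Y).

Definition annihilator (Y : t) : {vspace H} := lker (linfun (evalh Y)).

Lemma annihilatorE Y u : (u \in annihilator Y) = (u Y == 0).
Proof. by rewrite memv_ker lfunE. Qed.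

(** Evaluation at a nonzero vector is onto the line, so its kernel has
    codimension one. *)
Lemma dim_annihilator Y : Y != 0 -> (\dim (annihilator Y)).+1 = \dim {:t}.
Proof.
move=> Y0.
have := limg_ker_dim (linfun (evalh Y)) {:H}.
rewrite capfv -/(annihilator Y).
have -> : \dim (limg (linfun (evalh Y))) = 1%N.
  apply/eqP; rewrite eqn_leq; apply/andP; split.
    by apply: leq_trans (dimvS (subvf _)) _; rewrite dimvf.
  rewrite lt0n dimv_eq0; have [u uY] := vec_neq0 Y0.
  apply: contra uY => /eqP im0.
  have : linfun (evalh Y) u \in limg (linfun (evalh Y)) by rewrite memv_img ?memvf.
  by rewrite im0 memv0 lfunE.
by rewrite !dimvf addn1 => ->; rewrite /dim /= muln1.
Qed.

End Duality.

(** * Farkas' lemma *)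

Section Farkas.
Context {R : realType} {K : vectType R}.
Local Notation E := 'Hom(K, R^o).
Implicit Types (s : seq E) (b c : E).

(** The cone of nonnegative combinations, by recursion on the generators as in
    the proof of Farkas' lemma. *)
Fixpoint cone s b : Prop :=
  if s is a :: s' then exists2 y : R, 0 <= y & cone s' (b - y *: a) else b = 0.

(** By induction on the number of generators: a functional [c] that separates
    [b] from the cone of all generators but [a0] either is nonnegative on [a0],
    or one projects along [a0] onto the kernel of [c] and separates there. *)
Lemma farkas s b :
  cone s b \/ exists k, (forall a, a \in s -> 0 <= a k) /\ b k < 0.
Proof.
elim: {s}(size s) {-2}s (erefl (size s)) b => [|N IH] [|a0 s] //= ss b.
  have [->|b0] := eqVneq b 0; first by left.
  right; have [k bk] := hom_neq0 b0.
  have [bk0|bk0] := ltP (b k) 0; first by exists k.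
  by exists (- k); split=> //; rewrite linearN oppr_lt0 lt_neqAle eq_sym bk.
case: ss => ss.
have [|[c [cs cb]]] := IH s ss b.
  by left; exists 0 => //; rewrite scale0r subr0.
have [ca0|ca0] := leP 0 (a0 c).
  by right; exists c; split=> // a; rewrite inE => /predU1P [->|/cs].
pose mu := - a0 c; have mu0 : 0 < mu by rewrite oppr_gt0.
pose g (a : E) : E := a c *: a0 + mu *: a.
(* Lifting a nonnegative combination of the projected generators back along
   a0; the projection is scaled by mu > 0 to avoid denominators. *)
have key x : forall s' : seq E, (forall a, a \in s' -> 0 <= a c) ->
    cone (map g s') x -> exists2 z : R, 0 <= z & cone s' (mu^-1 *: (x - z *: a0)).
  move=> s'; elim: s' x => [|a s' IHs] x cs' /=.
    by move=> ->; exists 0 => //; rewrite scale0r subrr scaler0.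
  case=> y y0 /IHs [|z z0 zP]; first by move=> a' a's; apply: cs'; rewrite inE a's orbT.
  exists (z + y * a c); first by rewrite addr_ge0 // mulr_ge0 // cs' // mem_head.
  exists y => //; congr cone: zP.
  apply/lfunP => k; rewrite /g !(add_lfunE, opp_lfunE, scale_lfunE) /GRing.scale /=.
  by field; rewrite lt0r_neq0.
have szg : size (map g s) = N by rewrite size_map.
have [|[d [ds db]]] := IH (map g s) szg (b c *: a0 + mu *: b).
  move=> /key [] // z z0 zP; left; exists (mu^-1 * (z - b c)).
    apply: mulr_ge0; first by rewrite invr_ge0 ltW.
    by rewrite subr_ge0 (le_trans (ltW cb) z0).
  congr cone: zP.
  apply/lfunP => k; rewrite !(add_lfunE, opp_lfunE, scale_lfunE) /GRing.scale /=.
  by field; rewrite lt0r_neq0.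
right; exists (a0 d *: c + mu *: d); split.
  move=> a; rewrite inE => /predU1P [->|/[dup] aS /(map_f g) /ds].
    by rewrite linearD !linearZ /= /mu /GRing.scale /= mulNr mulrC subrr.
  by rewrite /g linearD !linearZ /= add_lfunE !scale_lfunE /GRing.scale /= mulrC.
by move: db; rewrite linearD !linearZ /= add_lfunE !scale_lfunE /GRing.scale /= mulrC.
Qed.

End Farkas.

(** * The ratio test *)

Section Ratio.
Context {R : realType}.

(** Moving from a feasible point along a direction that decreases some
    constraint, stop when the first constraint becomes tight. *)
Lemma ratio_test (I : eqType) (s : seq I) (u v : I -> R) :
  (forall i, i \in s -> 0 <= u i) -> (exists2 i, i \in s & v i < 0) ->
  exists2 r, 0 <= r & (forall i, i \in s -> 0 <= u i + r * v i) /\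
    exists i, [/\ i \in s, v i < 0 & u i + r * v i = 0].
Proof.
elim: s => [_ [] //|j s IH] us [i0 i0s vi0].
have us' : forall i, i \in s -> 0 <= u i.
  by move=> i si; apply: us; rewrite inE si orbT.
have uj : 0 <= u j by apply: us; rewrite mem_head.
have [exneg|none] := pselect (exists2 i, i \in s & v i < 0); last first.
  have vs i : i \in s -> 0 <= v i.
    by move=> si; rewrite leNgt; apply/negP => vi; apply: none; exists i.
  have vj : v j < 0.
    by move: i0s vi0; rewrite inE => /predU1P [->//|/vs]; rewrite leNgt => /negbTE ->.
  have r0 : 0 <= u j / - v j by rewrite divr_ge0 // oppr_ge0 ltW.
  have rj : u j + u j / - v j * v j = 0.
    by rewrite invrN mulrN mulNr divfK ?subrr // lt_eqF.
  exists (u j / - v j) => //; split.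
    move=> i; rewrite inE => /predU1P [->|si]; first by rewrite rj.
    by apply: addr_ge0; [exact: us'|apply: mulr_ge0 => //; exact: vs].
  by exists j; rewrite mem_head.
have [r r0 [rP [i [si vi ri]]]] := IH us' exneg.
have [rj|rj] := leP 0 (u j + r * v j).
  exists r => //; split.
    by move=> k; rewrite inE => /predU1P [->|/rP].
  by exists i; rewrite inE si orbT.
have vj : v j < 0.
  rewrite ltNge; apply/negP => vj; move: rj.
  by rewrite ltNge addr_ge0 // mulr_ge0.
have r0' : 0 <= u j / - v j by rewrite divr_ge0 // oppr_ge0 ltW.
have rj' : u j + u j / - v j * v j = 0.
  by rewrite invrN mulrN mulNr divfK ?subrr // lt_eqF.
exists (u j / - v j) => //; split; last by exists j; rewrite mem_head.
move=> k; rewrite inE => /predU1P [->|sk]; first by rewrite rj'.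
have [vk|vk] := leP 0 (v k); first by apply: addr_ge0; [exact: us'|apply: mulr_ge0].
apply: le_trans (rP _ sk) _; rewrite lerD2l ler_wnM2r ?(ltW vk) //.
rewrite ler_pdivrMr ?oppr_gt0 // mulrN.
by rewrite -subr_le0 opprK ltW.
Qed.

End Ratio.

(** * Facets of a convex hull *)

Section AffineDim.
Context {R : realType} {t : vectType R}.
Local Notation H := 'Hom(t, R^o).

Lemma homZ (x : H) a Y : x (a *: Y) = a * x Y.
Proof. by rewrite linearZ. Qed.

(** The differences of points of a full dimensional set span the dual space. *)
Lemma aff_full (S : set H) Y c : has_affine_dim S (\dim {:t}) ->
  (forall x, S x -> x Y + c = 0) -> Y = 0 /\ c = 0.
Proof.
move=> [x0 [D [Sx0 dD SD minD]]] SY.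
have Y0 : Y = 0.
  apply/eqP/negPn/negP => Y0.
  have /dimvS : (D <= annihilator Y)%VS.
    apply: minD => x Sx; rewrite annihilatorE add_lfunE opp_lfunE.
    by rewrite -[x Y](addrK c) SY // -[x0 Y](addrK c) SY // subrr.
  by rewrite dD -(dim_annihilator Y0) ltnn.
by split=> //; have := SY _ Sx0; rewrite Y0 linear0 add0r.
Qed.

Lemma annihilator_sub (Y Z : t) :
  (annihilator Y <= annihilator Z)%VS -> exists mu, Z = mu *: Y.
Proof.
move=> YZ; apply/vlineP/negPn/negP => /lin_separate [l [lY lZ]].
have : l \in annihilator Y by rewrite annihilatorE lY ?memv_line.
by move/(subvP YZ); rewrite annihilatorE; apply/negP.
Qed.

(** The direction of a set of codimension one has a one-dimensional
    annihilator, which contains the linear part of every affine function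
    vanishing on the set. *)
Lemma aff_hyperplane (S : set H) k Y c Z c' : has_affine_dim S k ->
  k.+1 = \dim {:t} -> Y != 0 -> (forall x, S x -> x Y + c = 0) ->
  (forall x, S x -> x Z + c' = 0) -> exists mu, Z = mu *: Y /\ c' = mu * c.
Proof.
move=> [x0 [D [Sx0 dD SD minD]]] kt Y0 SY SZ.
have DY : D = annihilator Y.
  apply/eqP; rewrite eqEdim; apply/andP; split; last first.
    by rewrite dD -ltnS kt dim_annihilator.
  apply: minD => x Sx; rewrite annihilatorE add_lfunE opp_lfunE.
  by rewrite -[x Y](addrK c) SY // -[x0 Y](addrK c) SY // subrr.
have /annihilator_sub [mu Zmu] : (annihilator Y <= annihilator Z)%VS.
  rewrite -DY; apply: minD => x Sx; rewrite annihilatorE add_lfunE opp_lfunE.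
  by rewrite -[x Z](addrK c') SZ // -[x0 Z](addrK c') SZ // subrr.
exists mu; split=> //; have := SZ _ Sx0; rewrite Zmu homZ.
have /eqP := SY _ Sx0; rewrite addr_eq0 => /eqP -> /eqP.
by rewrite mulrN addrC subr_eq0 => /eqP.
Qed.

End AffineDim.

Section Hull.
Context {R : realType} {t : vectType R}.
Local Notation H := 'Hom(t, R^o).
Local Notation K := (t * R^o)%type.

(** Evaluation of affine functions [(Y, c)], scaled: [hformf x 1] is evaluation
    at the point [x].  This homogenization turns convex hulls into cones. *)
Definition hformf (x : H) (s : R) (k : K) : R^o := x k.1 + s * k.2.

Lemma hformf_is_linear x s : linear (hformf x s).
Proof.
move=> a u v; rewrite /hformf /= linearP /GRing.scale /=.
by rewrite mulrDr mulrDr addrACA; congr (_ + (_ + _)); rewrite mulrCA.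
Qed.

HB.instance Definition _ x s := GRing.isLinear.Build R K R^o _ (hformf x s) (hformf_is_linear x s).

Definition hform x s : 'Hom(K, R^o) := linfun (hformf x s).

Lemma hformE x s k : hform x s k = x k.1 + s * k.2.
Proof. by rewrite lfunE. Qed.

Lemma cone_hull (p : seq H) x s : cone (map (hform^~ 1) p) (hform x s) ->
  exists a : 'I_(size p) -> R,
    [/\ forall i, 0 <= a i, \sum_i a i = s & x = \sum_i a i *: p`_i].
Proof.
elim: p x s => [|y p IH] x s /=.
  move=> h0; exists (fun=> 0); split=> //; rewrite big_ord0.
    have := congr1 (fun l : 'Hom(K, R^o) => l (0, 1)) h0.
    by rewrite hformE zero_lfunE /= linear0 add0r mulr1.
  apply/lfunP => Y; have := congr1 (fun l : 'Hom(K, R^o) => l (Y, 0)) h0.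
  by rewrite hformE !zero_lfunE /= mulr0 addr0.
case=> z z0 hz.
have /IH [a [a0 sa xa]] : cone [seq hform^~ 1 i | i <- p] (hform (x - z *: y) (s - z)).
  congr cone: hz; apply/lfunP => k.
  rewrite !(add_lfunE, opp_lfunE, scale_lfunE, hformE) /GRing.scale /=; ring.
exists (fun i => if unlift ord0 i is Some j then a j else z); split.
- by move=> i; case: unliftP => [j|] _.
- rewrite big_ord_recl unlift_none (eq_bigr a) ?sa ?subrKC //.
  by move=> i _; rewrite liftK.
- rewrite big_ord_recl unlift_none /= (eq_bigr (fun i => a i *: p`_i)) -?xa ?subrKC //.
  by move=> i _; rewrite liftK.
Qed.

Lemma hull_ge0 (p : seq H) Y c : (forall x, x \in p -> 0 <= x Y + c) ->
  forall x, convex_hull p x -> 0 <= x Y + c.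
Proof.
move=> pY x [a [a0 sa ->]].
have -> : (\sum_i a i *: p`_i) Y + c = \sum_i a i * (p`_i Y + c).
  rewrite sum_lfunE (eq_bigr _ (fun i _ => mulrDr _ _ _)) big_split /= -mulr_suml sa mul1r.
  by congr (_ + c); apply: eq_bigr => i _; rewrite scale_lfunE.
by apply: sumr_ge0 => i _; rewrite mulr_ge0 // pY // mem_nth.
Qed.

Lemma mem_hull (p : seq H) x : x \in p -> convex_hull p x.
Proof.
move=> xp; have ip : (index x p < size p)%N by rewrite index_mem.
exists (fun i => (i == Ordinal ip)%:R); split.
- by move=> i; rewrite ler0n.
- by rewrite (bigD1 (Ordinal ip)) //= eqxx big1 ?addr0 // => i /negbTE ->.
- rewrite (bigD1 (Ordinal ip)) //= eqxx big1 ?addr0 ?scale1r ?nth_index //.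
  by move=> i /negbTE ->; rewrite scale0r.
Qed.

Lemma hull_bounded (p : seq H) Z : exists B, forall x, convex_hull p x -> x Z <= B.
Proof.
exists (\sum_(y <- p) `|y Z|) => x px.
suff : 0 <= x (- Z) + \sum_(y <- p) `|y Z| by rewrite linearN addrC subr_ge0.
move: x px; apply: hull_ge0 => x xp.
rewrite linearN addrC subr_ge0 (le_trans (ler_norm _)) //.
by rewrite (big_rem x) //= lerDl sumr_ge0.
Qed.

Lemma count_lt (T : eqType) (P Q : pred T) (s : seq T) x :
  (forall y, y \in s -> P y -> Q y) -> x \in s -> Q x -> ~~ P x ->
  (count P s < count Q s)%N.
Proof.
move=> PQ xs Qx Px; elim: s PQ xs => //= y s IH PQ.
have cPQ : (count P s <= count Q s)%N.
  elim: s {IH} PQ => //= z s IHs PQ; apply: leq_add; last first.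
    by apply: IHs => z' z's; apply: PQ; move: z's; rewrite !inE => /predU1P [->|->]; rewrite ?eqxx ?orbT.
  by have := PQ z; rewrite !inE eqxx orbT => /(_ isT); case: (P z) => // ->.
have [yx|yx] := eqVneq x y; first by rewrite -yx Qx (negbTE Px) add0n add1n ltnS.
rewrite inE (negbTE yx) /= => xs; rewrite -addnS leq_add //.
  by have := PQ y (mem_head _ _); case: (P y) => // ->.
by apply: IH => // z zs; apply: PQ; rewrite inE zs orbT.
Qed.

(** Among the affine functions [(Y, c)] that are nonnegative on the points [p]
    and negative at [x], choose one with as many zeros on [p] as possible.  It
    is then determined by these zeros up to a factor, which says that they span
    a hyperplane. *)
Lemma hull_facet (p : seq H) x n : \dim {:t} = n.+1 ->
  has_affine_dim (convex_hull p) n.+1 -> ~ convex_hull p x ->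
  exists Y c, [/\ forall y, convex_hull p y -> 0 <= y Y + c, x Y + c < 0 &
    has_affine_dim (convex_hull p `&` [set y | y Y + c = 0]) n].
Proof.
move=> dt hp xp.
pose feas (k : K) := (forall y, y \in p -> 0 <= y k.1 + k.2) /\ x k.1 + k.2 < 0.
pose tight (k : K) : pred H := fun y => y k.1 + k.2 == 0.
have [k0 fk0] : exists k, feas k.
  have [/cone_hull [a aP]|[k [ks kx]]] := farkas (map (hform^~ 1) p) (hform x 1).
    by exfalso; apply: xp; exists a.
  exists k; split; last by move: kx; rewrite hformE mul1r.
  by move=> y yp; have := ks _ (map_f (hform^~ 1) yp); rewrite hformE mul1r.
pose P m := `[< exists k, feas k /\ count (tight k) p = m >].
have exP : exists m, P m by exists (count (tight k0) p); apply/asboolP; exists k0.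
have bP m : P m -> (m <= size p)%N by move=> /asboolP [k [_ <-]]; exact: count_size.
case: (ex_maxnP exP bP) => M /asboolP [[Y c] [[fY xY] cM]] maxM {k0 fk0}.
rewrite /= in fY xY.
(* Otherwise one subtracts a multiple of (Y, c) to get a direction that also
   vanishes at x; moving along it makes a further constraint tight while the
   value at x stays negative. *)
have line (Z : t) (e : R) : (forall y, y \in p -> y Y + c = 0 -> y Z + e = 0) ->
    exists mu, Z = mu *: Y /\ e = mu * c.
  move=> tZ; pose mu := (x Z + e) / (x Y + c).
  pose d1 := Z - mu *: Y; pose d2 := e - mu * c.
  have d0 : x d1 + d2 = 0.
    rewrite /d1 /d2 linearB /= homZ addrACA -opprD -mulrDr /mu.
    by rewrite divfK ?subrr // lt_eqF.
  have dt0 y : y \in p -> y Y + c = 0 -> y d1 + d2 = 0.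
    move=> yp yt; rewrite /d1 /d2 linearB /= homZ addrACA -opprD -mulrDr.
    by rewrite yt mulr0 subr0 tZ.
  have noneg (sg : R) : sg != 0 -> ~ exists2 y, y \in p & sg * (y d1 + d2) < 0.
    move=> sg0 neg.
    have [r r0 [rP [i [ip i0 ri]]]] := ratio_test fY neg.
    have E (y : H) : y (Y + (r * sg) *: d1) + (c + r * sg * d2) = y Y + c + r * (sg * (y d1 + d2)).
      by rewrite linearD /= homZ; ring.
    have fk' : feas (Y + (r * sg) *: d1, c + r * sg * d2).
      by split=> [y yp|] /=; rewrite E ?rP // d0 !mulr0 addr0.
    have : P (count (tight (Y + (r * sg) *: d1, c + r * sg * d2)) p).
      by apply/asboolP; exists (Y + (r * sg) *: d1, c + r * sg * d2).
    move/maxM; rewrite -cM leqNgt => /negP; apply.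
    apply: (@count_lt _ _ _ _ i) => //.
    - by move=> y yp; rewrite /tight /= E => /eqP yt; rewrite yt dt0 // !mulr0 addr0.
    - by rewrite /tight /= E ri.
    - rewrite /tight /=; apply/negP => /eqP it.
      by move: i0; rewrite dt0 // mulr0 ltxx.
  have dp y : y \in p -> y d1 + d2 = 0.
    move=> yp; apply: le_anti; rewrite !leNgt; apply/andP; split; apply/negP => dy.
      by apply: (noneg (-1)); [rewrite oppr_eq0 oner_eq0|exists y; rewrite // mulN1r oppr_lt0].
    by apply: (noneg 1); [rewrite oner_eq0|exists y; rewrite // mul1r].
  have [||d10 d20] := @aff_full _ _ (convex_hull p) d1 d2; first by rewrite dt.
    move=> y py; apply: le_anti; apply/andP; split.
      rewrite -oppr_ge0 opprD -linearN; move: y py.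
      by apply: hull_ge0 => y yp; rewrite linearN -opprD dp // oppr0.
    by move: y py; apply: hull_ge0 => y yp; rewrite dp.
  by exists mu; split; apply/eqP; rewrite -subr_eq0; apply/eqP.
have Y0 : Y != 0.
  apply/eqP => Y0; have [y0 [_ [py0 _ _ _]]] := hp.
  have := hull_ge0 fY py0; rewrite Y0 linear0 add0r leNgt.
  by move: xY; rewrite Y0 linear0 add0r => ->.
have [i0 ip it] : exists2 i, i \in p & i Y + c = 0.
  apply: contrapT => /forall2NP none.
  have [|mu [Ymu mu1]] := line 0 1; first by move=> y yp yt; case: (none y).
  move/esym/eqP: Ymu; rewrite scaler_eq0 (negbTE Y0) orbF => /eqP mu0.
  by move/eqP: mu1; rewrite mu0 mul0r oner_eq0.
exists Y, c; split=> //; first exact: hull_ge0.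
exists i0, (annihilator Y); split.
- by split=> //; exact: mem_hull.
- by apply: succn_inj; rewrite dim_annihilator.
- move=> y [py yt]; rewrite annihilatorE add_lfunE opp_lfunE.
  by rewrite -[y Y](addrK c) yt -[i0 Y](addrK c) it subrr.
- move=> D' SD'; apply/subvP => u uY; apply/negPn/negP => /hom_separate [Z [ZD' uZ]].
  have [|mu [Zmu _]] := line Z (- i0 Z).
    move=> y yp yt; have /ZD' : y - i0 \in D' by apply: SD'; split=> //; exact: mem_hull.
    by rewrite add_lfunE opp_lfunE.
  move: uZ; rewrite Zmu homZ.
  by move: uY; rewrite annihilatorE => /eqP ->; rewrite mulr0 eqxx.
Qed.

End Hull.

(** * Faces of a Delzant polytope *)

Section DelzantPolytope.
Context {R : realType} {t : vectType R} {T : topologicalZmodType}.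
Variables (exp : {additive t -> T}) (D : polytope t) (n : nat).
Hypotheses (hD : is_delzant_polytope exp D n) (ht : \dim {:t} = n).
Local Notation H := 'Hom(t, R^o).
Implicit Types (x xi u : H) (f : facets D) (v w : vertices D).

(** Half the square of [r_ f]; on C^{F_v} with f in F_v this becomes
    |z_f|^2/2. *)
Definition height f (xi : H) : R := xi (normal f) + offset f.

Lemma heightD f xi u a : height f (xi + a *: u) = height f xi + a * u (normal f).
Proof. by rewrite /height add_lfunE scale_lfunE addrAC. Qed.

(** The zero vector is twice a lattice vector, hence not primitive. *)
Lemma normal_neq0 f : normal f != 0.
Proof.
apply/eqP => f0; have [e0 /(_ 2 0)] := normal_primitive hD f.
by rewrite raddf0 f0 mul0rz => /(_ erefl erefl).
Qed.

Lemma polytope_height f xi : polytope_set D xi -> 0 <= height f xi.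
Proof. exact: delzant_halfspace hD f xi. Qed.

(** A facet is the zero set on the polytope of some affine function; the facet
    has codimension one, so this function is a multiple of [height f]. *)
Lemma facetE f xi : facet f xi <-> polytope_set D xi /\ height f xi = 0.
Proof.
have [[fne [Y [c [Yc fE]]]] [k kn fk]] : is_face (polytope_set D) (facet f) /\
    exists2 k, k.+1 = n & has_affine_dim (facet f) k.
  by apply/(facetsP hD); exists f.
split.
  by move=> fx; split; [move: fx; rewrite fE => -[]|exact: facet_hyperplane hD f xi fx].
move=> [xD xf]; rewrite fE; split => //=.
have fY : forall y, facet f y -> y Y + c = 0 by move=> y; rewrite fE => -[].
have kt : k.+1 = \dim {:t} by rewrite ht.
have [mu [-> ->]] := aff_hyperplane fk kt (normal_neq0 f) (facet_hyperplane hD (f:=f)) fY.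
rewrite homZ -mulrDr; move: xf; rewrite /height => ->; exact: mulr0.
Qed.

(** A point outside is separated from the polytope by a function that vanishes
    on a facet, hence is a positive multiple of the height of that facet.  In
    dimension zero the polytope is the whole space. *)
Lemma polytopeP xi : polytope_set D xi <-> forall f, 0 <= height f xi.
Proof.
split=> [xD f|hf]; first exact: polytope_height.
have [p pE] := delzant_convex hD; have dD := delzant_dim hD.
apply: contrapT; rewrite pE in dD * => px.
have [n0|[m nm]] : n = 0%N \/ exists m, n = m.+1 by case: (n) => [|m]; [left|right; exists m].
  have t0 : \dim {:t} = 0%N by rewrite ht.
  have [x0 [_ [px0 _ _ _]]] := dD; apply: px.
  suff -> : xi = x0 by [].
  apply/eqP; rewrite -subr_eq0; apply/eqP/lfunP => Y.
  suff -> : Y = 0 by rewrite !linear0.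
  have /eqP t00 : ({:t} == 0)%VS by rewrite -dimv_eq0 t0.
  by apply/eqP; rewrite -memv0 -t00 memvf.
have tm : \dim {:t} = m.+1 by rewrite ht.
rewrite nm in dD.
have [Y [c [pY xY Ydim]]] := hull_facet tm dD px.
have [f fE] : exists f, facet f = convex_hull p `&` [set y | y Y + c = 0].
  apply/(facetsP hD); split; last by exists m.
  split; first by have [x0 [_ [? _ _ _]]] := Ydim; exists x0.
  by exists Y, c; rewrite pE.
have Y0 : Y != 0.
  apply/eqP => Y0; have [y0 [_ [py0 _ _ _]]] := dD.
  have := pY _ py0; rewrite Y0 linear0 add0r leNgt.
  by move: xY; rewrite Y0 linear0 add0r => ->.
have GY : forall y : H, (convex_hull p `&` [set y | y Y + c = 0]) y -> y Y + c = 0.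
  by move=> y [].
have Gf : forall y : H, (convex_hull p `&` [set y | y Y + c = 0]) y ->
    y (normal f) + offset f = 0.
  by move=> y; rewrite -fE; exact: facet_hyperplane hD f y.
have [mu [fY fc]] := aff_hyperplane Ydim (esym tm) Y0 GY Gf.
have hE (y : H) : height f y = mu * (y Y + c) by rewrite /height fY fc homZ mulrDr.
have mu0 : 0 < mu.
  rewrite lt_neqAle; apply/andP; split.
    apply/eqP => mu0; move: (normal_neq0 f); rewrite fY -mu0 scale0r eqxx //.
  have [y py yY] : exists2 y, convex_hull p y & y Y + c != 0.
    apply: contrapT => /forall2NP none; move/eqP: Y0; apply.
    have [||//] := @aff_full _ _ (convex_hull p) Y c; first by rewrite tm.
    by move=> y py; case: (none y) => // /negP/negPn/eqP.
  have ypos : 0 < y Y + c by rewrite lt_neqAle eq_sym yY pY.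
  have := @polytope_height f y; rewrite pE => /(_ py).
  by rewrite hE pmulr_lge0.
by have := hf f; rewrite hE pmulr_rge0 // leNgt xY.
Qed.

Lemma vertex_in v : polytope_set D (vertex v).
Proof.
have [_ [Y [c [_ vE]]]] : is_face (polytope_set D) [set vertex v].
  by apply/(verticesP hD); exists v.
by have [] : (polytope_set D `&` [set x | x Y + c = 0]) (vertex v) by rewrite -vE.
Qed.

Lemma FsetP f v : reflect (height f (vertex v) = 0) (f \in Fset v).
Proof.
rewrite inE; apply: (iffP (asboolP _)) => [/facetE []//|h0].
by apply/facetE; split=> //; exact: vertex_in.
Qed.

Lemma Delta_vP v xi : Delta_v v xi <->
  polytope_set D xi /\ forall f, f \notin Fset v -> 0 < height f xi.
Proof.
split=> [[xD xF]|[xD xF]]; split=> //.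
  move=> f fv; rewrite lt_neqAle polytope_height // andbT; apply/eqP => f0.
  by apply: xF; exists f => //; apply/facetE.
by move=> [f fv /facetE [_ f0]]; have := xF f fv; rewrite f0 ltxx.
Qed.

Lemma small_scale (I : eqType) (s : seq I) (a b : I -> R) :
  (forall i, i \in s -> 0 < a i) ->
  exists2 e, 0 < e & forall i, i \in s -> e * `|b i| <= a i.
Proof.
elim: s => [|j s IH] sa; first by exists 1.
have [i si|e e0 eP] := IH; first by apply: sa; rewrite inE si orbT.
have aj : 0 < a j by apply: sa; rewrite mem_head.
have b1 : 0 < 1 + `|b j| by rewrite ltr_wpDr.
exists (Num.min e (a j / (1 + `|b j|))).
  by rewrite lt_min e0 divr_gt0.
move=> i; rewrite inE => /predU1P [->|/[dup] si /eP]; last first.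
  by apply: le_trans; rewrite ler_wpM2r // ge_min lexx.
apply: (@le_trans _ _ (a j / (1 + `|b j|) * `|b j|)).
  by rewrite ler_wpM2r // ge_min lexx orbT.
by rewrite mulrAC ler_pdivrMr // ler_wpM2l ?(ltW aj) // lerDr.
Qed.

(** A vertex can be moved along any direction on which all the normals of its
    facets vanish, so such a direction is zero. *)
Lemma normals_separate v u : (forall f, f \in Fset v -> u (normal f) = 0) -> u = 0.
Proof.
move=> u0.
have [e e0 eP] : exists2 e, 0 < e & forall f, f \in enum [predC Fset v] ->
    e * `|u (normal f)| <= height f (vertex v).
  apply: small_scale => f; rewrite mem_enum /= => fv.
  rewrite lt_neqAle eq_sym; apply/andP; split.
    by apply: contra fv => /eqP fv; apply/FsetP.
  exact: polytope_height (vertex_in v).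
have uP a : `|a| <= e -> polytope_set D (vertex v + a *: u).
  move=> ae; apply/polytopeP => f; rewrite heightD.
  have [fv|fv] := boolP (f \in Fset v).
    by rewrite u0 // mulr0 addr0; apply: polytope_height; exact: vertex_in.
  have : `|a * u (normal f)| <= height f (vertex v).
    apply: le_trans (eP f _); last by rewrite mem_enum.
    by rewrite normrM ler_wpM2r.
  by rewrite ler_norml -subr_ge0 opprK addrC => /andP [].
have [_ [Y [c [Yc vE]]]] : is_face (polytope_set D) [set vertex v].
  by apply/(verticesP hD); exists v.
have vY : vertex v Y + c = 0.
  by have [] : (polytope_set D `&` [set x | x Y + c = 0]) (vertex v) by rewrite -vE.
have eE (a : R) : (vertex v + a *: u) Y + c = a * u Y.
  by rewrite add_lfunE scale_lfunE addrAC vY add0r.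
have uY : u Y = 0.
  have := Yc _ (uP e _); have := Yc _ (uP (- e) _).
  rewrite normrN gtr0_norm // lexx !eE mulNr oppr_ge0 => /(_ isT) h1 /(_ isT) h2.
  have /eqP : e * u Y = 0 by apply: le_anti; rewrite h1 h2.
  by rewrite mulf_eq0 gt_eqF // => /eqP.
have : [set vertex v] (vertex v + e *: u).
  rewrite vE; split; first by apply: uP; rewrite gtr0_norm.
  by rewrite /= eE uY mulr0.
move=> /= /eqP; rewrite addrC -subr_eq0 addrK scaler_eq0 gt_eqF //=.
by move/eqP.
Qed.

(** Otherwise the ray in this direction would stay in the polytope, which is
    bounded. *)
Lemma bounded_direction xi u : polytope_set D xi -> u != 0 ->
  exists f, u (normal f) < 0.
Proof.
move=> xD u0; apply: contrapT => /forallNP uf.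
have uf0 f : 0 <= u (normal f) by rewrite leNgt; apply/negP.
have rayD (a : R) : 0 <= a -> polytope_set D (xi + a *: u).
  move=> a0; apply/polytopeP => f; rewrite heightD addr_ge0 ?mulr_ge0 //.
  exact: polytope_height.
have [Z uZ] : exists Z, 0 < u Z.
  have [Z uZ] := hom_neq0 u0.
  have [|] := ltP 0 (u Z); first by exists Z.
  by exists (- Z); rewrite linearN oppr_gt0 lt_neqAle uZ.
have [p pE] := delzant_convex hD; have [B pB] := hull_bounded p Z.
have pos : 0 <= (`|B| + `|xi Z| + 1) / u Z by rewrite divr_ge0 ?(ltW uZ) // !addr_ge0.
have := pB (xi + ((`|B| + `|xi Z| + 1) / u Z) *: u).
rewrite -pE => /(_ (rayD _ pos)).
rewrite add_lfunE scale_lfunE /GRing.scale /= divfK ?gt_eqF //.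
have := ler_norm (- xi Z); rewrite normrN; have := ler_norm B; lra.
Qed.

(** A point of a face with as many active facets as possible is a vertex:
    otherwise it could be moved along a line inside that face until a further
    facet becomes active. *)
Lemma vertex_below xi : polytope_set D xi ->
  exists v, forall f, height f xi = 0 -> f \in Fset v.
Proof.
move=> xD.
pose act (x : H) : {set facets D} := [set f | height f x == 0]%SET.
pose P m := `[< exists x, [/\ polytope_set D x, act xi \subset act x & #|act x| = m] >].
have exP : exists m, P m by exists #|act xi|; apply/asboolP; exists xi.
have bP m : P m -> (m <= #|facets D|)%N by move=> /asboolP [x [_ _ <-]]; exact: max_card.
case: (ex_maxnP exP bP) => M /asboolP [x [xP xix xM]] maxM.
have sep u : (forall f, height f x = 0 -> u (normal f) = 0) -> u = 0.
  move=> u0; apply/eqP/negPn/negP => un0.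
  have [f0 uf0] := bounded_direction xP un0.
  have [||r r0 [rP [f1 [_ uf1 rf1]]]] :=
    @ratio_test R _ (enum (facets D)) (fun f => height f x) (fun f => u (normal f)).
  - by move=> f _; exact: polytope_height.
  - by exists f0; rewrite // mem_enum.
  have : P #|act (x + r *: u)|.
    apply/asboolP; exists (x + r *: u); split=> //.
      by apply/polytopeP => f; rewrite heightD rP // mem_enum.
    apply: (fintype.subset_trans xix); apply/fintype.subsetP => f; rewrite !inE heightD => /eqP fx.
    by rewrite fx u0 // mulr0 addr0.
  move/maxM; rewrite -xM leqNgt => /negP; apply; apply: proper_card.
  apply/properP; split.
    apply/fintype.subsetP => f; rewrite !inE heightD => /eqP fx.
    by rewrite fx u0 // mulr0 addr0.
  exists f1; rewrite !inE ?heightD ?rf1 //.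
  by apply: contraTN uf1 => /eqP f1x; rewrite u0 // ltxx.
have : is_face (polytope_set D) [set x].
  split; first by exists x.
  exists (\sum_(f in act x) normal f), (\sum_(f in act x) offset f).
  have E (y : H) : y (\sum_(f in act x) normal f) + \sum_(f in act x) offset f =
      \sum_(f in act x) height f y by rewrite linear_sum big_split.
  split=> [y yD|]; first by rewrite E sumr_ge0 // => f _; exact: polytope_height.
  apply/seteqP; split=> y /=.
    by move=> ->; split=> //=; rewrite E big1 // => f; rewrite inE => /eqP.
  move=> [yD /=]; rewrite E => /eqP.
  rewrite psumr_eq0 => [/allP y0|f _]; last exact: polytope_height.
  apply/eqP; rewrite -subr_eq0; apply/eqP; apply: sep => f fx.
  have /eqP fy : height f y == 0.
    by have := y0 f (mem_index_enum _); rewrite inE fx eqxx.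
  rewrite add_lfunE opp_lfunE -[y _](addrK (offset f)) -[x _](addrK (offset f)).
  by move: fx fy; rewrite /height => -> ->; rewrite subrr.
move=> /(verticesP hD) [v vx]; exists v => f fxi.
apply/FsetP; rewrite vx; apply/eqP.
by move/fintype.subsetP: xix => /(_ f); rewrite !inE fxi eqxx => ->.
Qed.

Lemma Delta_cover xi : polytope_set D xi -> exists v, Delta_v v xi.
Proof.
move=> xD; have [v vP] := vertex_below xD; exists v; apply/Delta_vP; split=> // f.
apply: contraR => fx; apply: vP; apply: le_anti.
by apply/andP; split; [rewrite leNgt|exact: polytope_height].
Qed.

(** No facet contains the polytope, so each height is positive somewhere; the
    average of such points works for all facets at once. *)
Lemma interior_point : exists xi, forall f, 0 < height f xi.
Proof.
have [x0 [D0 [x0D _ _ _]]] := delzant_dim hD.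
have ex f : exists xi, polytope_set D xi /\ 0 < height f xi.
  apply: contrapT => /forallNP none.
  have /eqP := normal_neq0 f; apply.
  have [||//] := @aff_full _ _ (polytope_set D) (normal f) (offset f).
    by rewrite ht; exact: delzant_dim hD.
  move=> y yD; apply: le_anti; apply/andP; split; last exact: polytope_height.
  by rewrite leNgt; apply/negP => fy; apply: (none y).
have {ex} [s sP] : {s : facets D -> H & forall f, polytope_set D (s f) /\ 0 < height f (s f)}.
  exact: (choice ex).
have [N0|N0] := posnP #|facets D|.
  by exists x0 => f; have := card0_eq N0 f.
pose N : R := #|facets D|%:R; have Np : 0 < N by rewrite ltr0n.
exists (N^-1 *: \sum_f s f) => f.
have -> : height f (N^-1 *: \sum_f s f) = N^-1 * \sum_g height f (s g).
  rewrite /height scale_lfunE sum_lfunE big_split /= sumr_const -/N mulrDr.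
  by rewrite -[offset f *+ _]mulr_natl mulrA mulVf ?mul1r // gt_eqF.
rewrite mulr_gt0 ?invr_gt0 // (bigD1 f) //= ltr_pwDl ?(sP f).2 //.
by apply: sumr_ge0 => g _; apply: polytope_height; have [] := sP g.
Qed.

End DelzantPolytope.

(** * The torus and its integral lattice *)

Section OpenDomains.
Context {R : realType}.

(** A chart is an injective continuous map on its open domain, so sets inside
    the domain are open when their images are. *)
Lemma open_of_chart_image d (M : topologicalType) (A : atlas R M) (a : chart_idx A) S :
  is_manifold d A -> S `<=` chart_dom a -> open (chart a @` S) -> open S.
Proof.
move=> mA Sa oS; rewrite openE => x Sx; rewrite /interior.
have xa := Sa _ Sx.
have /(chart_continuous mA xa) cS : nbhs (chart a x) (chart a @` S).
  by apply: open_nbhs_nbhs; split=> //; exists x.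
have nx : nbhs x (chart_dom a) by apply: open_nbhs_nbhs; split=> //; exact: chart_open_dom mA a.
apply: filterS2 nx cS => y ya [z Sz zy].
by rewrite -(chart_inj mA (mem_set (Sa _ Sz)) (mem_set ya) zy).
Qed.

(** Smoothness on a set asserts that its images in the charts are open. *)
Lemma open_of_smooth_map d (M : topologicalType) (N : Type) (A : atlas R M) (B : atlas R N)
    U f : is_manifold d A -> (forall y : N, exists b : chart_idx B, chart_dom b y) ->
  smooth_map A B U f -> open U.
Proof.
move=> mA cB sf.
have -> : U = \bigcup_(ab : chart_idx A * chart_idx B)
    [set x | [/\ U x, chart_dom ab.1 x & chart_dom ab.2 (f x)]].
  apply/seteqP; split=> [x Ux|x [ab _ []]//].
  have [a xa] := manifold_cover mA x; have [b xb] := cB (f x).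
  by exists (a, b).
apply: bigcup_open => -[a b] _ /=.
have [g _ [og _]] := sf a b.
by apply: open_of_chart_image mA _ og => x [].
Qed.

End OpenDomains.

Section Coordinates.
Context {R : realType} {t : vectType R}.

Lemma scalar_sum (l : t -> R) (I : Type) (r : seq I) (P : pred I) (c : I -> R) (Y : I -> t) :
  (forall a Y Z, l (a *: Y + Z) = a * l Y + l Z) ->
  l (\sum_(i <- r | P i) c i *: Y i) = \sum_(i <- r | P i) c i * l (Y i).
Proof.
move=> ll.
have l0 : l 0 = 0 by have := ll (-1) 0 0; rewrite scaler0 addr0 mulN1r addrC subrr; exact.
have lD : {morph l : a b / a + b >-> a + b}.
  by move=> a b; rewrite -[a in LHS]scale1r ll mul1r.
rewrite (big_morph l lD l0); apply: eq_bigr => j _.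
by rewrite -[_ *: _]addr0 ll l0 addr0.
Qed.

(** The chart of the Lie algebra used by [vect_atlas], as a linear map. *)
Definition vcoords (Y : t) : 'rV[R]_(dim t) := VectorInternalTheory.v2r Y.

Lemma vcoords_is_linear : linear vcoords.
Proof.
move=> a u v; rewrite /vcoords /VectorInternalTheory.v2r.
by case: (VectorInternalTheory.v2r_subproof _) => f [sl sa] b /=; rewrite sa sl.
Qed.

HB.instance Definition _ := GRing.isLinear.Build R t 'rV[R]_(dim t) _ vcoords vcoords_is_linear.

Lemma vcoords_inj : injective vcoords.
Proof. exact: VectorInternalTheory.v2r_inj. Qed.

End Coordinates.

Section Torus.
Context {R : realType} {t : vectType R} {T : topologicalZmodType}.
Variables (n : nat) (AT : atlas R T) (exp : {additive t -> T}).
Hypothesis (hT : is_torus n AT exp).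

Lemma translate_open (O : set T) g : open O -> open [set x | O (x - g)].
Proof.
move=> oO; apply: (open_comp (f := fun x : T => x - g)) oO => x _.
by apply: (@continuous_comp _ _ _ (fun x : T => (x, g)) (fun p : T * T => p.1 - p.2));
  [apply: cvg_pair => /=; [exact: cvg_id|exact: cvg_cst]|exact: sub_continuous].
Qed.

(** The image of the exponential map is a subgroup that contains a
    neighbourhood of 0, so it and its complement are unions of open cosets. *)
Lemma exp_surjective g : exists Y, exp Y = g.
Proof.
have [W [U [W0 [[WU _ UW] _ [h sh _]]]]] := torus_local_diffeo hT.
have oU : open U.
  by apply: open_of_smooth_map (torus_manifold hT) _ sh => y; exists tt.
have U0 : U 0 by have := WU _ W0; rewrite raddf0.
have Uexp x : U x -> exists Y, exp Y = x by move/UW => [Y _ <-]; exists Y.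
suff : range exp = setT by move/seteqP => [_ /(_ g Logic.I) [Y _ <-]]; exists Y.
apply: (torus_connected hT).
- by exists 0, 0; rewrite ?raddf0.
- exists (range exp); last by rewrite setTI.
  rewrite openE => _ [Y _ <-].
  have : nbhs (exp Y) [set x | U (x - exp Y)].
    by apply: open_nbhs_nbhs; split; [exact: translate_open|rewrite /= subrr].
  by apply: filterS => x /Uexp [Z ZE]; exists (Z + Y); rewrite // raddfD /= ZE subrK.
- exists (range exp); last by rewrite setTI.
  rewrite -openC openE => x nx.
  have : nbhs x [set y | U (y - x)].
    by apply: open_nbhs_nbhs; split; [exact: translate_open|rewrite /= subrr].
  apply: filterS => y /Uexp [Z ZE] [Y _ YE]; apply: nx; exists (Y - Z) => //.
  by rewrite raddfB /= ZE YE opprB addrC subrK.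
Qed.

(** The lattice is discrete. *)
Lemma exp_injective_near0 : exists2 e, 0 < e &
  forall Y, (forall j, `|vcoords Y 0 j| < e) -> exp Y = 0 -> Y = 0.
Proof.
have [W [U [W0 [[WU injW UW] sexp _]]]] := torus_local_diffeo hT.
have [b b0] := manifold_cover (torus_manifold hT) (0 : T).
have [_ _ [oV _]] := sexp tt b.
set S := (X in open (_ @` X)) in oV.
have S0 : nbhs (0 : 'rV[R]_(dim t)) (vcoords @` S).
  apply: open_nbhs_nbhs; split=> //; exists 0; last exact: linear0.
  by split=> //; rewrite raddf0.
have /nbhs_ballP [e /= e0 eS] := S0.
exists e => // Y Ye Y0.
have [|Z [WZ _ _] /vcoords_inj ZY] := eS (vcoords Y).
  by split=> // i j; rewrite !ord1 mxE /ball /= sub0r normrN.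
rewrite -ZY; apply: injW; rewrite ?inE //.
by rewrite ZY Y0 raddf0.
Qed.

End Torus.

Section Lattice.
Context {R : realType} {t : vectType R} {T : topologicalZmodType}.
Variables (n : nat) (AT : atlas R T) (exp : {additive t -> T}) (D : polytope t).
Hypotheses (hT : is_torus n AT exp) (hD : is_delzant_polytope exp D n).
Implicit Types (v w : vertices D).

Let ht : \dim {:t} = n := torus_lie_dim hT.

Lemma exp_normal (f : facets D) : exp (normal f) = 0.
Proof. by have [] := normal_primitive hD f. Qed.

Lemma exp_int_comb v (c : Fv v -> int) : exp (\sum_f normal (val f) *~ c f) = 0.
Proof. by rewrite raddf_sum big1 // => f _; rewrite raddfMz exp_normal mul0rz. Qed.

(** Zero has only one expansion in the lattice basis. *)
Lemma normals_int_free v (c : Fv v -> int) :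
  \sum_f normal (val f) *~ c f = 0 -> forall f, c f = 0.
Proof.
move=> c0 f; have [c1 [_ c1P]] := delzant_basis hD v (raddf0 exp).
have e1 : 0 = \sum_(f : Fv v) normal (val f) *~ [ffun f => c f] f.
  by rewrite -[LHS]c0; apply: eq_bigr => g _; rewrite ffunE.
have e2 : 0 = \sum_(f : Fv v) normal (val f) *~ ([ffun => 0] : {ffun Fv v -> int}) f.
  by rewrite big1 // => g _; rewrite ffunE mulr0z.
have := c1P _ e1; rewrite (c1P _ e2) => /ffunP /(_ f).
by rewrite !ffunE.
Qed.

(** Dirichlet's argument: a nontrivial real relation among the normals would
    have two integer multiples with nearly equal fractional parts; the
    difference of their integer parts is then a lattice vector that is small,
    hence zero, contradicting independence over the integers. *)
Lemma normals_free v (a : Fv v -> R) :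
  \sum_f a f *: normal (val f) = 0 -> forall f, a f = 0.
Proof.
move=> a0 f0; apply/eqP/negPn/negP => af0.
have [e e0 small] := exp_injective_near0 hT.
pose S := \sum_(f : Fv v) \sum_j `|vcoords (normal (val f)) 0 j|.
have S0 : 0 <= S by apply: sumr_ge0 => f _; apply: sumr_ge0.
pose L := (Num.trunc (S / e)).+1.
have L0 : 0 < L%:R :> R by rewrite ltr0n.
have SL : S / L%:R < e.
  by rewrite ltr_pdivrMr // mulrC -ltr_pdivrMr // truncnS_gt.
pose N : R := (Num.trunc `|a f0|^-1).+1%:R.
have Na : 1 < N * `|a f0|.
  by rewrite -ltr_pdivrMr ?normr_gt0 // mul1r truncnS_gt.
pose x (i : nat) f := N * i%:R * a f.
pose frac (y : R) := y - (Num.floor y)%:~R.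
have frac01 y : 0 <= frac y < 1.
  have := floor_itv y; rewrite /frac intrD => /andP [h1 h2].
  by rewrite subr_ge0 h1 ltrBlDl.
pose q (i : nat) f := Num.trunc (L%:R * frac (x i f)).
have qitv i f : (q i f)%:R <= L%:R * frac (x i f) < (q i f).+1%:R.
  by apply: truncn_itv; rewrite mulr_ge0 // ?(ltW L0) //; case/andP: (frac01 (x i f)).
have qL i f : (q i f < L)%N.
  have /andP [q1 _] := qitv i f; rewrite -(ltr_nat R); apply: le_lt_trans q1 _.
  by rewrite -[ltRHS]mulr1 ltr_pM2l //; case/andP: (frac01 (x i f)).
pose cell (i : 'I_(#|{ffun Fv v -> 'I_L}|).+1) := [ffun f : Fv v => Ordinal (qL i f)].
(* The multiples x i of the relation, i = 0, ..., L^#|F_v|, are sorted by the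
   cell of side 1/L that contains their fractional parts; N is chosen such that
   distinct multiples have distinct integer parts at f0. *)
have [i [j [ij cij]]] : exists i j, i != j /\ cell i = cell j.
  have /injectivePn [i [j ij cij]] : ~~ injectiveb cell.
    by apply/negP => /injectiveP /leq_card; rewrite card_ord ltnn.
  by exists i, j.
have qij f : q i f = q j f by have /ffunP /(_ f) := cij; rewrite !ffunE => -[].
pose c f := Num.floor (x i f) - Num.floor (x j f).
have xa (k : nat) : \sum_f x k f *: normal (val f) = 0.
  by rewrite /x; under eq_bigr do rewrite -scalerA; rewrite -scaler_sumr a0 scaler0.
pose d f := frac (x i f) - frac (x j f).
have dc : \sum_f d f *: normal (val f) = - \sum_f normal (val f) *~ c f.
  apply/eqP; rewrite -addr_eq0; apply/eqP.
  transitivity (\sum_f x i f *: normal (val f) - \sum_f x j f *: normal (val f)); last first.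
    by rewrite !xa subrr.
  rewrite -big_split -sumrB; apply: eq_bigr => f _ /=.
  rewrite -scaler_int -scalerDl -scalerBl /d /frac /c; congr (_ *: _).
  by rewrite intrB; ring.
have dL f : `|d f| <= L%:R^-1.
  rewrite -(ler_pM2l L0) mulfV ?gt_eqF // -[X in X * _](gtr0_norm L0) -normrM mulrBr.
  have := qitv i f; have := qitv j f; rewrite qij -natr1 ler_norml => /andP [h1 h2] /andP [h3 h4].
  by apply/andP; split; clear -h1 h2 h3 h4; lra.
have c0 : \sum_f normal (val f) *~ c f = 0.
  rewrite -[LHS]opprK -dc; apply/eqP; rewrite oppr_eq0; apply/eqP; apply: small; last first.
    by rewrite dc raddfN exp_int_comb oppr0.
  move=> k; apply: le_lt_trans SL.
  rewrite linear_sum summxE; apply: le_trans (ler_norm_sum _ _ _) _.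
  rewrite mulr_suml; apply: ler_sum => f _.
  rewrite linearZ mxE normrM mulrC ler_pM //.
  by rewrite (bigD1 k) //= lerDl sumr_ge0.
have /eqP := normals_int_free c0 f0; rewrite subr_eq0 => /eqP fij.
have := frac01 (x i f0); have := frac01 (x j f0).
rewrite /frac fij => /andP [h1 h2] /andP [h3 h4].
have : `|x i f0 - x j f0| < 1 by rewrite ltr_norml; apply/andP; split; lra.
have -> : x i f0 - x j f0 = N * a f0 * (i%:R - j%:R) by rewrite /x; ring.
rewrite !normrM ger0_norm ?ler0n //; apply/negP; rewrite -leNgt.
apply: le_trans (ltW Na) _; rewrite ler_peMr //; first by rewrite (le_trans ler01 (ltW Na)).
have : (i : nat) != j by [].
rewrite neq_ltn => /orP [lt|lt].
  rewrite distrC ger0_norm ?subr_ge0 ?ler_nat ?(ltnW lt) // -natrB ?(ltnW lt) // ler1n.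
  by rewrite subn_gt0.
rewrite ger0_norm ?subr_ge0 ?ler_nat ?(ltnW lt) // -natrB ?(ltnW lt) // ler1n.
by rewrite subn_gt0.
Qed.

(** A functional that vanishes on all the normals at a vertex is zero. *)
Lemma normals_span v Y : exists c : Fv v -> R, Y = \sum_f c f *: normal (val f).
Proof.
pose S := (\sum_(f : Fv v) <[normal (val f)]>)%VS.
have /memv_sumP [y yP ->] : Y \in S.
  apply/negPn/negP => /lin_separate [u [uS /eqP]]; apply.
  have -> : u = 0.
    apply: (normals_separate hD ht (v := v)) => f fv; apply: uS.
    apply: (subvP (sumv_sup (Sub f fv : Fv v) _ (subvv _))) => //.
    by rewrite SubK memv_line.
  by rewrite zero_lfunE.
have /choice [c cP] : forall f, exists c, y f = c *: normal (val f).
  by move=> f; apply/vlineP; exact: yP.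
by exists c; apply: eq_bigr.
Qed.

(** Coordinates with respect to the basis of normals at [v]. *)
Definition ncoord v (Y : t) : Fv v -> R :=
  xget (fun=> 0) [set c : Fv v -> R | Y = \sum_f c f *: normal (val f)].

Arguments ncoord : clear implicits.

Lemma ncoordP v Y : \sum_f ncoord v Y f *: normal (val f) = Y.
Proof.
rewrite /ncoord; case: xgetP => [c _ /= {1}-> //|none].
by have [c cP] := normals_span v Y; case: (none c).
Qed.

Lemma ncoord_uniq v (c : Fv v -> R) : ncoord v (\sum_f c f *: normal (val f)) = c.
Proof.
apply/funext => f; apply/eqP; rewrite -subr_eq0; apply/eqP; move: f.
apply: normals_free; under eq_bigr do rewrite scalerBl.
by rewrite sumrB ncoordP subrr.
Qed.

Lemma ncoord_is_linear v : linear (fun Y => \row_(i < #|Fv v|) ncoord v Y (enum_val i)).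
Proof.
move=> a Y Z; apply/rowP => i; rewrite !mxE.
have -> : a *: Y + Z = \sum_f (a * ncoord v Y f + ncoord v Z f) *: normal (val f).
  under eq_bigr do rewrite scalerDl -scalerA.
  by rewrite big_split -scaler_sumr /= !ncoordP.
by rewrite ncoord_uniq.
Qed.

Lemma ncoordDZ v a Y Z f : ncoord v (a *: Y + Z) f = a * ncoord v Y f + ncoord v Z f.
Proof. by have /rowP/(_ (enum_rank f)) := ncoord_is_linear v a Y Z; rewrite !mxE enum_rankK. Qed.

Lemma ncoord0 v : ncoord v 0 = fun=> 0.
Proof.
rewrite -[RHS]ncoord_uniq; congr ncoord.
by rewrite big1 // => f _; rewrite scale0r.
Qed.

Lemma ncoord_normal v (f : Fv v) : ncoord v (normal (val f)) = fun k => (k == f)%:R.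
Proof.
have {1}-> : normal (val f) = \sum_k (k == f)%:R *: normal (val k).
  rewrite (bigD1 f) //= eqxx scale1r big1 ?addr0 // => k /negbTE ->.
  by rewrite scale0r.
exact: ncoord_uniq.
Qed.

Lemma dual_basis v (c : Fv v -> R) :
  exists xi : 'Hom(t, R^o), forall f, xi (normal (val f)) = c f.
Proof.
pose l (Y : t) : R^o := \sum_f ncoord v Y f * c f.
have ll : linear l.
  move=> a Y Z; rewrite /l /GRing.scale /= mulr_sumr -big_split; apply: eq_bigr => f _.
  by rewrite /= ncoordDZ mulrDl mulrA.
pose L := GRing.isLinear.Build R t R^o _ l ll.
pose l' : {linear t -> R^o} := HB.pack l L.
exists (linfun l') => f; rewrite lfunE /= /l ncoord_normal.
rewrite (bigD1 f) //= eqxx mul1r big1 ?addr0 // => g /negbTE ->.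
by rewrite mul0r.
Qed.

Lemma card_Fv v : #|Fv v| = n.
Proof.
pose X := [tuple normal (val (enum_val i)) | i < #|Fv v|].
have fX : free X.
  apply/freeP => k; under eq_bigr do rewrite -tnth_nth tnth_mktuple.
  move=> k0 i; have := @normals_free v (fun f => k (enum_rank f)) _ (enum_val i).
  rewrite enum_valK; apply; rewrite -[RHS]k0 (reindex (fun i : 'I_#|Fv v| => enum_val i)) /=; last first.
    by apply: onW_bij; exact: enum_val_bij.
  by apply: eq_bigr => j _; rewrite enum_valK.
have sX : <<X>>%VS = fullv.
  apply/eqP; rewrite eqEsubv subvf /=; apply/subvP => Y _.
  have [c ->] := normals_span v Y; apply: memv_suml => f _; apply: memvZ.
  apply: memv_span; have := mem_tnth (enum_rank f) X.
  by rewrite tnth_mktuple enum_rankK.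
by rewrite -ht -sX; move: fX; rewrite /free size_tuple => /eqP.
Qed.

End Lattice.

Arguments ncoord {R t D} v Y _.

(** * Complex-valued smooth functions *)

Section ComplexFunctions.
Local Open Scope complex_scope.
Context {R : realType}.
Implicit Types (z : R[i]).

Notation Re := complex.Re.
Notation Im := complex.Im.

Lemma ReM z z' : Re (z * z') = Re z * Re z' - Im z * Im z'.
Proof. by case: z => a b; case: z' => c d. Qed.

Lemma ImM z z' : Im (z * z') = Re z * Im z' + Im z * Re z'.
Proof. by case: z => a b; case: z' => c d. Qed.

Lemma complex_ext z z' : Re z = Re z' -> Im z = Im z' -> z = z'.
Proof. by case: z => a b; case: z' => c d /= -> ->. Qed.

Definition sqnorm z : R := Re z ^+ 2 + Im z ^+ 2.

Lemma sqnorm_ge0 z : 0 <= sqnorm z.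
Proof. by rewrite addr_ge0 // sqr_ge0. Qed.

Lemma sqnorm_eq0 z : (sqnorm z == 0) = (z == 0).
Proof. by rewrite eq_complex /sqnorm paddr_eq0 ?sqr_ge0 // !sqrf_eq0. Qed.

Lemma normc_sqrt z : Normc.normc z = Num.sqrt (sqnorm z).
Proof. by case: z. Qed.

Lemma normc_sq z : Normc.normc z ^+ 2 = sqnorm z.
Proof. by rewrite normc_sqrt sqr_sqrtr // sqnorm_ge0. Qed.

Lemma sqnorm_gt0 z : (0 < sqnorm z) = (z != 0).
Proof. by rewrite lt_neqAle sqnorm_ge0 andbT eq_sym sqnorm_eq0. Qed.

Lemma normcC z : `|z| = (Normc.normc z)%:C.
Proof. by rewrite normc_def normc_sqrt. Qed.

Lemma sqnormM z z' : sqnorm (z * z') = sqnorm z * sqnorm z'.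
Proof. by rewrite -!normc_sq Normc.normcM exprMn. Qed.

(** z/|z|, written with a real factor so that its real and imaginary parts are
    visibly smooth. *)
Definition csgn z : R[i] := z * ((Num.sqrt (sqnorm z))^-1)%:C.

Lemma csgnE z : csgn z = z / `|z|.
Proof. by rewrite normcC normc_sqrt /csgn fmorphV. Qed.

Lemma sqnorm_real (a : R) : sqnorm a%:C = a ^+ 2.
Proof. by rewrite /sqnorm /= expr0n addr0. Qed.

Lemma sqnorm_csgn z : z != 0 -> sqnorm (csgn z) = 1.
Proof.
move=> z0; rewrite sqnormM sqnorm_real exprVn sqr_sqrtr ?sqnorm_ge0 //.
by rewrite mulfV // sqnorm_eq0.
Qed.

(** Integer powers of a complex number of modulus one, polynomial in its real
    and imaginary parts. *)
Definition cpow (u : R[i]) (k : int) : R[i] :=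
  match k with Posz m => u ^+ m | Negz m => (conjc u) ^+ m.+1 end.

Lemma cpowE u k : sqnorm u = 1 -> cpow u k = u ^ k.
Proof.
case: k => // m u1; rewrite /= NegzE -exprnN -exprVn; congr (_ ^+ _).
have u0 : u != 0 by rewrite -sqnorm_gt0 u1.
apply: (mulfI u0); rewrite divff //.
by apply: complex_ext; rewrite ?ReM ?ImM; case: u u1 {u0} => a b /= ab; rewrite -?ab /sqnorm /=; ring.
Qed.

Lemma sqnorm_cpow u k : sqnorm u = 1 -> sqnorm (cpow u k) = 1.
Proof.
move=> u1; have X (v : R[i]) m : sqnorm v = 1 -> sqnorm (v ^+ m) = 1.
  move=> v1; elim: m => [|m IH]; first by rewrite expr0 sqnorm_real expr1n.
  by rewrite exprS sqnormM v1 IH mulr1.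
case: k => m /=; apply: X => //.
by rewrite -u1; case: u {u1} => a b; rewrite /sqnorm /= sqrrN.
Qed.

Section Smoothness.
Context {m : nat}.
Implicit Types (U : set 'rV[R]_m) (F G : 'rV[R]_m -> R[i]).

Definition csmooth U F := smooth_on U (fun x => Re (F x)) /\ smooth_on U (fun x => Im (F x)).

Lemma csmooth_eq U F G : (forall x, U x -> F x = G x) -> csmooth U F -> csmooth U G.
Proof.
by move=> FG [rF iF]; split; [apply: smooth_on_eq rF|apply: smooth_on_eq iF] => x /FG ->.
Qed.

Lemma csmooth_local U F : open U ->
  (forall x, U x -> exists2 W, W x & csmooth W F) -> csmooth U F.
Proof.
move=> oU UF; split; apply: smooth_onP => // x /UF [W Wx [rF iF]]; by exists W.
Qed.

Lemma csmooth_cst U (c : R[i]) : open U -> csmooth U (fun=> c).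
Proof. by move=> oU; split; apply: smooth_cst. Qed.

Lemma csmoothM U F G : csmooth U F -> csmooth U G -> csmooth U (fun x => F x * G x).
Proof.
move=> [rF iF] [rG iG]; split.
  apply: smooth_on_eq (smoothD (smoothM rF rG) (smoothN (smoothM iF iG))) => x _.
  by rewrite ReM.
apply: smooth_on_eq (smoothD (smoothM rF iG) (smoothM iF rG)) => x _.
by rewrite ImM.
Qed.

Lemma csmooth_real U (f : 'rV[R]_m -> R) : smooth_on U f -> csmooth U (fun x => (f x)%:C).
Proof. by move=> sf; split=> //; apply: smooth_cst; case: sf. Qed.

Lemma csmooth_conj U F : csmooth U F -> csmooth U (fun x => conjc (F x)).
Proof.
move=> [rF iF]; split.
  by apply: smooth_on_eq rF => x _; case: (F x).
by apply: smooth_on_eq (smoothN iF) => x _; case: (F x).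
Qed.

Lemma csmooth_prod U (I : Type) (r : seq I) (P : pred I) (F : I -> 'rV[R]_m -> R[i]) :
  open U -> (forall i, P i -> csmooth U (F i)) ->
  csmooth U (fun x => \prod_(i <- r | P i) F i x).
Proof.
move=> oU sF; elim: r => [|i r IH].
  by apply: csmooth_eq (csmooth_cst 1 oU) => x _; rewrite big_nil.
case Pi: (P i).
  apply: csmooth_eq (csmoothM (sF i Pi) IH) => x _.
  by rewrite big_cons Pi.
by apply: csmooth_eq IH => x _; rewrite big_cons Pi.
Qed.

Lemma csmoothX U F k : csmooth U F -> csmooth U (fun x => F x ^+ k).
Proof.
move=> sF; have oU : open U by case: sF => -[].
elim: k => [|k IH].
  by apply: csmooth_eq (csmooth_cst 1 oU) => x _; rewrite expr0.
by apply: csmooth_eq (csmoothM sF IH) => x _; rewrite exprS.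
Qed.

Lemma csmooth_cpow U F k : csmooth U F -> csmooth U (fun x => cpow (F x) k).
Proof. by case: k => k sF; apply: csmoothX => //; exact: csmooth_conj. Qed.

Lemma smooth_sqnorm U F : csmooth U F -> smooth_on U (fun x => sqnorm (F x)).
Proof.
move=> [rF iF].
by apply: smooth_on_eq (smoothD (smoothM rF rF) (smoothM iF iF)) => x _; rewrite -!expr2.
Qed.

Lemma csmooth_csgn U F : (forall x, U x -> F x != 0) -> csmooth U F ->
  csmooth U (fun x => csgn (F x)).
Proof.
move=> F0 sF; apply: csmoothM => //; apply: csmooth_real; apply: smoothV.
  by move=> x /F0 Fx; rewrite sqrtr_eq0 -ltNge sqnorm_gt0.
by apply: smooth_sqrt (smooth_sqnorm sF) => x /F0; rewrite sqnorm_gt0.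
Qed.

Lemma csmooth_cis U (f : 'rV[R]_m -> R) : smooth_on U f -> csmooth U (fun x => cis (f x)).
Proof.
move=> sf; have oU : open U by case: sf.
have s2 : smooth_on U (fun x => 2 * pi * f x) by apply: smoothM => //; exact: smooth_cst.
by split; [exact: smooth_cos s2|exact: smooth_sin s2].
Qed.

End Smoothness.

Lemma csmooth_comp m p (U : set 'rV[R]_m) (V : set 'rV[R]_p) (f : 'rV[R]_m -> 'rV[R]_p) F :
  (forall x, U x -> V (f x)) -> smooth_to U f -> csmooth V F -> csmooth U (F \o f).
Proof.
by move=> UV sf [rF iF]; split; [exact: smooth_comp UV sf rF|exact: smooth_comp UV sf iF].
Qed.

Section Derivatives.
Context {V : normedModType R}.
Variables (x a : V).
Implicit Types (F G : V -> R[i]).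

Lemma is_derive_add (f g : V -> R) df dg : is_derive x a f df -> is_derive x a g dg ->
  is_derive x a (fun y => f y + g y) (df + dg).
Proof. exact: is_deriveD. Qed.

Lemma is_derive_opp (f : V -> R) df : is_derive x a f df ->
  is_derive x a (fun y => - f y) (- df).
Proof. exact: is_deriveN. Qed.

Lemma is_derive_mul (f g : V -> R) df dg : is_derive x a f df -> is_derive x a g dg ->
  is_derive x a (fun y => f y * g y) (df * g x + f x * dg).
Proof.
move=> fd gd; have h := is_deriveM fd gd; apply: is_derive_eq h _.
by rewrite /GRing.scale /= addrC mulrC.
Qed.

Definition is_cder F (dF : R[i]) :=
  is_derive x a (fun y => Re (F y)) (Re dF) /\ is_derive x a (fun y => Im (F y)) (Im dF).

Lemma is_cder_eq F d d' : is_cder F d -> d = d' -> is_cder F d'.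
Proof. by move=> Fd <-. Qed.

Lemma is_cder_near F G dF : (\near x, F x = G x) -> is_cder F dF -> is_cder G dF.
Proof.
move=> FG [rF iF]; split.
  by apply: near_eq_is_derive rF; near=> y; congr Re; near: y.
by apply: near_eq_is_derive iF; near=> y; congr Im; near: y.
Unshelve. all: by end_near. Qed.

Lemma is_cder_cst c : is_cder (fun=> c) 0.
Proof. by split; exact: is_derive_cst. Qed.

Lemma is_cderM F G dF dG : is_cder F dF -> is_cder G dG ->
  is_cder (fun y => F y * G y) (dF * G x + F x * dG).
Proof.
move=> [rF iF] [rG iG]; split.
  under eq_fun do rewrite ReM.
  apply: is_derive_eq (is_derive_add (is_derive_mul rF rG) (is_derive_opp (is_derive_mul iF iG))) _.
  case: (F x) => ? ?; case: (G x) => ? ?; case: dF {rF iF} => ? ?; case: dG {rG iG} => ? ?.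
  by rewrite /=; ring.
under eq_fun do rewrite ImM.
apply: is_derive_eq (is_derive_add (is_derive_mul rF iG) (is_derive_mul iF rG)) _.
case: (F x) => ? ?; case: (G x) => ? ?; case: dF {rF iF} => ? ?; case: dG {rG iG} => ? ?.
by rewrite /=; ring.
Qed.

Lemma is_cder_real (f : V -> R) df : is_derive x a f df ->
  is_cder (fun y => (f y)%:C) df%:C.
Proof. by move=> fd; split=> //=; exact: is_derive_cst. Qed.

(** Logarithmic derivative [i alpha]: the angular speeds add up in products,
    and negative powers of unit complex numbers are conjugates. *)
Definition rotates F (alpha : R) := is_cder F ('i * alpha%:C * F x).

Lemma rotatesM F G al be : rotates F al -> rotates G be ->
  rotates (fun y => F y * G y) (al + be).
Proof.
move=> rF rG; apply: is_cder_eq (is_cderM rF rG) _.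
by rewrite rmorphD /=; ring.
Qed.

Lemma rotates_conj F al : rotates F al -> rotates (fun y => conjc (F y)) (- al).
Proof.
move=> [rF iF]; split.
  have -> : (fun y => Re (conjc (F y))) = (fun y => Re (F y)) by apply/funext => y; case: (F y).
  by apply: is_derive_eq rF _; case: (F x) => ? ?; rewrite !ReM /=; ring.
have -> : (fun y => Im (conjc (F y))) = (fun y => - Im (F y)) by apply/funext => y; case: (F y).
apply: is_derive_eq (is_derive_opp iF) _.
by case: (F x) => ? ?; rewrite !ImM /=; ring.
Qed.

Lemma rotates1 : rotates (fun=> 1) 0.
Proof. by apply: is_cder_eq (is_cder_cst 1) _; rewrite mulr0 mul0r. Qed.

Lemma rotatesX F al k : rotates F al -> rotates (fun y => F y ^+ k) (k%:R * al).
Proof.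
move=> rF; elim: k => [|k IH]; first by rewrite mul0r; exact: rotates1.
rewrite -natr1 mulrDl mul1r addrC.
by under eq_fun do rewrite exprS; exact: rotatesM.
Qed.

Lemma rotates_cpow F al k : rotates F al -> rotates (fun y => cpow (F y) k) (k%:~R * al).
Proof.
case: k => k rF; first exact: rotatesX.
by rewrite NegzE mulrNz mulNr -mulrN; apply: rotatesX; exact: rotates_conj.
Qed.

Lemma rotates_prod (I : Type) (r : seq I) (P : pred I) (F : I -> V -> R[i]) al :
  (forall i, P i -> rotates (F i) (al i)) ->
  rotates (fun y => \prod_(i <- r | P i) F i y) (\sum_(i <- r | P i) al i).
Proof.
move=> rF; elim: r => [|i r IH].
  by rewrite big_nil; under eq_fun do rewrite big_nil; exact: rotates1.
rewrite big_cons; under eq_fun do rewrite big_cons.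
by case Pi: (P i) => //; apply: rotatesM => //; exact: rF.
Qed.

Lemma is_derive_comp1 (h : R -> R) dh (f : V -> R) df : is_derive (f x) 1 h dh ->
  differentiable f x -> is_derive x a f df -> is_derive x a (h \o f) (dh * df).
Proof.
move=> hd fd [_ <-]; have [dhf E] := diff_comp1 hd fd.
by apply: DeriveDef; [exact: diff_derivable|exact: E].
Qed.

Lemma is_derive_sqnorm F dF : is_cder F dF ->
  is_derive x a (fun y => sqnorm (F y)) (2 * Re (conjc (F x) * dF)).
Proof.
move=> [rF iF]; rewrite /sqnorm; under eq_fun do rewrite !expr2.
apply: is_derive_eq (is_derive_add (is_derive_mul rF rF) (is_derive_mul iF iF)) _.
by rewrite ReM; case: (F x) => ? ? /=; ring.
Qed.

(** The real part of the logarithmic derivative of [F] is cancelled by the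
    normalization; the imaginary part is the differential of the angle. *)
Lemma rotates_csgn F dF : F x != 0 -> differentiable (fun y => sqnorm (F y)) x ->
  is_cder F dF -> rotates (fun y => csgn (F y)) (Im (conjc (F x) * dF) / sqnorm (F x)).
Proof.
move=> F0 dfb Fd; have N0 : 0 < sqnorm (F x) by rewrite sqnorm_gt0.
pose s := Num.sqrt (sqnorm (F x)); have s0 : s != 0 by rewrite sqrtr_eq0 -ltNge.
have sN : sqnorm (F x) = s ^+ 2 by rewrite sqr_sqrtr // ltW.
have Vd : is_derive (sqnorm (F x)) 1 (fun y : R => (Num.sqrt y)^-1) (- (s ^- 2) * (2 * s)^-1).
  have sd := is_derive1_sqrt N0; have [sdv sdE] := sd.
  apply: DeriveDef; first exact: derivableV.
  by rewrite deriveV // sdE.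
apply: is_cder_eq (is_cderM Fd (is_cder_real (is_derive_comp1 Vd dfb (is_derive_sqnorm Fd)))) _.
rewrite /csgn /comp -/s sN; move: sN; rewrite {1}/sqnorm; case: (F x) => p q /=; case: dF {Fd} => c d /= sN.
apply: complex_ext; rewrite ?ReM ?ImM /= -/s.
  have -> : c / s = c * (p ^+ 2 + q ^+ 2) / s ^+ 3 by rewrite sN; field.
  by field.
have -> : d / s = d * (p ^+ 2 + q ^+ 2) / s ^+ 3 by rewrite sN; field.
by field.
Qed.

End Derivatives.

End ComplexFunctions.

(** * Coordinates on C^I *)

Section ComplexVectorSpace.
Local Open Scope complex_scope.
Context {R : realType}.
Implicit Types (I J : finType).

Notation Re := complex.Re.
Notation Im := complex.Im.

Definition uncoords I (x : 'rV[R]_(#|I| + #|I|)) : cspace R I :=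
  fun i => x 0 (lshift #|I| (enum_rank i)) +i* x 0 (rshift #|I| (enum_rank i)).

Lemma coordsK I : cancel (@coords R I) (@uncoords I).
Proof.
move=> z; apply/funext => i; apply: complex_ext; rewrite /= /coords.
  by rewrite row_mxEl mxE enum_rankK.
by rewrite row_mxEr mxE enum_rankK.
Qed.

Lemma uncoordsK I : cancel (@uncoords I) (@coords R I).
Proof.
move=> x; rewrite /coords /uncoords -[RHS]hsubmxK.
by congr row_mx; apply/rowP => k; rewrite !mxE enum_valK.
Qed.

Lemma coords_inj I : injective (@coords R I).
Proof. exact: can_inj (@coordsK I). Qed.

Lemma coords_image I (S : set (cspace R I)) : @coords R I @` S = @uncoords I @^-1` S.
Proof.
apply/seteqP; split=> [_ [z Sz <-]|x Sx]; first by rewrite /= coordsK.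
by exists (uncoords x); rewrite ?uncoordsK.
Qed.

Lemma coords_continuous I : continuous (@coords R I).
Proof. exact: initial_continuous. Qed.

Lemma uncoords_continuous I : continuous (@uncoords I).
Proof.
apply/continuousP => _ [V oV <-].
rewrite (_ : _ @^-1` _ = V) //.
by apply/seteqP; split=> x /=; rewrite uncoordsK.
Qed.

(** [cspace] carries the topology that makes [coords] a homeomorphism. *)
Lemma open_coords I (S : set (cspace R I)) : open (@coords R I @` S) <-> open S.
Proof.
rewrite coords_image; split=> [oS|oS].
  have -> : S = @coords R I @^-1` (@uncoords I @^-1` S).
    by apply/seteqP; split=> z /=; rewrite coordsK.
  by apply: open_comp oS => z _; exact: coords_continuous.
by apply: open_comp oS => x _; exact: uncoords_continuous.
Qed.

Lemma csmooth_uncoords I U i : open U -> csmooth U (fun x => @uncoords I x i).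
Proof. by move=> oU; split; exact: smooth_coord. Qed.

Lemma is_cder_uncoords I x a i :
  is_cder x a (fun y => @uncoords I y i) (uncoords a i).
Proof. by split; exact: derive_coord. Qed.

Lemma smooth_to_coords m I (U : set 'rV[R]_m) (F : 'rV[R]_m -> cspace R I) :
  open U -> (forall i, csmooth U (fun x => F x i)) -> smooth_to U (fun x => coords (F x)).
Proof.
move=> oU sF; split=> // j; rewrite /coords; case: (splitP j) => k jk.
  have -> : j = lshift _ k by apply/val_inj.
  have [rF _] := sF (enum_val k).
  by apply: smooth_on_eq rF => x _; rewrite row_mxEl mxE.
have -> : j = rshift _ k by apply/val_inj.
have [_ iF] := sF (enum_val k).
by apply: smooth_on_eq iF => x _; rewrite row_mxEr mxE.
Qed.

Lemma smooth_map_cspace I J (U : set (cspace R I)) (F : cspace R I -> cspace R J) :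
  open U -> (forall j, csmooth (@coords R I @` U) (fun x => F (uncoords x) j)) ->
  smooth_map (cspace_atlas I) (cspace_atlas J) U F.
Proof.
move=> oU sF [] []; exists (fun x => coords (F (uncoords x))).
  by move=> z Uz _ _ /=; rewrite coordsK.
have -> : [set x | [/\ U x, chart_dom (tt : chart_idx (cspace_atlas I)) x
   & chart_dom (tt : chart_idx (cspace_atlas J)) (F x)]] = U.
  by apply/seteqP; split=> [z []|z Uz].
by apply: smooth_to_coords => //; apply/open_coords.
Qed.

Lemma std_formE I (a b : 'rV[R]_(#|I| + #|I|)) :
  (a *m std_form #|I| *m b^T) 0 0 =
  (2 * pi)^-1 * \sum_i Im (conjc (uncoords a i) * uncoords b i).
Proof.
rewrite /std_form -scalemxAr -scalemxAl mxE; congr (_ * _).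
rewrite -[a in LHS]hsubmxK -[b in LHS]hsubmxK mul_row_block !mulmx0 add0r addr0 mulmxN !mulmx1.
rewrite tr_row_mx mul_row_col !mxE (reindex (@enum_val I (mem I))) /=; last first.
  by apply: onW_bij; exact: enum_val_bij.
rewrite -big_split; apply: eq_bigr => k _ /=.
by rewrite ?ImM !mxE /= !enum_valK; ring.
Qed.

Lemma matrix_bilinear m (M N : 'M[R]_m) :
  (forall a b : 'rV[R]_m, (a *m M *m b^T) 0 0 = (a *m N *m b^T) 0 0) -> M = N.
Proof.
move=> MN; apply/matrixP => i j.
have E (P : 'M[R]_m) : P i j = ((delta_mx 0 i : 'rV_m) *m P *m (delta_mx 0 j : 'rV_m)^T) 0 0.
  by rewrite -rowE trmx_delta -colE !mxE.
by rewrite E MN -E.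
Qed.

Lemma jacobian_near m p (f g : 'rV[R]_m -> 'rV[R]_p) x :
  differentiable f x -> (\near x, f x = g x) -> 'J f x = 'J g x.
Proof.
move=> df fg; have dg := near_eq_differentiable fg df.
apply/row_matrixP => i.
have ef := deriveEjacobian (delta_mx 0 i) df; have eg := deriveEjacobian (delta_mx 0 i) dg.
have rE (A : 'M[R]_(m, p)) : row i A = delta_mx 0 i *m A by exact: rowE.
rewrite [LHS]rE [RHS]rE -[LHS]ef -[RHS]eg; exact: near_eq_derive.
Qed.

(** It suffices to compare the values of the two forms on pairs of vectors, and
    the Jacobian maps a vector to the directional derivative. *)
Lemma jacobian_symplectic I J (F : 'rV[R]_(#|I| + #|I|) -> cspace R J) x dF :
  differentiable (fun y => coords (F y)) x ->
  (forall a j, is_cder x a (fun y => F y j) (dF a j)) ->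
  (forall a b, \sum_j Im (conjc (dF a j) * dF b j) =
     \sum_i Im (conjc (uncoords a i) * uncoords b i)) ->
  let P := 'J (fun y => coords (F y)) x in
  std_form #|I| = P *m std_form #|J| *m P^T.
Proof.
move=> df dFP dFs /=; apply: matrix_bilinear => a b.
set Jm := jacobian _ _.
have DJ v : v *m Jm = coords (dF v).
  rewrite -[LHS](deriveEjacobian v df) derive_mx; last exact: diff_derivable.
  apply/rowP => k; rewrite mxE /coords; case: (splitP k) => l kl.
    have -> : k = lshift _ l by apply/val_inj.
    have [rF _] := dFP v (enum_val l).
    rewrite row_mxEl mxE; have [_ <-] := rF; congr ('D_v _ x); apply/funext => y.
    by rewrite row_mxEl mxE.
  have -> : k = rshift _ l by apply/val_inj.
  have [_ iF] := dFP v (enum_val l).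
  rewrite row_mxEr mxE; have [_ <-] := iF; congr ('D_v _ x); apply/funext => y.
  by rewrite row_mxEr mxE.
rewrite !mulmxA -[_ *m Jm^T *m _]mulmxA -trmx_mul !DJ !std_formE -dFs.
by congr (_ * _); apply: eq_bigr => j _; rewrite !coordsK.
Qed.

End ComplexVectorSpace.

(** * The characters of the torus *)

Section SmoothMaps.
Context {R : realType}.

Lemma smooth_to_comp m p q (U : set 'rV[R]_m) (V : set 'rV[R]_p)
    (f : 'rV[R]_m -> 'rV[R]_p) (g : 'rV[R]_p -> 'rV[R]_q) :
  (forall x, U x -> V (f x)) -> smooth_to U f -> smooth_to V g -> smooth_to U (g \o f).
Proof.
move=> UV sf [oV sg]; split=> [|j]; first by case: sf.
exact: smooth_comp UV sf (sg j).
Qed.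

Lemma smooth_to_sub m p (U V : set 'rV[R]_m) (f : 'rV[R]_m -> 'rV[R]_p) :
  open V -> V `<=` U -> smooth_to U f -> smooth_to V f.
Proof. by move=> oV VU [_ sf]; split=> // j; apply: smooth_on_sub (sf j). Qed.

Lemma smooth_to_preimage m p (U : set 'rV[R]_m) (V : set 'rV[R]_p) (f : 'rV[R]_m -> 'rV[R]_p) :
  smooth_to U f -> open V -> open (U `&` f @^-1` V).
Proof.
move=> sf oV; rewrite openE => x [Ux Vfx]; rewrite /interior.
have [oU _] := sf.
apply: filterI; first by apply: open_nbhs_nbhs; split.
have cf := differentiable_continuous (smooth_to_differentiable sf Ux).
by apply: (cf V); apply: open_nbhs_nbhs; split.
Qed.

Lemma smooth_to_row_mx m p q (U : set 'rV[R]_m) (f : 'rV[R]_m -> 'rV[R]_p)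
    (g : 'rV[R]_m -> 'rV[R]_q) :
  smooth_to U f -> smooth_to U g -> smooth_to U (fun x => row_mx (f x) (g x)).
Proof.
move=> [oU sf] [_ sg]; split=> // j; case: (splitP j) => k jk.
  have -> : j = lshift _ k by apply/val_inj.
  by apply: smooth_on_eq (sf k) => x _; rewrite row_mxEl.
have -> : j = rshift _ k by apply/val_inj.
by apply: smooth_on_eq (sg k) => x _; rewrite row_mxEr.
Qed.

Lemma smooth_to_id m (U : set 'rV[R]_m) : open U -> smooth_to U id.
Proof. by move=> oU; split=> // j; exact: smooth_coord. Qed.

Lemma smooth_to_cst m p (U : set 'rV[R]_m) (c : 'rV[R]_p) : open U -> smooth_to U (fun=> c).
Proof. by move=> oU; split=> // j; exact: smooth_cst. Qed.

Lemma smooth_to_lsubmx m p (U : set 'rV[R]_(m + p)) : open U -> smooth_to U lsubmx.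
Proof.
move=> oU; split=> // j; apply: smooth_on_eq (smooth_coord (lshift _ j) oU) => x _.
by rewrite mxE.
Qed.

Lemma smooth_to_rsubmx m p (U : set 'rV[R]_(m + p)) : open U -> smooth_to U rsubmx.
Proof.
move=> oU; split=> // j; apply: smooth_on_eq (smooth_coord (rshift _ j) oU) => x _.
by rewrite mxE.
Qed.

End SmoothMaps.

Section Cis.
Local Open Scope complex_scope.
Context {R : realType}.
Implicit Types x y : R.

Lemma cisD x y : cis (x + y) = cis x * cis y.
Proof.
apply: complex_ext; rewrite ?ReM ?ImM /= mulrDr ?cosD ?sinD //.
by rewrite addrC; congr (_ + _); rewrite mulrC.
Qed.

Lemma cis0 : cis (0 : R) = 1.
Proof. by apply: complex_ext; rewrite /= mulr0 ?cos0 ?sin0. Qed.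

Lemma sqnorm_cis x : sqnorm (cis x) = 1.
Proof. exact: cos2Dsin2. Qed.

Lemma cis_neq0 x : cis x != 0.
Proof. by rewrite -sqnorm_gt0 sqnorm_cis. Qed.

Lemma cisN x : cis (- x) = (cis x)^-1.
Proof.
apply: (mulfI (cis_neq0 x)); rewrite -cisD subrr cis0 divff //; exact: cis_neq0.
Qed.

Lemma cis1 : cis (1 : R) = 1.
Proof.
by apply: complex_ext; rewrite /= mulr1 mulr_natl ?cos2pi ?sin2pi.
Qed.

Lemma cisMz x (k : int) : cis (x * k%:~R) = cis x ^ k.
Proof.
have H m : cis (x * m%:R) = cis x ^+ m.
  elim: m => [|m IH]; first by rewrite mulr0 cis0 expr0.
  by rewrite -natr1 mulrDr mulr1 cisD IH exprSr.
case: k => m; first exact: H.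
by rewrite NegzE mulrNz mulrN cisN -[m.+1%:~R]/(m.+1%:R) H -exprnN.
Qed.

Lemma cis_int (k : int) : cis (k%:~R : R) = 1.
Proof. by rewrite -[k%:~R]mul1r cisMz cis1 exp1rz. Qed.

Lemma cis_sum (I : Type) (r : seq I) (P : pred I) (F : I -> R) :
  cis (\sum_(i <- r | P i) F i) = \prod_(i <- r | P i) cis (F i).
Proof. by apply: (big_morph cis cisD cis0). Qed.

(** With y the fractional part, 1 = cos (2 pi y) = 1 - 2 sin^2 (pi y), and the
    sine is positive between 0 and pi. *)
Lemma cis_eq1 x : cis x = 1 -> x = (Num.floor x)%:~R.
Proof.
move=> x1; pose y := x - (Num.floor x)%:~R.
have : cis y = 1 by rewrite /y cisD x1 mul1r -mulrNz cis_int.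
have := floor_itv x; rewrite intrD => /andP [fl fu].
have y0 : 0 <= y by rewrite subr_ge0.
have y1 : y < 1 by rewrite ltrBlDl.
move/(congr1 (@complex.Re R)) => /= cy.
apply/eqP; rewrite -subr_eq0 -/y eq_le y0 andbT leNgt; apply/negP => yp.
have : 0 < sin (pi * y).
  by apply: sin_gt0_pi; rewrite mulr_gt0 ?pi_gt0 //= gtr_pMr ?pi_gt0.
have : sin (pi * y) ^+ 2 = 0.
  move: cy; have -> : 2 * pi * y = (pi * y) *+ 2 by rewrite mulr2n; ring.
  rewrite cos_mulr2n; have := cos2Dsin2 (pi * y); rewrite -mulr_natl; lra.
by move=> /eqP; rewrite sqrf_eq0 => /eqP ->; rewrite ltxx.
Qed.

Lemma polar_form (z : R[i]) : exists x, z = (Normc.normc z)%:C * cis x.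
Proof.
have [->|z0] := eqVneq z 0; first by exists 0; rewrite Normc.normc0 mul0r.
have := sqnorm_csgn z0; set u := csgn z => u1.
have -> : z = (Normc.normc z)%:C * u.
  rewrite /u /csgn normc_sqrt mulrC -mulrA -rmorphM mulVf ?mulr1 //.
  by rewrite sqrtr_eq0 -ltNge sqnorm_gt0.
suff [x ->] : exists x, u = cis x.
  by exists x; rewrite Normc.normcM [Normc.normc (cis x)]normc_sqrt sqnorm_cis sqrtr1
    mulr1 /= expr0n addr0 sqrtr_sqr normc_sqrt ger0_norm ?sqrtr_ge0.
move: u1; case: u => c s; rewrite /sqnorm /= => cs.
have s2 : 1 - c ^+ 2 = s ^+ 2 by rewrite -cs; ring.
have c1 : -1 <= c <= 1.
  have c21 : c ^+ 2 <= 1 by rewrite -cs lerDl sqr_ge0.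
  by rewrite -ler_norml -sqrtr_sqr -[leRHS]sqrtr1 ler_sqrt.
have cI : c \in `[-1, 1] by rewrite in_itv.
have pi0 : pi != 0 :> R by rewrite gt_eqF // pi_gt0.
have kk (q y : R) : q != 0 -> 2 * q * (y / (2 * q)) = y by move=> q0; field.
have [s0|s0] := leP 0 s.
  exists (acos c / (2 * pi)); rewrite /cis.
  rewrite kk //.
  by rewrite acosK // sin_acos // s2 sqrtr_sqr ger0_norm.
exists (- (acos c / (2 * pi))); rewrite /cis.
rewrite mulrN kk //.
by rewrite cosN sinN acosK // sin_acos // s2 sqrtr_sqr ltr0_norm // opprK.
Qed.

End Cis.

Section Characters.
Local Open Scope complex_scope.
Context {R : realType} {t : vectType R} {T : topologicalZmodType}.
Variables (n : nat) (AT : atlas R T) (exp : {additive t -> T}) (D : polytope t).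
Hypotheses (hT : is_torus n AT exp) (hD : is_delzant_polytope exp D n).
Implicit Types (v w : vertices D) (g : T).

(** The coordinate characters of the torus in its identification with
    (R/Z)^{F_v}, for the lift of [g] chosen in [act_v]. *)
Definition tchar v g (f : Fv v) : R[i] :=
  cis (xget (fun=> 0) [set s : Fv v -> R | exp (\sum_f s f *: normal (val f)) = g] f).
Arguments tchar : clear implicits.

Lemma act_vE v g (z : cspace R (Fv v)) f : act_v exp v g z f = tchar v g f * z f.
Proof. by []. Qed.

Lemma ncoord_int v Y f : exp Y = 0 -> exists k : int, ncoord v Y f = k%:~R.
Proof.
move=> Y0; have [c [Yc _]] := delzant_basis hD v Y0.
exists (c f); rewrite Yc.
under eq_bigr do rewrite -scaler_int.
by rewrite (ncoord_uniq hT hD).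
Qed.

(** Two lifts of the same element differ by a lattice vector, whose coordinates
    are integers. *)
Lemma tchar_exp v Y f : tchar v (exp Y) f = cis (ncoord v Y f).
Proof.
rewrite /tchar; case: xgetP => [s _ /= sY|none]; last first.
  by case: (none (ncoord v Y)); rewrite /= (ncoordP hT hD).
have [k kE] : exists k : int, ncoord v ((-1) *: Y + \sum_f s f *: normal (val f)) f = k%:~R.
  by apply: ncoord_int; rewrite raddfD scaleN1r raddfN /= sY addNr.
move: kE; rewrite (ncoordDZ hT hD) (ncoord_uniq hT hD) mulN1r => /eqP.
rewrite addrC subr_eq addrC => /eqP ->.
by rewrite cisD cis_int mulr1.
Qed.

Lemma tcharD v g h f : tchar v (g + h) f = tchar v g f * tchar v h f.
Proof.
have [Y <-] := exp_surjective hT g; have [Z <-] := exp_surjective hT h.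
by rewrite -raddfD !tchar_exp -[Y]scale1r (ncoordDZ hT hD) mul1r scale1r cisD.
Qed.

Lemma tchar0 v f : tchar v 0 f = 1.
Proof.
by rewrite -(raddf0 exp) tchar_exp (ncoord0 hT hD) cis0.
Qed.

Lemma sqnorm_tchar v g f : sqnorm (tchar v g f) = 1.
Proof. exact: sqnorm_cis. Qed.

(** If all characters are trivial, the coordinates of a lift are integers, so
    the lift is in the lattice. *)
Lemma tchar_faithful v g : (forall f, tchar v g f = 1) -> g = 0.
Proof.
have [Y <-] := exp_surjective hT g => Y1.
rewrite -(ncoordP hT hD v Y).
under eq_bigr => f _.
  have := Y1 f; rewrite tchar_exp => /cis_eq1 ->; rewrite scaler_int; over.
exact: (exp_int_comb hD).
Qed.

Lemma linear_coords (l : t -> R) : (forall a Y Z, l (a *: Y + Z) = a * l Y + l Z) ->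
  exists c : 'I_(dim t) -> R, forall Y, l Y = \sum_j vcoords Y 0 j * c j.
Proof.
move=> ll; pose b j : t := VectorInternalTheory.r2v (delta_mx 0 j : 'rV[R]_(dim t)).
have bP j : vcoords (b j) = delta_mx 0 j by exact: VectorInternalTheory.r2vK.
exists (fun j => l (b j)) => Y; rewrite -scalar_sum //; congr l.
apply: vcoords_inj; rewrite linear_sum [LHS]row_sum_delta.
by apply: eq_bigr => j _; rewrite linearZ /= bP.
Qed.

Definition chart_inv (a : chart_idx AT) (y : 'rV[R]_(chart_dim a)) : T :=
  xget 0 [set g | chart_dom a g /\ chart a g = y].

Lemma chart_invK a g : chart_dom a g -> chart_inv (chart a g) = g.
Proof.
move=> ga; rewrite /chart_inv; case: xgetP => [g' _ [g'a e]|none].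
  exact: (chart_inj (torus_manifold hT)) (mem_set g'a) (mem_set ga) e.
by case: (none g).
Qed.

(** Near a point [g0] the torus is parametrized by the Lie algebra through
    [Y |-> exp Y + g0], on which the characters are exponentials of linear
    forms. *)
Lemma tchar_smooth v f (a : chart_idx AT) :
  csmooth (chart a @` chart_dom a) (fun y => tchar v (chart_inv y) f).
Proof.
have mT := torus_manifold hT.
have oa : open (chart a @` chart_dom a).
  by apply: (chart_open_map mT) => //; exact: chart_open_dom mT a.
apply: csmooth_local => // y0 [g0 g0a <-].
have [W [U [W0 [[WU injW UW] _ [h sh hK]]]]] := torus_local_diffeo hT.
have U0 : U 0 by have := WU _ W0; rewrite raddf0.
have [b b0] := manifold_cover mT (0 : T).
have [g1 g1E sg1] := torus_smooth_sub hT (a, a) b.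
have [g2 g2E sg2] := sh b tt.
move: sg1 sg2; set S1 := (X in smooth_to X _); set S2 := (X in smooth_to X g2).
move=> sg1 sg2.
pose A := chart a @` chart_dom a.
have sr : smooth_to A (fun y => row_mx y (chart a g0)).
  by apply: smooth_to_row_mx; [exact: smooth_to_id|exact: smooth_to_cst].
have oA1 : open (A `&` (fun y => row_mx y (chart a g0)) @^-1` S1).
  by apply: smooth_to_preimage sr _; case: sg1.
set A1 := A `&` _ in oA1.
have s1 : smooth_to A1 (g1 \o (fun y => row_mx y (chart a g0))).
  by apply: smooth_to_comp (smooth_to_sub oA1 _ sr) sg1 => y [].
have oA2 := smooth_to_preimage s1 (proj1 sg2).
set A2 := A1 `&` _ in oA2.
have s2 : smooth_to A2 (g2 \o (g1 \o (fun y => row_mx y (chart a g0)))).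
  by apply: smooth_to_comp (smooth_to_sub oA2 _ s1) sg2 => y [].
(* On A2 the composite of the chart expressions of g |-> g - g0 and of the
   local inverse h of exp is the coordinate vector of h (g - g0). *)
have A2P y : A2 y -> exists g, [/\ chart_dom a g, chart a g = y, U (g - g0) &
    (g2 \o (g1 \o (fun y => row_mx y (chart a g0)))) y = vcoords (h (g - g0))].
  move=> [[[g ga gy]] [[p q] [_ [/= pa qa] pqb] pq]] [x [Ux xb _] xE].
  have [py qg0] := eq_row_mx pq.
  have {}qg0 : q = g0 by exact: (chart_inj mT) (mem_set qa) (mem_set g0a) qg0.
  have {}py : p = g.
    by apply: (chart_inj mT (mem_set pa) (mem_set ga)); rewrite py gy.
  subst q p.
  have gE := g1E (g, g0) I (conj pa qa) pqb; rewrite /= in gE.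
  have {xE}xg : x = g - g0.
    apply: (chart_inj mT (mem_set xb) (mem_set pqb)); rewrite xE /= -gy gE //.
  subst x; exists g; split=> //=.
  by rewrite -gy -gE -(g2E _ Ux xb I).
have [c cP] := linear_coords (fun a' Y Z => ncoordDZ hT hD a' Y Z f).
exists A2.
  split; last first.
    exists 0; first by split=> //.
    have := g1E (g0, g0) I (conj g0a g0a); rewrite /= subrr => /(_ b0) <-.
    by [].
  split; first by exists g0.
  by exists (g0, g0) => //; split=> //=; rewrite subrr.
have sc : smooth_on A2 (fun y => \sum_j (g2 \o (g1 \o (fun y => row_mx y (chart a g0)))) y 0 j * c j).
  apply: smooth_sum => // j _; apply: smoothM; last exact: smooth_cst.
  by have [_] := s2.
apply: csmooth_eq (csmoothM (csmooth_cis sc) (csmooth_cst (tchar v g0 f) oA2)) => y Ay.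
have [g [ga gy Ug gE]] := A2P _ Ay.
rewrite gE -cP -tchar_exp -gy chart_invK //.
have -> : exp (h (g - g0)) = g - g0.
  by have [Y WY <-] := UW _ Ug; rewrite hK.
by rewrite -tcharD subrK.
Qed.

End Characters.

Arguments tchar {R t T} exp {D} v g f.

(** * The Hamiltonian action on C^{F_v} *)

Section LinearSymplectic.
Context {R : realType}.

Definition symplectic_at (p q : nat) (F : 'rV[R]_(p + p) -> 'rV[R]_(q + q)) x :=
  differentiable F x /\ std_form p = 'J F x *m std_form q *m ('J F x)^T.

Lemma symplectic_at_near p q (F G : 'rV[R]_(p + p) -> 'rV[R]_(q + q)) x :
  (\near x, F x = G x) -> symplectic_at F x -> symplectic_at G x.
Proof.
move=> FG [dF FJ]; split; first exact: near_eq_differentiable FG dF.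
by rewrite -(jacobian_near dF FG).
Qed.

Lemma jacobian_comp m p q (F : 'rV[R]_m -> 'rV[R]_p) (G : 'rV[R]_p -> 'rV[R]_q) x :
  differentiable F x -> differentiable G (F x) ->
  'J (G \o F) x = 'J F x *m 'J G (F x).
Proof.
move=> dF dG; have dGF : differentiable (G \o F) x by exact: differentiable_comp.
apply/row_matrixP => i.
have rE (A : 'M[R]_(m, q)) : row i A = delta_mx 0 i *m A by exact: rowE.
rewrite [LHS]rE [RHS]rE mulmxA -[LHS](deriveEjacobian _ dGF).
rewrite -[X in _ = X *m _](deriveEjacobian _ dF) -[RHS](deriveEjacobian _ dG).
rewrite (deriveE _ dGF) (diff_comp dF dG) /= -(deriveE _ dF) -(deriveE _ dG).
by [].
Qed.

Lemma symplectic_at_comp p q r (F : 'rV[R]_(p + p) -> 'rV[R]_(q + q))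
    (G : 'rV[R]_(q + q) -> 'rV[R]_(r + r)) x :
  symplectic_at F x -> symplectic_at G (F x) -> symplectic_at (G \o F) x.
Proof.
move=> [dF FJ] [dG GJ]; split; first exact: differentiable_comp.
by rewrite (jacobian_comp dF dG) trmx_mul !mulmxA -(mulmxA _ (std_form r)) FJ {1}GJ !mulmxA.
Qed.

End LinearSymplectic.

Section Momentum.
Local Open Scope complex_scope.
Context {R : realType} {t : vectType R} {T : topologicalZmodType}.
Variables (n : nat) (AT : atlas R T) (exp : {additive t -> T}) (D : polytope t).
Hypotheses (hT : is_torus n AT exp) (hD : is_delzant_polytope exp D n).
Implicit Types (v w : vertices D) (g : T) (Y : t).
Local Notation C v := (cspace R (Fv v)).

Notation Re := complex.Re.
Notation Im := complex.Im.

(** The normals at one vertex span the Lie algebra. *)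
Lemma hom_ext v (xi xi' : 'Hom(t, R^o)) :
  (forall f : Fv v, xi (normal (val f)) = xi' (normal (val f))) -> xi = xi'.
Proof.
move=> e; apply/eqP; rewrite -subr_eq0; apply/eqP.
apply: (normals_separate hD (torus_lie_dim hT) (v := v)) => f fv.
have := e (Sub f fv); rewrite SubK add_lfunE opp_lfunE => ->.
by rewrite subrr.
Qed.

Lemma mu_vP v (z : C v) (f : Fv v) :
  Normc.normc (z f) ^+ 2 / 2 - offset (val f) = mu_v v z (normal (val f)).
Proof.
rewrite /mu_v; case: xgetP => [xi _ /(_ f) //|none].
have [xi xiP] := dual_basis hT hD (fun f : Fv v => Normc.normc (z f) ^+ 2 / 2 - offset (val f)).
by case: (none xi) => f' /=; rewrite xiP.
Qed.

Lemma mu_v_uniq v (z : C v) xi :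
  (forall f : Fv v, height (val f) xi = sqnorm (z f) / 2) -> mu_v v z = xi.
Proof.
move=> xiP; apply: (@hom_ext v) => f; rewrite -mu_vP normc_sq -xiP.
by rewrite /height addrK.
Qed.

Lemma height_mu v (z : C v) (f : Fv v) : height (val f) (mu_v v z) = sqnorm (z f) / 2.
Proof. by rewrite /height -mu_vP normc_sq subrK. Qed.

Lemma mu_vE v (z : C v) Y :
  mu_v v z Y = \sum_f ncoord v Y f * (sqnorm (z f) / 2 - offset (val f)).
Proof.
rewrite -{1}(ncoordP hT hD v Y) linear_sum; apply: eq_bigr => f _.
by rewrite /= homZ -mu_vP normc_sq.
Qed.

Lemma act_v0 v (z : C v) : act_v exp v 0 z = z.
Proof. by apply/funext => f; rewrite act_vE (tchar0 hT hD) mul1r. Qed.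

Lemma act_vD v g h (z : C v) : act_v exp v (g + h) z = act_v exp v g (act_v exp v h z).
Proof. by apply/funext => f; rewrite !act_vE (tcharD hT hD) mulrA. Qed.

Lemma mu_act v g (z : C v) : mu_v v (act_v exp v g z) = mu_v v z.
Proof. by apply: mu_v_uniq => f; rewrite height_mu act_vE sqnormM sqnorm_tchar mul1r. Qed.

Lemma smooth_mu v Y U : open U -> smooth_on U (fun x => mu_v v (uncoords x) Y).
Proof.
move=> oU; under eq_fun do rewrite mu_vE.
apply: smooth_sum => // f _; apply: smoothM; first exact: smooth_cst.
apply: smoothD; last exact: smooth_cst.
apply: smoothM; last exact: smooth_cst.
by apply: smooth_sqnorm; exact: csmooth_uncoords.
Qed.

(** The differential of <mu_v, Y>, as d(|z|^2/2) = Re (conj z dz). *)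
Definition dmu v (x a : 'rV[R]_(#|Fv v| + #|Fv v|)) Y : R :=
  \sum_f ncoord v Y f * Re (conjc (uncoords x f) * uncoords a f).
Arguments dmu : clear implicits.

Lemma is_derive_bigsum (V : normedModType R) (I : Type) (r : seq I) (F : I -> V -> R) dF (x a : V) :
  (forall i, is_derive x a (F i) (dF i)) ->
  is_derive x a (fun y => \sum_(i <- r) F i y) (\sum_(i <- r) dF i).
Proof.
move=> Fd; elim: r => [|i r IH].
  by rewrite big_nil; under eq_fun do rewrite big_nil; exact: is_derive_cst.
by rewrite big_cons; under eq_fun do rewrite big_cons; exact: is_derive_add.
Qed.

Lemma is_derive_mu v Y x a :
  is_derive x a (fun y => mu_v v (uncoords y) Y) (dmu v x a Y).
Proof.
under eq_fun do rewrite mu_vE.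
apply: is_derive_bigsum => f.
have sd := is_derive_sqnorm (is_cder_uncoords x a f).
have cd (c : R) : is_derive x a (fun=> c) 0 by exact: is_derive_cst.
have d2 := is_derive_add (is_derive_mul sd (cd 2^-1)) (cd (- offset (val f))).
apply: is_derive_eq (is_derive_mul (cd (ncoord v Y f)) d2) _.
by rewrite /=; field.
Qed.

Lemma dmu_sum v x a (I : finType) (P : pred I) (c : I -> R) (Y : I -> t) :
  dmu v x a (\sum_(i | P i) c i *: Y i) = \sum_(i | P i) c i * dmu v x a (Y i).
Proof.
apply: scalar_sum => b Z Z'; rewrite /dmu mulr_sumr -big_split; apply: eq_bigr => f _.
by rewrite /= (ncoordDZ hT hD) mulrDl mulrA.
Qed.

Lemma dmu_normal v x a (f : Fv v) :
  dmu v x a (normal (val f)) = Re (conjc (uncoords x f) * uncoords a f).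
Proof.
rewrite /dmu (ncoord_normal hT hD).
by rewrite (bigD1 f) //= eqxx mul1r big1 ?addr0 // => k /negbTE ->; rewrite mul0r.
Qed.

Lemma rotates_cis (y : R) : rotates (0 : R) 1 (fun h => cis (h * y)) (2 * pi * y).
Proof.
have d : is_derive (0 : R) 1 (fun h : R => 2 * pi * (h * y)) (2 * pi * y).
  apply: is_derive_eq (is_derive_mul (is_derive_cst (2 * pi) (0 : R) (1 : R))
    (is_derive_mul (is_derive_id (0 : R) 1) (is_derive_cst y (0 : R) (1 : R)))) _.
  by rewrite /= mul0r mulr0 addr0 mul1r add0r.
have df : differentiable (fun h : R => 2 * pi * (h * y)) 0.
  by apply/derivable1_diffP; case: d.
split.
  apply: is_derive_eq (is_derive_comp1 (is_derive_cos _) df d) _.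
  by rewrite !(ReM, ImM) /=; ring.
apply: is_derive_eq (is_derive_comp1 (is_derive_sin _) df d) _.
by rewrite !(ReM, ImM) /=; ring.
Qed.

Lemma orbit_velocity v (z : C v) Y :
  derive1 (fun h : R => coords (act_v exp v (exp (h *: Y)) z)) 0 =
  coords (fun f : Fv v => 'i * (2 * pi * ncoord v Y f)%:C * z f).
Proof.
have dF (f : Fv v) : is_cder (0 : R) 1 (fun h => act_v exp v (exp (h *: Y)) z f)
    ('i * (2 * pi * ncoord v Y f)%:C * z f).
  have -> : (fun h => act_v exp v (exp (h *: Y)) z f) = fun h => cis (h * ncoord v Y f) * z f.
    apply/funext => h; rewrite act_vE (tchar_exp hT hD) -[h *: Y]addr0 (ncoordDZ hT hD).
    by rewrite (ncoord0 hT hD) addr0.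
  apply: is_cder_eq (is_cderM (rotates_cis (ncoord v Y f)) (is_cder_cst _ _ (z f))) _.
  by rewrite mul0r cis0 mulr1 mulr0 addr0.
have dr j : is_derive (0 : R) 1
    (fun h => coords (act_v exp v (exp (h *: Y)) z) 0 j)
    (coords (fun f : Fv v => 'i * (2 * pi * ncoord v Y f)%:C * z f) 0 j).
  rewrite /coords; case: (splitP j) => k jk.
    have -> : j = lshift _ k by apply/val_inj.
    by rewrite row_mxEl mxE; under eq_fun do rewrite row_mxEl mxE; case: (dF (enum_val k)).
  have -> : j = rshift _ k by apply/val_inj.
  by rewrite row_mxEr mxE; under eq_fun do rewrite row_mxEr mxE; case: (dF (enum_val k)).
rewrite derive1E derive_mx; last first.
  by apply/derivable_mxP => i j; rewrite ord1; case: (dr j).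
by apply/rowP => j; rewrite mxE; case: (dr j).
Qed.

(** Both sides are compared on an arbitrary vector b: the orbit moves with
    velocity 2 pi i y_f z_f, and Im (conj (i z_f) b_f) = - Re (conj z_f b_f).
    The function may be known near the point only, as in the charts of the
    glued space. *)
Lemma momentum_local v (z : C v) Y (f : 'rV[R]_(#|Fv v| + #|Fv v|) -> R) :
  (\forall y \near coords z, mu_v v (uncoords y) Y = f y) ->
  derive1 (fun h : R => coords (act_v exp v (exp (h *: Y)) z)) 0 *m std_form #|Fv v| =
  - \row_k 'D_(delta_mx 0 k) f (coords z).
Proof.
move=> nf; rewrite orbit_velocity; set u := coords _.
apply/rowP => k; rewrite [RHS]mxE [X in - X]mxE.
have -> : (u *m std_form #|Fv v|) 0 k = (u *m std_form #|Fv v| *m (delta_mx 0 k : 'rV_(_ + _))^T) 0 0.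
  by rewrite trmx_delta -colE [RHS]mxE.
rewrite std_formE -(near_eq_derive _ nf).
have [_ ->] := is_derive_mu Y (coords z) (delta_mx 0 k).
rewrite /dmu -sumrN mulr_sumr; apply: eq_bigr => i _.
rewrite /u !coordsK.
have pi0 : (pi : R) != 0 by rewrite gt_eqF // pi_gt0.
case: (z i) => p q; case: (uncoords _ i) => c d.
rewrite !ImM !ReM /=; move: pi0; move: (pi : R) => P P0.
by field.
Qed.

Lemma act_symplectic_at v g x :
  symplectic_at (fun y => coords (act_v exp v g (uncoords y))) x.
Proof.
have oT : open [set: 'rV[R]_(#|Fv v| + #|Fv v|)] by exact: openT.
have sm : smooth_to [set: 'rV[R]_(#|Fv v| + #|Fv v|)]
    (fun y => coords (act_v exp v g (uncoords y))).
  apply: smooth_to_coords => // f; apply: csmoothM; first exact: csmooth_cst.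
  exact: csmooth_uncoords.
split; first exact: smooth_to_differentiable sm _.
apply: (@jacobian_symplectic R (Fv v) (Fv v) (fun y => act_v exp v g (uncoords y)) x
  (fun a f => tchar exp v g f * uncoords a f)).
- exact: smooth_to_differentiable sm _.
- move=> a f.
  apply: is_cder_eq (is_cderM (is_cder_cst x a (tchar exp v g f)) (is_cder_uncoords x a f)) _.
  by rewrite mul0r add0r.
- move=> a b; apply: eq_bigr => f _.
  have := sqnorm_tchar exp g f; rewrite /sqnorm.
  case: (tchar exp v g f) => p q /= pq.
  case: (uncoords a f) => c d; case: (uncoords b f) => c' d' /=.
  by rewrite -[RHS]mul1r -pq; ring.
Qed.

Definition act_coords v (a : chart_idx AT)
    (y : 'rV[R]_(chart_dim a + (#|Fv v| + #|Fv v|))) : 'rV[R]_(#|Fv v| + #|Fv v|) :=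
  coords (act_v exp v (chart_inv (lsubmx y)) (uncoords (rsubmx y))).

Arguments act_coords : clear implicits.

Lemma act_coordsE v (a : chart_idx AT) g (z : C v) : chart_dom a g ->
  act_coords v a (row_mx (chart a g) (coords z)) = coords (act_v exp v g z).
Proof.
by move=> ga; rewrite /act_coords row_mxKl row_mxKr (chart_invK hT ga) coordsK.
Qed.

Definition act_coords_dom v (a : chart_idx AT) : set 'rV[R]_(chart_dim a + (#|Fv v| + #|Fv v|)) :=
  [set y | (chart a @` chart_dom a) (lsubmx y)].

Arguments act_coords_dom : clear implicits.

Lemma smooth_act_coords v (a : chart_idx AT) :
  smooth_to (act_coords_dom v a) (act_coords v a).
Proof.
have mT := torus_manifold hT.
have oa : open (chart a @` chart_dom a).
  by apply: (chart_open_map mT) => //; exact: chart_open_dom mT a.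
have oT m : open [set: 'rV[R]_m] by exact: openT.
have od : open (act_coords_dom v a).
  have := smooth_to_preimage (smooth_to_lsubmx (oT (chart_dim a + (#|Fv v| + #|Fv v|))%N)) oa.
  by rewrite setTI.
apply: smooth_to_coords => // f; apply: csmoothM.
  apply: (csmooth_comp (f := lsubmx)) (tchar_smooth hT hD f a); first by [].
  exact: smooth_to_lsubmx.
apply: (csmooth_comp (f := rsubmx) (V := setT)) (csmooth_uncoords f (oT _)); first by [].
exact: smooth_to_rsubmx.
Qed.

Lemma cspace_hamiltonian v :
  is_hamiltonian AT exp (cspace_form R (Fv v)) (act_v exp v) (mu_v v).
Proof.
have oT : open [set: C v] by exact: openT.
have ocT : open (@coords R (Fv v) @` setT) by apply/open_coords.
split.
- exact: act_v0.
- by move=> g h z; exact: act_vD.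
- move=> [a []] []; exists (act_coords v a).
    by move=> [g z] _ [ga _] _ /=; rewrite act_coordsE.
  set S := (X in smooth_to X _).
  have -> : S = act_coords_dom v a; last exact: smooth_act_coords.
  apply/seteqP; split=> [_ [[g z] [_ [/= ga _] _] <-]|y [g ga gy]].
    by rewrite /act_coords_dom /= row_mxKl; exists g.
  exists (g, uncoords (rsubmx y)); first by split.
  by rewrite /= uncoordsK gy hsubmxK.
- move=> g [] [] f fE z _ _ _ /=.
  have [_ E] := act_symplectic_at g (coords z).
  have fE' : (fun y => coords (act_v exp v g (uncoords y))) = f.
    by apply/funext => y; rewrite -[y in RHS]uncoordsK -fE.
  by rewrite fE' in E; exact: E.
- move=> Y []; exists (fun y => mu_v v (uncoords y) Y); last exact: smooth_mu.
  by move=> z _ /=; rewrite coordsK.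
- by move=> g z; exact: mu_act.
- move=> Y [] f fE z _ /=; apply: momentum_local.
  apply: (near_open (U := setT)) => [||y _]; [exact: openT|by []|].
  by rewrite -[y in RHS]uncoordsK -fE.
Qed.

End Momentum.

Arguments dmu {R t D} v x a Y.
Arguments act_coords {R t T AT} exp {D} v a y.
Arguments act_coords_dom {R t T AT D} v a _.

(** * Transition coefficients *)

Section GluingMaps.
Local Open Scope complex_scope.
Context {R : realType} {t : vectType R} {T : topologicalZmodType}.
Variables (n : nat) (AT : atlas R T) (exp : {additive t -> T}) (D : polytope t).
Hypotheses (hT : is_torus n AT exp) (hD : is_delzant_polytope exp D n).
Implicit Types (u v w : vertices D) (xi : 'Hom(t, R^o)).
Local Notation C v := (cspace R (Fv v)).

Notation Re := complex.Re.
Notation Im := complex.Im.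

Lemma sum_Fset w (V : nmodType) (F : facets D -> V) :
  \sum_(g in Fset w) F g = \sum_(g : Fv w) F (val g).
Proof. exact: big_sub. Qed.

Lemma zcoefP w f : normal f = \sum_(g : Fv w) (zcoef w f (val g))%:~R *: normal (val g).
Proof.
under eq_bigr do rewrite scaler_int; rewrite -(sum_Fset w (fun g => normal g *~ zcoef w f g)).
rewrite /zcoef; case: xgetP => [c _ [] //|none].
have [c [fc _]] := delzant_basis hD w (exp_normal hD f).
pose c' : {ffun facets D -> int} :=
  [ffun g => if (insub g : option (Fv w)) is Some g' then c g' else 0].
case: (none c'); split.
  rewrite sum_Fset {1}fc; apply: eq_bigr => g _.
  by rewrite ffunE valK.
by move=> g gw; rewrite ffunE insubN.
Qed.

Lemma ncoord_zcoef w f (g : Fv w) : ncoord w (normal f) g = (zcoef w f (val g))%:~R.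
Proof. by rewrite {1}(zcoefP w f) (ncoord_uniq hT hD). Qed.

(** A normal at [w] is a vector of the basis in which it is expanded. *)
Lemma zcoef_in w (f : facets D) (g : Fv w) : f \in Fset w ->
  zcoef w f (val g) = (f == val g)%:Z.
Proof.
move=> fw; apply/eqP; rewrite -(eqr_int R) -ncoord_zcoef.
have := ncoord_normal hT hD (Sub f fw : Fv w); rewrite SubK => ->.
by rewrite -val_eqE SubK [val g == f]eq_sym.
Qed.

Lemma ncoord_change v w Y (g : Fv w) :
  ncoord w Y g = \sum_(f : Fv v) ncoord v Y f * (zcoef w (val f) (val g))%:~R.
Proof.
rewrite -{1}(ncoordP hT hD v Y).
have -> : \sum_f ncoord v Y f *: normal (val f) =
    \sum_(g : Fv w) (\sum_(f : Fv v) ncoord v Y f * (zcoef w (val f) (val g))%:~R) *: normal (val g).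
  under [RHS]eq_bigr do rewrite scaler_suml.
  rewrite exchange_big /=; apply: eq_bigr => f _.
  by rewrite {1}(zcoefP w (val f)) scaler_sumr; apply: eq_bigr => k _; rewrite scalerA.
by rewrite (ncoord_uniq hT hD).
Qed.

(** * The domains of the gluing maps *)

Lemma U_P v (z : C v) : U_ v z <-> forall f, f \notin Fset v -> 0 < height f (mu_v v z).
Proof.
split=> [/(Delta_vP hD (torus_lie_dim hT)) [_ h] //|h].
apply/(Delta_vP hD (torus_lie_dim hT)); split=> //.
apply/(polytopeP hD (torus_lie_dim hT)) => f.
have [fv|/h/ltW //] := boolP (f \in Fset v).
have := height_mu hT hD z (Sub f fv); rewrite SubK => ->.
by rewrite divr_ge0 // sqnorm_ge0.
Qed.

Lemma neq0_height v (z : C v) (f : Fv v) : (z f != 0) = (0 < height (val f) (mu_v v z)).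
Proof. by rewrite (height_mu hT hD) pmulr_lgt0 // sqnorm_gt0. Qed.

Lemma UoP v w (z : C v) : Uo v w z <->
  (forall f, f \notin Fset v -> 0 < height f (mu_v v z)) /\
  (forall f, f \notin Fset w -> 0 < height f (mu_v v z)).
Proof.
split=> [[/U_P Uz zw]|[Uv Uw]].
  split=> // f fw; have [fv|/Uz //] := boolP (f \in Fset v).
  by have := zw (Sub f fv); rewrite neq0_height SubK; apply.
by split; [exact/U_P|move=> f fw; rewrite neq0_height; exact: Uw].
Qed.

(** On C^{F_v} the coordinate z_f vanishes exactly when the momentum lies on
    the facet f. *)
Lemma Uo_Delta v w (z : C v) :
  Uo v w z <-> Delta_v v (mu_v v z) /\ Delta_v w (mu_v v z).
Proof.
have ht := torus_lie_dim hT.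
split=> [Uz|[/(Delta_vP hD ht) [_ hv] /(Delta_vP hD ht) [_ hw]]]; last exact/UoP.
have [Uv _] := Uz; have /UoP [_ hw] := Uz; split=> //.
by apply/(Delta_vP hD ht); split=> //; have /(Delta_vP hD ht) [] := Uv.
Qed.

Lemma Uo_sub v w (z : C v) : Uo v w z -> U_ v z.
Proof. by case. Qed.

Lemma Uo_refl v (z : C v) : Uo v v z <-> U_ v z.
Proof. by split=> [/Uo_sub //|Uz]; apply/Uo_Delta. Qed.

Lemma smooth_height v (f : facets D) U : open U -> smooth_on U (fun x => height f (mu_v v (uncoords x))).
Proof.
by move=> oU; exact: (smoothD (smooth_mu hT hD (normal f) oU) (smooth_cst (offset f) oU)).
Qed.

Lemma open_Uo v w : open (@coords R (Fv v) @` Uo v w).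
Proof.
rewrite coords_image openE => x /UoP [hv hw]; rewrite /interior.
have H u : (forall f, f \notin Fset u -> 0 < height f (mu_v v (uncoords x))) ->
    \forall y \near x, forall f, f \notin Fset u -> 0 < height f (mu_v v (uncoords y)).
  move=> hu; apply: near_forall => f.
  have [fu|fu] := boolP (f \in Fset u).
    by apply: (near_open (U := setT)) => //; exact: openT.
  have sh := smooth_differentiable (smooth_height (v := v) f openT) (Logic.I : setT x).
  have := near_gt0 (differentiable_continuous sh) (hu f fu).
  by apply: filterS => y.
by apply: filterS2 (H v hv) (H w hw) => y yv yw; apply/UoP.
Qed.

Lemma open_U v : open (@coords R (Fv v) @` U_ v).
Proof.
have -> : U_ v = Uo v v by apply/seteqP; split=> z /Uo_refl.
exact: open_Uo.
Qed.

Lemma U_act v g (z : C v) : U_ v z -> U_ v (act_v exp v g z).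
Proof. by rewrite /U_ /preimage /= (mu_act hT hD). Qed.

Lemma Uo_act v w g (z : C v) : Uo v w z -> Uo v w (act_v exp v g z).
Proof. by move=> /UoP h; apply/UoP; rewrite (mu_act hT hD). Qed.

(** * A section of the momentum map *)

Definition rho v xi : C v := fun f => (r_ (val f) xi)%:C.
Arguments rho : clear implicits.

Lemma r_height (f : facets D) xi : r_ f xi = Num.sqrt (2 * height f xi).
Proof. by []. Qed.

Lemma mu_rho v xi : polytope_set D xi -> mu_v v (rho v xi) = xi.
Proof.
move=> xP; apply: (mu_v_uniq hT hD) => f; rewrite /rho sqnorm_real r_height sqr_sqrtr.
  by field.
by rewrite mulr_ge0 // (polytope_height hD).
Qed.

(** The momentum determines the absolute values of the coordinates, and the
    torus can change their arguments at will. *)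
Lemma rho_orbit v (z : C v) : exists g, z = act_v exp v g (rho v (mu_v v z)).
Proof.
have /choice [x xP] := fun f => polar_form (z f).
exists (exp (\sum_f x f *: normal (val f))); apply/funext => f.
rewrite act_vE (tchar_exp hT hD) (ncoord_uniq hT hD) {1}xP mulrC; congr (_ * _%:C).
by rewrite r_height (height_mu hT hD) mulrCA divff ?mulr1 // normc_sqrt.
Qed.

(** * The gluing maps *)

(** The coefficients in the definition of the gluing map are those that change
    the characters at [v] into the characters at [w]. *)
Lemma tchar_change v w g (k : Fv w) :
  \prod_(f : Fv v) tchar exp v g f ^ zcoef w (val f) (val k) = tchar exp w g k.
Proof.
have [Y <-] := exp_surjective hT g.
rewrite (tchar_exp hT hD) (ncoord_change v) cis_sum; apply: eq_bigr => f _.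
by rewrite (tchar_exp hT hD) cisMz.
Qed.

Lemma norm_tchar v g (f : Fv v) (x : R[i]) : `|tchar exp v g f * x| = `|x|.
Proof. by rewrite !normcC !normc_sqrt sqnormM sqnorm_tchar mul1r. Qed.

Lemma phi_act v w g (z : C v) : phi w v (act_v exp v g z) = act_v exp w g (phi w v z).
Proof.
apply/funext => k; rewrite act_vE -(tchar_change v).
have EA : \prod_(f : Fv v) act_v exp v g z f ^ zcoef w (val f) (val k) =
    (\prod_(f : Fv v) tchar exp v g f ^ zcoef w (val f) (val k)) *
    \prod_(f : Fv v) z f ^ zcoef w (val f) (val k).
  by rewrite -big_split; apply: eq_bigr => f _; exact: expfzMl.
have EB : \prod_(f : Fv v | val f \notin Fset w) `|act_v exp v g z f| ^ zcoef w (val f) (val k) =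
    \prod_(f : Fv v | val f \notin Fset w) `|z f| ^ zcoef w (val f) (val k).
  apply: eq_bigr => f _.
  exact: (congr1 (fun y => y ^ zcoef w (val f) (val k)) (norm_tchar g f (z f))).
pose c xi : R[i] := if val k \in Fset v then 1 else (r_ (val k) xi)%:C.
have Ec : c (mu_v v (act_v exp v g z)) = c (mu_v v z) by rewrite (mu_act hT hD).
have E3 (a a' b b' d d' : R[i]) : a = a' -> b = b' -> d = d' -> a * b / d = a' * b' / d'.
  by move=> -> -> ->.
have E4 (x a b d : R[i]) : x * a * b / d = x * (a * b / d) by rewrite !mulrA.
apply: etrans (E3 _ _ _ _ _ _ EA Ec EB) _.
exact: E4.
Qed.

(** The part of the gluing map that is rotated: a coordinate for the facets
    common to both vertices, a radius for the new facets. *)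
Definition rad v (z : C v) (g : facets D) : R[i] :=
  if (insub g : option (Fv v)) is Some f then z f else (r_ g (mu_v v z))%:C.

Definition phase w v (z : C v) (g : facets D) : R[i] :=
  \prod_(f : Fv v | val f \notin Fset w) cpow (csgn (z f)) (zcoef w (val f) g).
Arguments phase : clear implicits.

(** The gluing map is a rotation of each coordinate, by angles that depend
    only on the coordinates that vanish nowhere on the overlap. *)
Lemma phiE v w (z : C v) (g : Fv w) : Uo v w z ->
  phi w v z g = rad z (val g) * phase w v z (val g).
Proof.
move=> [_ zw].
pose N := \prod_(f : Fv v | val f \notin Fset w) `|z f| ^ zcoef w (val f) (val g).
pose P := phase w v z (val g).
pose Q := \prod_(f : Fv v | ~~ (val f \notin Fset w)) z f ^ zcoef w (val f) (val g).
pose c : R[i] := if val g \in Fset v then 1 else (r_ (val g) (mu_v v z))%:C.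
have N0 : N != 0.
  by apply/prodf_neq0 => f fw; rewrite expfz_neq0 // normr_eq0 zw.
have EP : \prod_(f : Fv v | val f \notin Fset w) z f ^ zcoef w (val f) (val g) = P * N.
  rewrite -big_split; apply: eq_bigr => f fw /=.
  have z0 := zw f fw.
  by rewrite cpowE ?sqnorm_csgn // csgnE -expfzMl divfK // normr_eq0.
have EA : \prod_(f : Fv v) z f ^ zcoef w (val f) (val g) = P * N * Q.
  by rewrite -EP; exact: (bigID (fun f : Fv v => val f \notin Fset w)).
have EQ : Q * c = rad z (val g).
  rewrite /Q /rad /c; have [gv|gv] := boolP (val g \in Fset v).
    rewrite insubT mulr1; set g' : Fv v := Sub _ _.
    have vg : val g' = val g by rewrite SubK.
    rewrite (bigD1 g'); last by rewrite vg negbK (valP g).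
    have zg : zcoef w (val g) (val g) = 1 by rewrite zcoef_in ?eqxx ?(valP g).
    rewrite vg zg expr1z big1 => [|f /andP [/negPn fw fg]].
      by rewrite /= mulr1.
    rewrite zcoef_in // (_ : (val f == val g) = false) ?expr0z //.
    by apply: contraNF fg => /eqP e; apply/eqP/val_inj; rewrite vg.
  rewrite insubN // big1 ?mul1r // => f /negPn fw.
  rewrite zcoef_in // (_ : (val f == val g) = false) ?expr0z //.
  by apply: contraNF gv => /eqP <-; exact: valP.
have E (a b d : R[i]) : d != 0 -> forall e, a * d * b * e / d = b * e * a.
  by move=> d0 e; field.
apply: etrans (congr1 (fun a => a * c / N) EA) _.
by rewrite -EQ; exact: E.
Qed.

(** At points with positive coordinates there is nothing to rotate by. *)
Lemma phi_rho v w xi : Delta_v v xi -> Delta_v w xi -> phi w v (rho v xi) = rho w xi.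
Proof.
have ht := torus_lie_dim hT.
move=> xv xw; have xD : polytope_set D xi by case: xv.
have Ur : Uo v w (rho v xi) by apply/Uo_Delta; rewrite mu_rho.
apply/funext => g; rewrite phiE // /rad /phase big1.
  by rewrite mulr1 mu_rho //; case: insubP => // f _ fg; rewrite /rho fg.
move=> f fw; have [_ /(_ _ fw) f0] := Ur.
rewrite (_ : csgn _ = 1); first by rewrite cpowE ?exp1rz // sqnorm_real expr1n.
rewrite /csgn sqnorm_real sqrtr_sqr ger0_norm ?sqrtr_ge0 // -rmorphM mulfV //.
by move: f0; rewrite /rho fmorph_eq0.
Qed.

(** On overlaps all points are of the form [act g (rho xi)], and the gluing
    maps only replace the section: this gives every set-theoretic property. *)
Lemma phi_orbit v w (z : C v) : Uo v w z -> exists g,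
  z = act_v exp v g (rho v (mu_v v z)) /\ phi w v z = act_v exp w g (rho w (mu_v v z)).
Proof.
move=> /Uo_Delta [xv xw]; have [g zg] := rho_orbit z; exists g; split=> //.
by rewrite {1}zg phi_act phi_rho.
Qed.

Lemma mu_phi v w (z : C v) : Uo v w z -> mu_v w (phi w v z) = mu_v v z.
Proof.
move=> Uz; have [g [_ ->]] := phi_orbit Uz; rewrite (mu_act hT hD) mu_rho //.
by have /Uo_Delta [[]] := Uz.
Qed.

Lemma phi_Uo v w (z : C v) : Uo v w z -> Uo w v (phi w v z).
Proof.
by move=> Uz; apply/Uo_Delta; rewrite mu_phi //; have /Uo_Delta [] := Uz.
Qed.

(** Both sides replace the section over the same momentum by that at [w]. *)
Lemma phi_cocycle u v w (z : C u) : Uo u v z -> Uo v w (phi v u z) ->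
  Uo u w z /\ phi w v (phi v u z) = phi w u z.
Proof.
move=> Uz Up.
have /Uo_Delta [zu zv] := Uz; have /Uo_Delta := Up; rewrite mu_phi // => -[_ zw].
have Uw : Uo u w z by apply/Uo_Delta.
split=> //; have [g [zg ->]] := phi_orbit Uz.
by rewrite phi_act phi_rho // {2}zg phi_act phi_rho.
Qed.

Lemma phi_id v (z : C v) : U_ v z -> phi v v z = z.
Proof. by move=> /Uo_refl /phi_orbit [g [zg ->]]; rewrite -zg. Qed.

Lemma phiK v w (z : C v) : Uo v w z -> phi v w (phi w v z) = z.
Proof.
by move=> Uz; have [_ ->] := phi_cocycle Uz (phi_Uo Uz); rewrite phi_id //; case: Uz.
Qed.

End GluingMaps.

Arguments rho {R t D} v xi _.
Arguments phase {R t D} w v z g.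
Arguments open_Uo {R t T n AT exp D} hT hD v w.
Arguments open_U {R t T n AT exp D} hT hD v.

(** * The gluing maps are symplectomorphisms *)

Section GluingSymplectic.
Local Open Scope complex_scope.
Context {R : realType} {t : vectType R} {T : topologicalZmodType}.
Variables (n : nat) (AT : atlas R T) (exp : {additive t -> T}) (D : polytope t).
Hypotheses (hT : is_torus n AT exp) (hD : is_delzant_polytope exp D n).
Implicit Types (u v w : vertices D).
Local Notation C v := (cspace R (Fv v)).

Notation Re := complex.Re.
Notation Im := complex.Im.

Lemma smooth_phi v w (g : Fv w) :
  csmooth (@coords R (Fv v) @` Uo v w) (fun x => phi w v (uncoords x) g).
Proof.
have oU := open_Uo hT hD v w.
have UP x : (@coords R (Fv v) @` Uo v w) x -> Uo v w (uncoords x).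
  by rewrite coords_image.
apply: csmooth_eq (_ : csmooth _ (fun x => rad (uncoords x) (val g) * phase w v (uncoords x) (val g))).
  by move=> x /UP Ux; rewrite (phiE hT hD).
apply: csmoothM.
  rewrite /rad; case: insubP => [f _ _|gv]; first exact: csmooth_uncoords.
  apply: csmooth_real.
  have sh := smooth_height hT hD (v := v) (val g) oU.
  apply: smooth_sqrt (smoothM (smooth_cst 2 oU) sh) => x /UP /(UoP hT hD) [hv _].
  by rewrite mulr_gt0 // hv.
apply: csmooth_prod => // f fw; apply: csmooth_cpow; apply: csmooth_csgn.
  by move=> x /UP [_]; apply.
exact: csmooth_uncoords.
Qed.

Lemma smooth_to_phi v w :
  smooth_to (@coords R (Fv v) @` Uo v w) (fun x => coords (phi w v (uncoords x))).
Proof. by apply: smooth_to_coords => [|g]; [exact: open_Uo hT hD v w|exact: smooth_phi]. Qed.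

Lemma phi_diffeo v w :
  diffeo (cspace_atlas (Fv v)) (cspace_atlas (Fv w)) (Uo v w) (Uo w v) (phi w v).
Proof.
have sm v' w' : smooth_map (cspace_atlas (Fv v')) (cspace_atlas (Fv w')) (Uo v' w') (phi w' v').
  apply: smooth_map_cspace; first by apply/open_coords; exact: open_Uo hT hD v' w'.
  by move=> g; exact: smooth_phi.
split; last by exists (phi v w); [exact: sm|move=> z Uz; exact: (phiK hT hD Uz)].
  split.
  - by move=> z Uz; exact: (phi_Uo hT hD Uz).
  - move=> z z' /set_mem Uz /set_mem Uz' e.
    by rewrite -(phiK hT hD Uz) e (phiK hT hD Uz').
  - move=> y Uy; exists (phi v w y); first exact: (phi_Uo hT hD Uy).
    exact: (phiK hT hD Uy).
exact: sm.
Qed.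

(** * The differential of the gluing maps *)

Definition drad v (x a : 'rV[R]_(#|Fv v| + #|Fv v|)) (g : facets D) : R[i] :=
  if (insub g : option (Fv v)) is Some f then uncoords a f
  else (dmu v x a (normal g) / r_ g (mu_v v (uncoords x)))%:C.
Arguments drad : clear implicits.

(** The differential d(arg z_f). *)
Definition dangle v (x a : 'rV[R]_(#|Fv v| + #|Fv v|)) (f : Fv v) : R :=
  Im (conjc (uncoords x f) * uncoords a f) / sqnorm (uncoords x f).
Arguments dangle : clear implicits.

Definition dphase w v (x a : 'rV[R]_(#|Fv v| + #|Fv v|)) (g : facets D) : R :=
  \sum_(f : Fv v | val f \notin Fset w) (zcoef w (val f) g)%:~R * dangle v x a f.
Arguments dphase : clear implicits.

Definition dphi w v (x a : 'rV[R]_(#|Fv v| + #|Fv v|)) (g : Fv w) : R[i] :=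
  (drad v x a (val g) + 'i * (dphase w v x a (val g))%:C * rad (uncoords x) (val g)) *
  phase w v (uncoords x) (val g).
Arguments dphi : clear implicits.

Lemma is_cder_rad v w x a (g : Fv w) : Uo v w (uncoords x) ->
  is_cder x a (fun y => @rad R t D v (uncoords y) (val g)) (drad v x a (val g)).
Proof.
move=> /(UoP hT hD) [hv _]; rewrite /rad /drad; case: insubP => [f _ _|gv].
  exact: is_cder_uncoords.
apply: is_cder_real.
have h0 : 0 < 2 * height (val g) (mu_v v (uncoords x)) by rewrite mulr_gt0 // hv.
have cd (c : R) : is_derive x a (fun=> c) 0 by exact: is_derive_cst.
have hd : is_derive x a (fun y => 2 * height (val g) (mu_v v (uncoords y)))
    (2 * dmu v x a (normal (val g))).
  apply: is_derive_eq (is_derive_mul (cd 2)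
    (is_derive_add (is_derive_mu hT hD (normal (val g)) x a) (cd (offset (val g))))) _.
  by rewrite mul0r add0r addr0.
have sh := smoothM (smooth_cst 2 openT) (smooth_height hT hD (v := v) (val g) openT).
have df : differentiable (fun y => 2 * height (val g) (mu_v v (uncoords y))) x.
  exact: smooth_differentiable sh Logic.I.
have rd := is_derive_comp1 (f := fun y => 2 * height (val g) (mu_v v (uncoords y)))
  (is_derive1_sqrt h0) df hd.
apply: (@is_derive_eq _ _ _ (fun y => r_ (val g) (mu_v v (uncoords y))) _ _ _ _ rd).
rewrite r_height; move: (Num.sqrt _) (dmu _ _ _ _) => s d.
by rewrite invfM mulrACA mulVf ?mul1r // mulrC.
Qed.

Lemma rotates_phase v w x a (g : facets D) : Uo v w (uncoords x) ->
  rotates x a (fun y => phase w v (uncoords y) g) (dphase w v x a g).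
Proof.
move=> [_ zw]; apply: rotates_prod => f fw; apply: rotates_cpow.
apply: rotates_csgn; [exact: zw| |exact: is_cder_uncoords].
have sq := smooth_sqnorm (@csmooth_uncoords R _ setT f openT).
exact: (smooth_differentiable (x := x) sq Logic.I).
Qed.

Lemma is_cder_phi v w x a (g : Fv w) : Uo v w (uncoords x) ->
  is_cder x a (fun y => phi w v (uncoords y) g) (dphi w v x a g).
Proof.
move=> Ux; apply: is_cder_near (_ : is_cder x a (fun y =>
    rad (uncoords y) (val g) * phase w v (uncoords y) (val g)) _).
  apply: (near_open (open_Uo hT hD v w)); first by rewrite coords_image.
  by move=> y; rewrite coords_image => Uy; rewrite (phiE hT hD).
apply: is_cder_eq (is_cderM (is_cder_rad a g Ux) (rotates_phase a (val g) Ux)) _.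
rewrite /dphi; move: (rad _ _) (phase _ _ _ _) (drad _ _ _ _) => r p d.
by ring.
Qed.

(** How the symplectic form behaves under rotation: the angular speeds
    contribute the wedge product of half the squared radius with the angle. *)
Lemma rotation_pairing (r ra rb p : R[i]) (al be : R) : sqnorm p = 1 ->
  Im (conjc ((ra + 'i * al%:C * r) * p) * ((rb + 'i * be%:C * r) * p)) =
  Im (conjc ra * rb) + Re (conjc r * ra) * be - Re (conjc r * rb) * al.
Proof.
rewrite /sqnorm; case: p => p q; case: r => r s; case: ra => a1 a2; case: rb => b1 b2 /= pq.
by rewrite -[RHS]mul1r -[X in _ = X * _]pq; ring.
Qed.

(** dx dy = d(r^2/2) d(theta) in polar coordinates. *)
Lemma polar_pairing (z a b : R[i]) : z != 0 ->
  Re (conjc z * a) * (Im (conjc z * b) / sqnorm z) -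
  Re (conjc z * b) * (Im (conjc z * a) / sqnorm z) = Im (conjc a * b).
Proof.
rewrite -sqnorm_gt0 => /lt0r_neq0; rewrite /sqnorm.
by case: z => p q; case: a => a1 a2; case: b => b1 b2 /= z0; field.
Qed.

Lemma pairing_phi_coord v w x a b (g : Fv w) : Uo v w (uncoords x) ->
  Im (conjc (dphi w v x a g) * dphi w v x b g) =
  (if (insub (val g) : option (Fv v)) is Some f
   then Im (conjc (uncoords a f) * uncoords b f) else 0) +
  (dmu v x a (normal (val g)) * dphase w v x b (val g) -
   dmu v x b (normal (val g)) * dphase w v x a (val g)).
Proof.
move=> Ux; have [_ zw] := Ux; have /(UoP hT hD) [hv _] := Ux.
have p1 : sqnorm (phase w v (uncoords x) (val g)) = 1.
  rewrite /phase; elim/big_ind: _ => [|y z y1 z1|f fw].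
  - by rewrite sqnorm_real expr1n.
  - by rewrite sqnormM y1 z1 mulr1.
  - by apply: sqnorm_cpow; apply: sqnorm_csgn; exact: zw.
rewrite /dphi rotation_pairing // -addrA; congr (_ + (_ - _)).
- rewrite /drad; case: insubP => // gv /=.
  by rewrite mulr0 oppr0 mul0r addr0.
- rewrite /drad /rad; case: insubP => [f _ fg|gv]; first by rewrite -fg (dmu_normal hT hD).
  rewrite /= oppr0 mul0r subr0; congr (_ * _); rewrite mulrC divfK //.
  by rewrite r_height sqrtr_eq0 -ltNge mulr_gt0 // hv.
- rewrite /drad /rad; case: insubP => [f _ fg|gv]; first by rewrite -fg (dmu_normal hT hD).
  rewrite /= oppr0 mul0r subr0; congr (_ * _); rewrite mulrC divfK //.
  by rewrite r_height sqrtr_eq0 -ltNge mulr_gt0 // hv.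
Qed.

(** Exchanging the sums, the coefficients expand the normals at [v] in the
    basis at [w], and the differential of the momentum is linear in the vector. *)
Lemma sum_dmu_dphase v w x a b :
  \sum_(g : Fv w) dmu v x a (normal (val g)) * dphase w v x b (val g) =
  \sum_(f : Fv v | val f \notin Fset w)
    Re (conjc (uncoords x f) * uncoords a f) * dangle v x b f.
Proof.
rewrite /dphase; under eq_bigr do rewrite mulr_sumr.
rewrite exchange_big; apply: eq_bigr => f fw.
rewrite -(dmu_normal hT hD) (zcoefP hD w (val f)) (dmu_sum hT hD) mulr_suml.
by apply: eq_bigr => g _; ring.
Qed.

Lemma sum_common v w (F : Fv v -> R) :
  \sum_(g : Fv w) (if (insub (val g) : option (Fv v)) is Some f then F f else 0) =
  \sum_(f : Fv v | ~~ (val f \notin Fset w)) F f.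
Proof.
pose G (g : facets D) : R := if (insub g : option (Fv v)) is Some f then F f else 0.
rewrite -(sum_Fset w G) big_mkcond [RHS]big_mkcond /=.
transitivity (\sum_(g in Fset v) if g \in Fset w then G g else 0).
  rewrite [RHS]big_mkcond; apply: eq_bigr => g _.
  have [gv|gv] := boolP (g \in Fset v) => //.
  by rewrite /G insubN // if_same.
rewrite sum_Fset; apply: eq_bigr => f _.
by rewrite negbK /G valK.
Qed.

(** The common facets contribute their coordinates, and the correction terms
    of the rotations add up to the contribution of the remaining facets of [v]
    in polar coordinates. *)
Lemma phi_symplectic_at v w x : Uo v w (uncoords x) ->
  symplectic_at (fun y => coords (phi w v (uncoords y))) x.
Proof.
move=> Ux; have dphi_x : differentiable (fun y => coords (phi w v (uncoords y))) x.
  by apply: smooth_to_differentiable (smooth_to_phi v w) _; rewrite coords_image.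
split=> //.
apply: (@jacobian_symplectic R (Fv v) (Fv w) (fun y => phi w v (uncoords y)) x (dphi w v x)).
- by [].
- by move=> a g; exact: is_cder_phi.
- move=> a b; under eq_bigr do rewrite (pairing_phi_coord _ _ _ Ux).
  rewrite big_split sumrB !sum_dmu_dphase.
  rewrite (sum_common w (fun f => Im (conjc (uncoords a f) * uncoords b f))).
  rewrite [RHS](bigID (fun f : Fv v => val f \notin Fset w)) [RHS]addrC; congr (_ + _).
  rewrite -sumrB; apply: eq_bigr => f fw; apply: polar_pairing.
  by have [_ ] := Ux; apply.
Qed.

Lemma phi_symplectomorphism v w :
  symplectomorphism (cspace_form R (Fv v)) (cspace_form R (Fv w))
    (Uo v w) (Uo w v) (phi w v).
Proof.
split; first exact: phi_diffeo.
move=> [] [] g gE z Uz _ _.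
have Uz' : Uo v w (uncoords (coords z)) by rewrite coordsK.
have [_ E] : symplectic_at g (coords z).
  apply: symplectic_at_near (phi_symplectic_at Uz').
  apply: (near_open (open_Uo hT hD v w)); first by exists z.
  by move=> _ [y Uy <-]; rewrite coordsK; exact: gE Uy I I.
exact: E.
Qed.

End GluingSymplectic.

(** * The glued space and its charts *)

Section GluedSpace.
Local Open Scope quotient_scope.
Local Open Scope complex_scope.
Context {R : realType} {t : vectType R} {T : topologicalZmodType}.
Variables (n : nat) (AT : atlas R T) (exp : {additive t -> T}) (D : polytope t).
Hypotheses (hT : is_torus n AT exp) (hD : is_delzant_polytope exp D n).
Implicit Types (u v w : vertices D).
Local Notation C v := (cspace R (Fv v)).

Definition mkpiece v (z : C v) (Uz : U_ v z) : piece v := exist _ z (mem_set Uz).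

Lemma piece_in v (x : piece v) : U_ v (val x).
Proof. by case: x => z /= /set_mem. Qed.

(** As the gluing maps satisfy the cocycle condition, one gluing step already
    is an equivalence relation. *)
Lemma glue_stepP (x y : pieces D) : clos_refl_sym_trans _ (@glue_step R t D) x y -> glue_step x y.
Proof.
elim=> {x y} [//|x|x y _ [Uxy yE]|x y z _ [Uxy yE] _ [Uyz zE]].
- split; first by apply/(Uo_refl hT hD); exact: piece_in.
  by rewrite (phi_id hT hD) //; exact: piece_in.
- by split; rewrite yE; [exact: (phi_Uo hT hD)|rewrite (phiK hT hD)].
- rewrite yE in Uyz zE; have [Uxz xzE] := phi_cocycle hT hD Uxy Uyz.
  by split; rewrite // zE.
Qed.

Lemma to_gluedP v w (x : piece v) (y : piece w) :
  to_glued v x = to_glued w y <-> Uo v w (val x) /\ val y = phi w v (val x).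
Proof.
split=> [/eqmodP /asboolP /glue_stepP //|h].
by apply/eqmodP/asboolP; apply: rst_step.
Qed.

Lemma to_glued_inj v : injective (@to_glued R t D v).
Proof.
move=> x y /to_gluedP [Ux e]; apply: val_inj; rewrite /= e (phi_id hT hD) //.
exact: piece_in.
Qed.

Lemma glued_cover (y : glued D) : exists v (x : piece v), to_glued v x = y.
Proof.
exists (tag (repr y)), (tagged (repr y)); rewrite /to_glued.
by rewrite -[RHS]reprK; case: (repr y).
Qed.

Lemma glued_chartE v (x : piece v) : glued_chart v (to_glued v x) = coords (val x).
Proof.
rewrite /glued_chart; case: xgetP => [z _ [y /to_glued_inj -> <-] //|none].
by case: (none (val x)); exists x.
Qed.

Lemma to_glued_continuous v : continuous (@to_glued R t D v).
Proof.
move=> x; apply: (@continuous_comp _ _ _ (existT (@piece R t D) v) (\pi_(glued D))).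
  exact: existT_continuous.
exact: pi_continuous.
Qed.

Lemma phi_preimage_open v w (O : set (C v)) : open O -> open (Uo w v `&` phi v w @^-1` O).
Proof.
move=> oO; apply/open_coords.
have := smooth_to_preimage (smooth_to_phi hT hD w v) (proj2 (open_coords O) oO).
congr (open _); rewrite !coords_image; apply/seteqP; split=> x /=; by rewrite ?coordsK.
Qed.

(** The preimage in another piece of the image of an open set is cut out by a
    gluing map. *)
Lemma to_glued_open v (O : set (piece v)) : open O -> open (to_glued v @` O).
Proof.
move=> [Q oQ <-]; apply/sigT_openP => w.
exists (Uo w v `&` phi v w @^-1` Q); first exact: phi_preimage_open.
apply/seteqP; split=> y.
  move=> [Uy Oy]; have Uv : U_ v (phi v w (val y)) by apply: Uo_sub (phi_Uo hT hD Uy).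
  by exists (mkpiece Uv) => //; apply/esym/to_gluedP.
by move=> [x Ox /esym /to_gluedP [Uy xE]]; split=> //=; rewrite -xE.
Qed.

Lemma range_to_glued_open v : open (range (@to_glued R t D v)).
Proof. by apply: to_glued_open; exact: openT. Qed.

Lemma glued_chart_image v (O : set (glued D)) : O `<=` range (to_glued v) ->
  glued_chart v @` O = @coords R (Fv v) @` [set z | exists2 x : piece v, val x = z & O (to_glued v x)].
Proof.
move=> Or; apply/seteqP; split=> [_ [y Oy <-]|_ [_ [x <- Ox] <-]].
  have [x _ xy] := Or _ Oy; rewrite -xy glued_chartE; exists (val x) => //.
  by exists x; rewrite ?xy.
by exists (to_glued v x) => //; exact: glued_chartE.
Qed.

Lemma glued_chart_range v : glued_chart v @` range (to_glued v) = @coords R (Fv v) @` U_ v.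
Proof.
rewrite glued_chart_image //; congr (_ @` _); apply/seteqP; split=> z.
  by move=> [x <- _]; exact: piece_in.
by move=> Uz; exists (mkpiece Uz) => //; exists (mkpiece Uz).
Qed.

Lemma glued_chart_open v (O : set (glued D)) : open O -> O `<=` range (to_glued v) ->
  open (glued_chart v @` O).
Proof.
move=> oO Or; rewrite glued_chart_image //; apply/open_coords.
have [Q oQ QE] : open (to_glued v @^-1` O).
  by apply: open_comp oO => x _; exact: to_glued_continuous.
have -> : [set z | exists2 x : piece v, val x = z & O (to_glued v x)] = Q `&` U_ v.
  apply/seteqP; split=> z.
    move=> [x <- Ox]; split; last exact: piece_in.
    by have : (to_glued v @^-1` O) x by []; rewrite -QE.
  move=> [Qz Uz]; exists (mkpiece Uz) => //.
  have : (set_val @^-1` Q) (mkpiece Uz) by [].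
  by rewrite QE.
by apply: openI => //; apply/open_coords; exact: open_U hT hD v.
Qed.

Lemma glued_chart_inj v : set_inj (range (to_glued v)) (glued_chart v).
Proof.
move=> _ _ /set_mem [x _ <-] /set_mem [y _ <-]; rewrite !glued_chartE.
by move=> /coords_inj /val_inj ->.
Qed.

Lemma glued_chart_continuous v y : range (to_glued v) y ->
  {for y, continuous (glued_chart v)}.
Proof.
move=> [x _ <-] W; rewrite glued_chartE nbhsE => -[W' [oW' W'x] W'W].
apply: (@filterS _ _ _ (to_glued v @` [set x' | W' (coords (val x'))])).
  by move=> _ [x' Wx' <-]; rewrite /= glued_chartE; exact: W'W.
apply: open_nbhs_nbhs; split; last by exists x.
apply: to_glued_open; exists (@coords R (Fv v) @^-1` W') => //.
by apply: open_comp oW' => z _; exact: coords_continuous.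
Qed.

Lemma glued_transition : smooth_map (glued_atlas D) (glued_atlas D) setT id.
Proof.
move=> v w; exists (fun x => coords (phi w v (uncoords x))).
  move=> _ _ [x _ <-] [y _ /esym /to_gluedP [Ux yE]].
  rewrite /= glued_chartE coordsK -yE -glued_chartE; congr glued_chart.
  by apply/to_gluedP.
set S := (X in smooth_to X _); suff -> : S = @coords R (Fv v) @` Uo v w.
  exact: smooth_to_phi hT hD v w.
apply/seteqP; split=> [_ [_ [_ [x _ <-] [y _ /esym /to_gluedP [Ux _]]] <-]|_ [z Uz <-]].
  by rewrite /= glued_chartE; exists (val x).
have Uv : U_ v z by exact: Uo_sub Uz.
exists (to_glued v (mkpiece Uv)); last exact: glued_chartE.
split=> //; first by exists (mkpiece Uv).
have Uw : U_ w (phi w v z) by exact: Uo_sub (phi_Uo hT hD Uz).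
by exists (mkpiece Uw) => //; apply/esym/to_gluedP.
Qed.

(** * The common momentum map and the action *)

Definition glued_mu (y : glued D) : 'Hom(t, R^o) := mu_v (tag (repr y)) (val (tagged (repr y))).

Definition piece_act v g (x : piece v) : piece v := mkpiece (U_act hT hD g (piece_in x)).

Definition glued_act g (y : glued D) : glued D :=
  to_glued (tag (repr y)) (piece_act g (tagged (repr y))).

Lemma repr_to_glued v (x : piece v) :
  to_glued (tag (repr (to_glued v x))) (tagged (repr (to_glued v x))) = to_glued v x.
Proof. by rewrite /to_glued -[RHS]reprK; case: (repr _). Qed.

Lemma glued_muE v (x : piece v) : glued_mu (to_glued v x) = mu_v v (val x).
Proof.
rewrite /glued_mu; have /to_gluedP [Ux ->] := repr_to_glued x.
by rewrite (mu_phi hT hD).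
Qed.

Lemma glued_actE v g (x : piece v) : glued_act g (to_glued v x) = to_glued v (piece_act g x).
Proof.
rewrite /glued_act; apply/to_gluedP; have /to_gluedP [Ux xE] := repr_to_glued x.
split; first exact: Uo_act hT hD _ _ _ _ Ux.
by rewrite /= xE (phi_act hT hD).
Qed.

(** A point of another piece with momentum in [Delta_v] lies in the domain of
    the gluing map to the piece of [v]. *)
Lemma range_to_gluedP v (y : glued D) : range (to_glued v) y <-> Delta_v v (glued_mu y).
Proof.
split=> [[x _ <-]|]; first by rewrite glued_muE; exact: piece_in.
have [w [x <-]] := glued_cover y; rewrite glued_muE => xv.
have Ux : Uo w v (val x) by apply/(Uo_Delta hT hD); split=> //; exact: piece_in.
have Uv : U_ v (phi v w (val x)) by exact: Uo_sub (phi_Uo hT hD Ux).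
by exists (mkpiece Uv) => //; apply/esym/to_gluedP.
Qed.

End GluedSpace.

(** * The glued space is a manifold *)

Section RationalBalls.
Context {R : realType}.

Definition rat_ball m (qk : 'rV[rat]_m * nat) : set 'rV[R]_m :=
  ball (map_mx ratr qk.1 : 'rV[R]_m) (qk.2.+1%:R^-1 : R).

(** Balls with rational centres and radii 1/(k+1) form a countable basis. *)
Lemma rat_ball_small m (x : 'rV[R]_m) (W : set 'rV[R]_m) : open W -> W x ->
  exists qk, rat_ball qk x /\ rat_ball qk `<=` W.
Proof.
move=> oW Wx.
have /nbhs_ballP [e /= e0 eW] : nbhs x W by apply: open_nbhs_nbhs.
pose k := Num.trunc (2 / e).
have k0 : 0 < (k.+1%:R : R)^-1 by rewrite invr_gt0 ltr0n.
have ke : (k.+1%:R : R)^-1 + k.+1%:R^-1 <= e.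
  rewrite -mulr2n -[leLHS]mulr_natl ler_pdivrMr ?ltr0n // mulrC -ler_pdivrMr //.
  by rewrite ltW // truncnS_gt.
have /choice [q qP] : forall i, exists q : rat, `|ratr q - x 0 i| < k.+1%:R^-1.
  move=> i; have [|q] := @rat_in_itvoo R (x 0 i - k.+1%:R^-1) (x 0 i + k.+1%:R^-1).
    by rewrite ltrBlDr -addrA ltrDl addr_gt0.
  rewrite in_itv /= => /andP [h1 h2]; exists q.
  by rewrite ltr_distl h1 h2.
have bx : rat_ball (\row_i q i, k) x.
  split=> // i j; rewrite ord1 !mxE; exact: qP.
exists (\row_i q i, k); split=> // y qy; apply: eW.
apply: le_ball ke _ _; apply: ball_triangle qy; exact: ball_sym.
Qed.

End RationalBalls.

Section GluedManifold.
Local Open Scope complex_scope.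
Context {R : realType} {t : vectType R} {T : topologicalZmodType}.
Variables (n : nat) (AT : atlas R T) (exp : {additive t -> T}) (D : polytope t).
Hypotheses (hT : is_torus n AT exp) (hD : is_delzant_polytope exp D n).
Implicit Types (u v w : vertices D).
Local Notation C v := (cspace R (Fv v)).

Let ht : \dim {:t} = n := torus_lie_dim hT.

(** Continuity of the heights of the momentum can be tested in the pieces. *)
Lemma glued_mu_open (f : facets D) (W : set R) : open W ->
  open [set y : glued D | W (height f (glued_mu y))].
Proof.
move=> oW; apply/sigT_openP => v.
pose h (z : C v) := height f (mu_v v z).
have ch : continuous h.
  move=> z; have -> : h = (fun x => height f (mu_v v (uncoords x))) \o @coords R (Fv v).
    by apply/funext => z'; rewrite /= coordsK.
  apply: continuous_comp; first exact: coords_continuous.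
  have sh := smooth_height hT hD (v := v) f openT.
  exact: (differentiable_continuous (smooth_differentiable (x := coords z) sh Logic.I)).
exists (h @^-1` W); first by apply: open_comp oW => z _; exact: ch.
have E (y : piece v) : W (height f (glued_mu (to_glued v y))) = W (h (val y)).
  by rewrite (glued_muE hT hD).
apply/seteqP; split=> y Wy.
  have : W (h (val y)) by exact: Wy.
  by rewrite -E.
have : W (height f (glued_mu (to_glued v y))) by exact: Wy.
by rewrite E.
Qed.

Lemma separate_reals (a b : R) : a != b -> exists A B : set R,
  [/\ open A, open B, A a, B b & forall x, A x -> B x -> False].
Proof.
move=> ab; wlog lab : a b ab / a < b.
  move=> H; have [/H h|/H h|e] := ltgtP a b; [exact: h| |by rewrite e eqxx in ab].
  have [A [B [oA oB Ab Ba AB]]] := h ltac:(by rewrite eq_sym).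
  by exists B, A; split=> // x Bx Ax; exact: AB Ax Bx.
exists [set x | x < (a + b) / 2], [set x | (a + b) / 2 < x].
split; [exact: open_lt|exact: open_gt|by rewrite /= midf_lt|by rewrite /= midf_lt|].
by move=> x /= xa xb; have := lt_trans xa xb; rewrite ltxx.
Qed.

(** Points with different momenta are separated by the momentum map; points
    with the same momentum lie in a common chart. *)
Lemma glued_hausdorff : hausdorff_space (glued D).
Proof.
rewrite open_hausdorff => x y xy.
suff [A [B [oA oB Ax By AB]]] : exists A B : set (glued D),
    [/\ open A, open B, A x, B y & forall z, A z -> B z -> False].
  exists (A, B); first by rewrite !inE.
  by split=> //; apply/eqP/seteqP; split=> z // [Az Bz]; exact: AB Az Bz.
have [v [p px]] := glued_cover x.
have [e|ne] := pselect (glued_mu x = glued_mu y); last first.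
  have [f hf] : exists f : facets D, height f (glued_mu x) != height f (glued_mu y).
    apply: contrapT => /forallNP all_eq; apply: ne.
    apply: (hom_ext hT hD (v := v)) => f.
    have /negP/negPn/eqP := all_eq (val f); rewrite /height.
    by move/addIr.
  have [A [B [oA oB Ax By AB]]] := separate_reals hf.
  exists [set z | A (height f (glued_mu z))], [set z | B (height f (glued_mu z))].
  by split; [exact: glued_mu_open|exact: glued_mu_open|by []|by []|move=> z; exact: AB].
have [q qy] : range (to_glued v) y.
  by apply/(range_to_gluedP hT hD); rewrite -e -px (glued_muE hT hD); exact: piece_in.
move=> qy'; have hpq : coords (val p) != coords (val q) :> 'rV[R]_(#|Fv v| + #|Fv v|).
  apply/eqP => /coords_inj /val_inj pq; move/eqP: xy; apply.
  by rewrite -px -qy' pq.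
have [j hj] : exists j, coords (val p) 0 j != coords (val q) 0 j :> R.
  apply: contrapT => /forallNP all_eq; move/eqP: hpq; apply; apply/rowP => j.
  by have /negP/negPn/eqP := all_eq j.
have [A [B [oA oB Ax By AB]]] := separate_reals hj.
have opn (W : set R) : open W -> open (to_glued v @` [set z | W (coords (val z) 0 j)]).
  move=> oW; apply: (to_glued_open hT hD).
  exists [set z : C v | W (coords z 0 j)] => //.
  apply: (open_comp (f := fun z : C v => coords z 0 j)) oW => z _.
  apply: (@continuous_comp _ _ _ (@coords R (Fv v)) (fun x : 'rV[R]_(#|Fv v| + #|Fv v|) => x 0 j)).
    exact: coords_continuous.
  exact/differentiable_continuous/differentiable_coord.
exists (to_glued v @` [set z | A (coords (val z) 0 j)]), (to_glued v @` [set z | B (coords (val z) 0 j)]).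
split; [exact: opn|exact: opn|by exists p|by exists q|].
move=> _ [z Az <-] [z' Bz' /(to_glued_inj hT hD) zz'].
by apply: AB Az _; rewrite -zz'.
Qed.

Lemma glued_second_countable : @second_countable (glued D).
Proof.
pose B v (qk : 'rV[rat]_(#|Fv v| + #|Fv v|) * nat) : set (glued D) :=
  to_glued v @` [set z | rat_ball qk (coords (val z))].
exists (\bigcup_(v in [set: vertices D]) \bigcup_(qk in setT) [set B v qk]).
  apply: bigcup_countable => [|v _]; first exact: countableP.
  apply: bigcup_countable => [|qk _]; [exact: countableP|exact: countable1].
split=> [_ [v _ [qk _ ->]]|x W].
  apply: (to_glued_open hT hD).
  exists (@coords R (Fv v) @^-1` rat_ball qk) => //.
  by apply: open_comp (ball_open _ _) => z _; exact: coords_continuous.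
rewrite nbhsE => -[W' [oW' W'x] W'W].
have [v [p px]] := glued_cover x.
have oI : open (glued_chart v @` (W' `&` range (to_glued v))).
  apply: (glued_chart_open hT hD); last by move=> z [].
  by apply: openI => //; exact: range_to_glued_open hT hD v.
have Ix : (glued_chart v @` (W' `&` range (to_glued v))) (coords (val p)).
  exists x; last by rewrite -px (glued_chartE hT hD).
  by split=> //; exists p.
have [qk [qx qW]] := rat_ball_small oI Ix.
exists (B v qk).
  split; first by exists v => //; exists qk.
  by rewrite -px; exists p.
move=> _ [z qz <-]; apply: W'W.
have [y [W'y yr]] := qW _ qz.
rewrite -(glued_chartE hT hD) => yz.
by rewrite -(glued_chart_inj hT hD (mem_set yr) (mem_set (ex_intro2 _ _ z Logic.I erefl)) yz).
Qed.

Lemma glued_manifold : is_manifold (2 * n) (glued_atlas D).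
Proof.
split.
- exact: glued_hausdorff.
- exact: glued_second_countable.
- by move=> v; rewrite /= (card_Fv hT hD) mul2n addnn.
- by move=> x; have [v [p px]] := glued_cover x; exists v; exists p.
- by move=> v; exact: range_to_glued_open hT hD v.
- by move=> v; exact: (glued_chart_inj hT hD).
- by move=> v x; exact: (glued_chart_continuous hT hD).
- by move=> v W; exact: (glued_chart_open hT hD).
- exact: glued_transition hT hD.
Qed.

End GluedManifold.

Section GluedTopology.
Local Open Scope complex_scope.
Context {R : realType} {t : vectType R} {T : topologicalZmodType}.
Variables (n : nat) (AT : atlas R T) (exp : {additive t -> T}) (D : polytope t).
Hypotheses (hT : is_torus n AT exp) (hD : is_delzant_polytope exp D n).
Implicit Types (u v w : vertices D).
Local Notation C v := (cspace R (Fv v)).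

Let ht : \dim {:t} = n := torus_lie_dim hT.

Lemma height_continuous v (f : facets D) :
  continuous (fun x => height f (mu_v v (uncoords x))).
Proof.
move=> x; have sh := smooth_height hT hD (v := v) f openT.
exact: (differentiable_continuous (smooth_differentiable (x := x) sh Logic.I)).
Qed.

(** * Compactness *)

(** The momentum map is proper, since it controls the absolute values of the
    coordinates. *)
Lemma level_compact v (e : facets D -> R) : (forall f, 0 <= e f) ->
  compact [set x : 'rV[R]_(#|Fv v| + #|Fv v|) |
    forall f, e f <= height f (mu_v v (uncoords x))].
Proof.
move=> e0; set K := [set x | _].
have [p pE] := delzant_convex hD.
have /choice [B BP] : forall f : facets D, exists B, forall xi, polytope_set D xi -> height f xi <= B.
  move=> f; have [B Bp] := hull_bounded p (normal f); exists (B + offset f) => xi.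
  by rewrite pE => /Bp; rewrite /height lerD2r.
have KD x : K x -> polytope_set D (mu_v v (uncoords x)).
  by move=> Kx; apply/(polytopeP hD ht) => f; exact: le_trans (e0 f) (Kx f).
have cl : closed K.
  have -> : K = \bigcap_(f in [set: facets D])
      ((fun x => height f (mu_v v (uncoords x))) @^-1` [set r | e f <= r]).
    by apply/seteqP; split=> x h f; [move=> _; exact: h|exact: h].
  apply: closed_bigI => f _; apply: preimage_closed; last exact: closed_ge.
  by move=> x _; exact: height_continuous.
pose M := 1 + \sum_(f : Fv v) 2 * `|B (val f)|.
have cM : compact [set x : 'rV[R]_(#|Fv v| + #|Fv v|) |
    forall j, [set` `[- M, M]] (x ord0 j)].
  by apply: (@rV_compact _ _ (fun=> [set` `[- M, M]])) => j; exact: segment_compact.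
apply: subclosed_compact cl cM _ => x Kx j.
have sq f : sqnorm (uncoords x f) <= M - 1.
  rewrite /M addrC addrA addNr add0r (bigD1 f) //=.
  have := BP (val f) _ (KD _ Kx); rewrite (height_mu hT hD) ler_pdivrMr // mulrC => h.
  have h2 : 2 * B (val f) <= 2 * `|B (val f)| by rewrite ler_pM2l // ler_norm.
  apply: le_trans h (le_trans h2 _).
  by rewrite lerDl; apply: sumr_ge0 => f' _; rewrite mulr_ge0.
have small (a b : R) : a ^+ 2 + b ^+ 2 <= M - 1 -> - M <= a <= M /\ - M <= b <= M.
  by move=> h; split; apply/andP; split; nra.
rewrite /= in_itv /=; case: (splitP j) => k jk.
  have -> : j = lshift _ k by apply/val_inj.
  have := sq (enum_val k); rewrite /sqnorm /uncoords /= enum_valK.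
  by move=> /small [].
have -> : j = rshift _ k by apply/val_inj.
have := sq (enum_val k); rewrite /sqnorm /uncoords /= enum_valK.
by move=> /small [].
Qed.

(** A Lebesgue number for the cover of the polytope by the sets [Delta_v]: it
    exists because the polytope is the image of a compact set of coordinates at
    any single vertex. *)
Lemma Delta_cover_uniform : exists2 e, 0 < e & forall xi, polytope_set D xi ->
  exists v, forall f, f \notin Fset v -> e <= height f xi.
Proof.
have [xi0 xi0P] := interior_point hD ht.
have [v0 _] : exists v, Delta_v v xi0.
  by apply: (Delta_cover hD ht); apply/(polytopeP hD ht) => f; exact: ltW.
have /compact_near_coveringP cK := level_compact (v := v0) (fun _ : facets D => lexx (0 : R)).
set K := [set x | _] in cK.
pose P (k : nat) (x : 'rV[R]_(#|Fv v0| + #|Fv v0|)) := exists v, forall f, f \notin Fset v ->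
  k.+1%:R^-1 <= height f (mu_v v0 (uncoords x)).
have near_P x : K x -> \forall x' \near x & k \near \oo, P k x'.
  move=> Kx.
  have [v vP] : exists v, Delta_v v (mu_v v0 (uncoords x)).
    by apply: (Delta_cover hD ht); apply/(polytopeP hD ht).
  have {}vP f : f \notin Fset v -> 0 < height f (mu_v v0 (uncoords x)).
    by have /(Delta_vP hD ht) [_] := vP; apply.
  have [d d0 dP] : exists2 d, 0 < d & forall f, f \in enum [predC Fset v] ->
      d * `|1 : R| <= height f (mu_v v0 (uncoords x)).
    by apply: (small_scale (fun=> 1)) => f; rewrite mem_enum => /vP.
  have d2 : 0 < d / 2 by rewrite divr_gt0.
  exists ([set x' | forall f, f \notin Fset v -> 0 < height f (mu_v v0 (uncoords x')) - d / 2],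
    [set k | k.+1%:R^-1 < d / 2]).
    split=> /=; last exact: (near_infty_natSinv_lt (PosNum d2)).
    apply: (near_forall (P := fun f x' => f \notin Fset v ->
      0 < height f (mu_v v0 (uncoords x')) - d / 2)) => f; have [fv|fv] := boolP (f \in Fset v).
      by apply: (near_open (U := setT)) => //; exact: openT.
    have cf : {for x, continuous (fun x' => height f (mu_v v0 (uncoords x')) - d / 2)}.
      have sh := smoothD (smooth_height hT hD (v := v0) f openT) (smooth_cst (- (d / 2)) openT).
      exact: (differentiable_continuous (smooth_differentiable (x := x) sh Logic.I)).
    have : 0 < height f (mu_v v0 (uncoords x)) - d / 2.
      rewrite subr_gt0; have := dP f; rewrite mem_enum normr1 mulr1 => /(_ fv).
      by apply: lt_le_trans; rewrite ltr_pdivrMr // ltr_pMr // ltr1n.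
    by move=> /(near_gt0 cf); apply: filterS.
  move=> [x' k] [/= hx hk]; exists v => f /hx; rewrite subr_gt0 => h.
  by apply: ltW; apply: lt_trans hk h.
have [k _ /(_ k (leqnn k)) KP] := cK nat \oo P _ near_P.
exists k.+1%:R^-1; first by rewrite invr_gt0 ltr0n.
move=> xi xiD; have xiE := mu_rho hT hD v0 xiD.
have [|v vP] := KP (coords (rho v0 xi)).
  by move=> f; rewrite coordsK xiE (polytope_height hD).
by exists v => f /vP; rewrite coordsK xiE.
Qed.

(** The inverse of the chart [v], extended by the value [y0] outside the image
    of the chart. *)
Definition glued_pt (y0 : glued D) v (x : 'rV[R]_(#|Fv v| + #|Fv v|)) : glued D :=
  if pselect (U_ v (uncoords x)) is left Ux then to_glued v (mkpiece Ux) else y0.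
Arguments glued_pt : clear implicits.

Lemma glued_ptE y0 v (p : piece v) : glued_pt y0 v (coords (val p)) = to_glued v p.
Proof.
rewrite /glued_pt; case: pselect => [Ux|[]].
  by congr to_glued; apply: val_inj; rewrite /= coordsK.
by rewrite coordsK; exact: piece_in.
Qed.

Lemma glued_ptP y0 v x : U_ v (uncoords x) ->
  exists2 p : piece v, glued_pt y0 v x = to_glued v p & x = coords (val p).
Proof.
move=> Ux; exists (mkpiece Ux); last by rewrite /= uncoordsK.
by rewrite -(glued_ptE y0) /= uncoordsK.
Qed.

Lemma glued_pt_continuous y0 v x : U_ v (uncoords x) -> {for x, continuous (glued_pt y0 v)}.
Proof.
move=> Ux W; have [p pE xE] := glued_ptP y0 Ux.
rewrite pE nbhsE => -[W' [oW' W'p] W'W].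
apply: (@filterS _ _ _ (glued_chart v @` (W' `&` range (to_glued v)))).
  move=> _ [y [W'y [q _ qy]] <-]; rewrite -qy (glued_chartE hT hD) /= glued_ptE qy.
  exact: W'W.
apply: open_nbhs_nbhs; split.
  apply: (glued_chart_open hT hD); last by move=> z [].
  by apply: openI => //; exact: range_to_glued_open hT hD v.
by exists (to_glued v p); [split=> //; exists p|rewrite (glued_chartE hT hD) -xE].
Qed.

Lemma glued_nonempty : exists (v : vertices D) (p : piece v), forall f : facets D,
  0 < height f (mu_v v (val p)).
Proof.
have [xi xiP] := interior_point hD ht.
have xiD : polytope_set D xi by apply/(polytopeP hD ht) => f; exact: ltW.
have [v xv] := Delta_cover hD ht xiD.
have Uv : U_ v (rho v xi) by rewrite /U_ /preimage /= (mu_rho hT hD).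
by exists v, (mkpiece Uv) => f; rewrite /= (mu_rho hT hD).
Qed.

(** With e a Lebesgue number, the parts of the pieces where all heights of
    facets outside F_v are at least e are compact and cover the space. *)
Lemma glued_compact : compact [set: glued D].
Proof.
have [v0 [p0 _]] := glued_nonempty; pose y0 := to_glued v0 p0.
have [e e0 eP] := Delta_cover_uniform.
pose c v (f : facets D) : R := if f \in Fset v then 0 else e.
have c0 v f : 0 <= c v f by rewrite /c; case: ifP => // _; exact: ltW.
pose K v := [set x : 'rV[R]_(#|Fv v| + #|Fv v|) | forall f, c v f <= height f (mu_v v (uncoords x))].
have KU v x : K v x -> U_ v (uncoords x).
  move=> Kx; apply/(U_P hT hD) => f fv; apply: lt_le_trans e0 _.
  by have := Kx f; rewrite /c (negbTE fv).
have -> : [set: glued D] = \big[setU/set0]_(v <- enum (vertices D)) (glued_pt y0 v @` K v).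
  apply/seteqP; split=> // y _; rewrite -bigcup_seq.
  have yD : polytope_set D (glued_mu y).
    by have [w [p <-]] := glued_cover y; rewrite (glued_muE hT hD); have [] := piece_in p.
  have [v vP] := eP _ yD.
  have [p _ py] : range (to_glued v) y.
    apply/(range_to_gluedP hT hD); apply/(Delta_vP hD ht); split=> // f /vP.
    exact: lt_le_trans.
  exists v; first by rewrite /= mem_enum.
  exists (coords (val p)); last by rewrite glued_ptE.
  move=> f; rewrite coordsK -(glued_muE hT hD) py /c.
  by case: ifPn => [_|/vP //]; exact: polytope_height hD _ _ yD.
apply: bigsetU_compact => v _; apply: continuous_compact; last exact: level_compact.
apply: continuous_in_subspaceT => x /set_mem /KU Ux.
exact: glued_pt_continuous.
Qed.

(** * Connectedness *)

Lemma mu_scale v (z : C v) (s : R) :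
  mu_v v (fun f => s%:C * z f) = vertex v + s ^+ 2 *: (mu_v v z - vertex v).
Proof.
apply: (mu_v_uniq hT hD) => f; rewrite heightD add_lfunE opp_lfunE.
have /(FsetP hD ht) v0 : val f \in Fset v by exact: valP.
rewrite v0 sqnormM sqnorm_real -mulrA -(height_mu hT hD).
have E (b c o : R) : c + o = 0 -> 0 + s ^+ 2 * (b - c) = s ^+ 2 * (b + o).
  by move=> /eqP; rewrite addr_eq0 => /eqP ->; ring.
exact: E v0.
Qed.

(** Scaling the coordinates moves the momentum along the segment to the
    vertex, so the domain of a chart is star-shaped. *)
Lemma U_star v (z : C v) (s : R) : 0 <= s <= 1 -> U_ v z -> U_ v (fun f => s%:C * z f).
Proof.
move=> /andP [s0 s1] /(U_P hT hD) zP; apply/(U_P hT hD) => f fv.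
rewrite mu_scale heightD add_lfunE opp_lfunE.
have hv : 0 < height f (vertex v).
  rewrite lt_neqAle eq_sym; apply/andP; split.
    by apply: contra fv => /eqP hv; apply/(FsetP hD ht).
  exact: polytope_height hD _ _ (vertex_in hD v).
have := zP f fv; rewrite /height; rewrite /height in hv.
move: (mu_v v z _) (vertex v _) (offset f) hv => a b c hb ha.
have -> : b + c + s ^+ 2 * (a - b) = (1 - s ^+ 2) * (b + c) + s ^+ 2 * (a + c) by ring.
have [->|sn1] := eqVneq s 1; first by rewrite expr1n subrr mul0r add0r mul1r.
have s2 : s ^+ 2 < 1 by rewrite exprn_ilt1 // lt_neqAle sn1.
by rewrite ltr_pwDl ?mulr_gt0 ?subr_gt0 // mulr_ge0 ?sqr_ge0 // ltW.
Qed.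

(** Every piece is a union of paths from its vertex, and all pieces contain the
    points over the interior of the polytope. *)
Lemma glued_connected : connected [set: glued D].
Proof.
have [v0 [p0 p0P]] := glued_nonempty; pose y0 := to_glued v0 p0.
have cr v : connected (range (@to_glued R t D v)).
  pose path (p : piece v) (s : R) := glued_pt y0 v (s *: coords (val p)).
  have scaleE (z : C v) (s : R) : uncoords (s *: coords z) = fun f => s%:C * z f.
    apply/funext => f; apply: complex_ext; rewrite ?ReM ?ImM /= /uncoords /= /coords !mxE.
      by rewrite (unsplitK (inl _)) mxE enum_rankK mul0r subr0.
    by rewrite (unsplitK (inr _)) mxE enum_rankK mul0r addr0.
  have Us (p : piece v) s : 0 <= s <= 1 -> U_ v (uncoords (s *: coords (val p))).
    by move=> s01; rewrite scaleE; apply: U_star => //; exact: piece_in.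
  have -> : range (@to_glued R t D v) = \bigcup_(p in [set: piece v]) (path p @` [set` `[0, 1]]).
    apply/seteqP; split=> [_ [p _ <-]|_ [p _ [s s01 <-]]].
      exists p => //; exists 1; first by rewrite /= in_itv /= ler01 lexx.
      by rewrite /path scale1r glued_ptE.
    rewrite /= in_itv /= in s01.
    by have [q qE _] := glued_ptP y0 (Us p s s01); exists q; rewrite // /path qE.
  apply: bigcup_connected => [|p _].
    exists (glued_pt y0 v 0) => p _; exists 0; first by rewrite /= in_itv /= ler01 lexx.
    by rewrite /path scale0r.
  apply: connected_continuous_connected; first exact: segment_connected.
  apply: continuous_in_subspaceT => s /set_mem; rewrite /= in_itv /= => s01.
  apply: (@continuous_comp _ _ _ (fun s : R => s *: coords (val p)) (glued_pt y0 v)).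
    by apply: cvgZr_tmp; exact: cvg_id.
  exact: glued_pt_continuous y0 _ _ (Us p s s01).
have -> : [set: glued D] = \bigcup_(v in [set: vertices D]) range (@to_glued R t D v).
  apply/seteqP; split=> // y _; have [v [p py]] := glued_cover y.
  by exists v => //; exists p.
apply: bigcup_connected => [|v _]; last exact: cr.
exists y0 => v _; apply/(range_to_gluedP hT hD); rewrite (glued_muE hT hD).
apply/(Delta_vP hD ht); split=> [|f _]; last exact: p0P.
by apply/(polytopeP hD ht) => f; exact: ltW.
Qed.

End GluedTopology.

(** * The Hamiltonian structure of the glued space *)

Section StandardForm.
Context {R : realType}.

Lemma std_form_tr p : (@std_form R p)^T = - std_form p.
Proof.
by rewrite /std_form linearZ /= tr_block_mx !trmx0 linearN /= trmx1 -scalerN opp_block_mx !oppr0 opprK.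
Qed.

Lemma std_form_unit p : @std_form R p \in unitmx.
Proof.
have c0 : (2 * pi : R)^-1 != 0 by rewrite invr_eq0 mulf_neq0 // gt_eqF // pi_gt0.
rewrite /std_form; set c := (2 * pi)^-1 in c0 *.
pose N : 'M[R]_(p + p) := c^-1 *: block_mx 0 (- 1%:M) 1%:M 0.
suff /mulmx1_unit [] : (c *: block_mx 0 1%:M (- 1%:M) 0) *m N = 1%:M by [].
rewrite /N -scalemxAl -scalemxAr scalerA mulfV // scale1r mulmx_block.
by rewrite !mulmx0 !mul0mx !mulmx1 !mulNmx !mulmxN !mulmx1 opprK !add0r !addr0 ?oppr0 -scalar_mx_block.
Qed.

End StandardForm.

Section GluedHamiltonian.
Local Open Scope complex_scope.
Context {R : realType} {t : vectType R} {T : topologicalZmodType}.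
Variables (n : nat) (AT : atlas R T) (exp : {additive t -> T}) (D : polytope t).
Hypotheses (hT : is_torus n AT exp) (hD : is_delzant_polytope exp D n).
Implicit Types (u v w : vertices D).
Local Notation C v := (cspace R (Fv v)).

Let ht : \dim {:t} = n := torus_lie_dim hT.
Let act := glued_act hT hD.

(** It suffices to know one symplectic expression of the map near each point,
    as all expressions in the same charts agree there. *)
Lemma glued_form_preserved (F : glued D -> glued D) :
  (forall v w (p : piece v) (q : piece w), F (to_glued v p) = to_glued w q ->
    exists2 G, symplectic_at G (coords (val p)) &
      \forall x \near coords (val p), forall p' : piece v, x = coords (val p') ->
        exists2 q' : piece w, F (to_glued v p') = to_glued w q' & G x = coords (val q')) ->
  preserves_form (@glued_form R t D) (@glued_form R t D) setT F.
Proof.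
move=> HF v w g gE _ _ [p _ <-] [q _ pq]; rewrite /glued_form /= (glued_chartE hT hD).
have [G GS nG] := HF v w p q (esym pq).
have oU : open (@coords R (Fv v) @` U_ v) := open_U hT hD v.
have [_ E] : symplectic_at g (coords (val p)).
  apply: symplectic_at_near GS.
  have nU : \forall x \near coords (val p), (@coords R (Fv v) @` U_ v) x.
    by apply: open_nbhs_nbhs; split=> //; exists (val p) => //; exact: piece_in.
  apply: filterS2 nG nU => x Hx [z Uz zx]; have [q' FE ->] := Hx (mkpiece Uz) (esym zx).
  rewrite -zx.
  rewrite -(glued_chartE hT hD q') -FE; rewrite [LHS]gE //.
  - by rewrite /= (glued_chartE hT hD).
  - by exists (mkpiece Uz).
  - by rewrite FE; exists q'.
exact: E.
Qed.

Lemma glued_symplectic : Defs.is_symplectic (@glued_form R t D).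
Proof.
split.
- move=> v i j; apply: smooth_cst; rewrite /= (glued_chart_range hT hD).
  exact: open_U hT hD v.
- apply: glued_form_preserved => v w p q /(to_gluedP hT hD) [Up qE].
  exists (fun x => coords (phi w v (uncoords x))).
    by apply: (phi_symplectic_at hT hD); rewrite coordsK.
  apply: (near_open (open_Uo hT hD v w)); first by exists (val p).
  move=> _ [z Uz <-] p' /coords_inj zp; rewrite zp in Uz *.
  have Uw : U_ w (phi w v (val p')) by exact: Uo_sub (phi_Uo hT hD Uz).
  exists (mkpiece Uw); last by rewrite coordsK.
  exact: (proj2 (to_gluedP hT hD p' (mkpiece Uw)) (conj Uz erefl)).
- by move=> v x _; exact: std_form_tr.
- by move=> v x _; exact: std_form_unit.
- by move=> v x i j k _; rewrite /glued_form !derive_cst !addr0.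
Qed.

Lemma glued_act_chart v g (p : piece v) :
  glued_chart v (act g (to_glued v p)) = coords (act_v exp v g (val p)).
Proof. by rewrite /act glued_actE (glued_chartE hT hD). Qed.

Lemma glued_act_smooth :
  smooth_map (prod_atlas AT (glued_atlas D)) (glued_atlas D) setT (fun p => act p.1 p.2).
Proof.
move=> [a v] w.
pose G y := coords (phi w v (uncoords (act_coords exp v a y))).
exists G.
  move=> [g _] _ [/= ga [p _ <-]] [q _]; rewrite /act glued_actE => /esym.
  move=> /(to_gluedP hT hD) [Up qE].
  rewrite /G (glued_chartE hT hD) (act_coordsE hT) // coordsK.
  rewrite -[X in coords X]qE -(glued_chartE hT hD); congr (glued_chart w).
  exact: (proj2 (to_gluedP hT hD (piece_act hT hD g p) q) (conj Up qE)).
have sG := smooth_to_comp (U := act_coords_dom v a `&` act_coords exp v a @^-1` (@coords R (Fv v) @` Uo v w))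
  _ (smooth_to_sub _ _ (smooth_act_coords hT hD v a)) (smooth_to_phi hT hD v w).
set S := (X in smooth_to X _).
suff -> : S = act_coords_dom v a `&` act_coords exp v a @^-1` (@coords R (Fv v) @` Uo v w).
  apply: sG => [y [] //| |y [] //].
  by apply: smooth_to_preimage (smooth_act_coords hT hD v a) (open_Uo hT hD v w).
apply/seteqP; split.
  move=> _ [[g _] [_ [/= ga [p _ <-]]] [q _] + <-]; rewrite /act glued_actE /= => /esym.
  move=> /(to_gluedP hT hD) [Up _]; rewrite (glued_chartE hT hD); split.
    by rewrite /act_coords_dom /= row_mxKl; exists g.
  by rewrite /= (act_coordsE hT) //; exists (act_v exp v g (val p)).
move=> y [[g ga gy] [z Uz zE]].
have yE : y = row_mx (chart a g) (coords (uncoords (rsubmx y))).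
  by rewrite uncoordsK gy hsubmxK.
have zE' : z = act_v exp v g (uncoords (rsubmx y)).
  by apply: coords_inj; rewrite zE {1}yE (act_coordsE hT).
have Uy : U_ v (uncoords (rsubmx y)).
  by have := Uo_sub Uz; rewrite zE' /U_ /preimage /= (mu_act hT hD).
have Uw : U_ w (phi w v z) by exact: Uo_sub (phi_Uo hT hD Uz).
exists (g, to_glued v (mkpiece Uy)); last by rewrite /= (glued_chartE hT hD) -yE.
split=> //=; first by split=> //; exists (mkpiece Uy).
exists (mkpiece Uw); first by [].
rewrite /act glued_actE; apply/esym/(to_gluedP hT hD); split; rewrite /= -zE' //.
Qed.

Lemma glued_hamiltonian : is_hamiltonian AT exp (@glued_form R t D) act (@glued_mu R t D).
Proof.
split.
- move=> y; have [v [p <-]] := glued_cover y; rewrite /act glued_actE; congr to_glued.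
  by apply: val_inj; exact: act_v0 hT hD v (val p).
- move=> g h y; have [v [p <-]] := glued_cover y; rewrite /act !glued_actE; congr to_glued.
  by apply: val_inj; exact: act_vD hT hD v g h (val p).
- exact: glued_act_smooth.
- move=> g; apply: glued_form_preserved => v w p q; rewrite /act glued_actE.
  move=> /(to_gluedP hT hD) [Up qE].
  exists ((fun x => coords (phi w v (uncoords x))) \o (fun x => coords (act_v exp v g (uncoords x)))).
    apply: symplectic_at_comp; first exact: act_symplectic_at.
    by apply: (phi_symplectic_at hT hD); rewrite !coordsK.
  apply: (near_open (open_Uo hT hD v w)).
    exists (val p) => //; apply/(UoP hT hD); have /(UoP hT hD) := Up.
    by rewrite /= (mu_act hT hD).
  move=> _ [z Uz <-] p' /coords_inj zp; rewrite zp in Uz *.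
  have Ua := Uo_act hT hD g Uz.
  have Uw : U_ w (phi w v (act_v exp v g (val p'))) by exact: Uo_sub (phi_Uo hT hD Ua).
  exists (mkpiece Uw); last by rewrite /= !coordsK.
  rewrite glued_actE.
  exact: (proj2 (to_gluedP hT hD (piece_act hT hD g p') (mkpiece Uw)) (conj Ua erefl)).
- move=> Y v; exists (fun x => mu_v v (uncoords x) Y).
    by move=> _ [p _ <-]; rewrite (glued_muE hT hD) /= (glued_chartE hT hD) coordsK.
  rewrite /= (glued_chart_range hT hD); apply: (smooth_mu hT hD).
  exact: open_U hT hD v.
- move=> g y; have [v [p <-]] := glued_cover y.
  by rewrite /act glued_actE !(glued_muE hT hD) /= (mu_act hT hD).
- move=> Y v f fE _ [p _ <-].
  rewrite /infinitesimal_action /= (glued_chartE hT hD).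
  have -> : (fun h : R => glued_chart v (act (exp (h *: Y)) (to_glued v p))) =
      fun h => coords (act_v exp v (exp (h *: Y)) (val p)).
    by apply/funext => h; exact: glued_act_chart.
  apply: (momentum_local hT hD).
  apply: (near_open (open_U hT hD v)).
    by exists (val p) => //; exact: piece_in.
  move=> _ [z Uz <-]; have := fE (to_glued v (mkpiece Uz)).
  rewrite (glued_muE hT hD) /= (glued_chartE hT hD) coordsK => <- //.
  by exists (mkpiece Uz).
Qed.

(** Over an interior point of the polytope no coordinate vanishes. *)
Lemma glued_effective : effective act.
Proof.
move=> g gfix; have [v [p pP]] := glued_nonempty hT hD.
apply: (tchar_faithful hT hD (v := v)) => f.
have := gfix (to_glued v p); rewrite /act glued_actE => /(to_glued_inj hT hD).
move=> /(congr1 val) /= /(congr1 (fun z : C v => z f)); rewrite act_vE.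
have f0 : val p f != 0 by rewrite (neq0_height hT hD).
by move=> e; apply: (mulIf f0); rewrite mul1r.
Qed.

Lemma glued_mu_image : @glued_mu R t D @` setT = polytope_set D.
Proof.
apply/seteqP; split=> [_ [y _ <-]|xi xD].
  have [v [p <-]] := glued_cover y; rewrite (glued_muE hT hD).
  by have [] := piece_in p.
have [v xv] := Delta_cover hD ht xD.
have Uv : U_ v (rho v xi) by rewrite /U_ /preimage /= (mu_rho hT hD).
by exists (to_glued v (mkpiece Uv)) => //; rewrite (glued_muE hT hD) /= (mu_rho hT hD).
Qed.

End GluedHamiltonian.

Theorem corollary4p4 (R : realType) (n : nat) (t : vectType R)
    (T : topologicalZmodType) (AT : atlas R T) (exp : {additive t -> T})
    (D : polytope t)
    (hT : is_torus n AT exp) (hD : is_delzant_polytope exp D n) :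
  (* mu_v is well defined, and a momentum map for the T-action on C^{F_v} *)
  (forall (v : vertices D) (z : cspace R (Fv v)) (f : Fv v),
     Normc.normc (z f) ^+ 2 / 2 - offset (val f) = mu_v v z (normal (val f))) /\
  (forall v : vertices D,
     is_hamiltonian AT exp (cspace_form R (Fv v)) (act_v exp v) (mu_v v)) /\
  (* phi_{w,v} is a T-equivariant symplectomorphism *)
  (forall v w : vertices D,
     symplectomorphism (cspace_form R (Fv v)) (cspace_form R (Fv w))
       (Uo v w) (Uo w v) (phi w v) /\
     forall g z, Uo v w z ->
       Uo v w (act_v exp v g z) /\
       phi w v (act_v exp v g z) = act_v exp w g (phi w v z)) /\
  (forall (v w : vertices D) z, Uo w v z -> mu_v w z = mu_v v (phi v w z)) /\
  (* cocycle condition *)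
  (forall (u v w : vertices D) z, Uo u v z -> Uo v w (phi v u z) ->
     Uo u w z /\ phi w v (phi v u z) = phi w u z) /\
  (* the pieces U_v are charts of the glued space *)
  (forall (v : vertices D) (x : piece v),
     glued_chart v (to_glued v x) = coords (val x)) /\
  exists (act : T -> glued D -> glued D) (mu : glued D -> 'Hom(t, R^o)),
    (forall (v : vertices D) (x : piece v) (g : T),
       exists2 y : piece v,
         val y = act_v exp v g (val x) & act g (to_glued v x) = to_glued v y) /\
    (forall (v : vertices D) (x : piece v), mu (to_glued v x) = mu_v v (val x)) /\
    is_delzant_space n AT exp (polytope_set D) (glued_form D) act mu.
Proof.
split; first exact: mu_vP hT hD.
split; first exact: cspace_hamiltonian hT hD.
split.
  move=> v w; split; first exact: phi_symplectomorphism hT hD v w.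
  by move=> g z Uz; split; [exact: Uo_act hT hD _ _ _ _ Uz|exact: phi_act hT hD _ _ _ _].
split; first by move=> v w z Uz; rewrite (mu_phi hT hD Uz).
split; first exact: phi_cocycle hT hD.
split; first exact: glued_chartE hT hD.
exists (glued_act hT hD), (@glued_mu R t D); split.
  by move=> v x g; exists (piece_act hT hD g x); last exact: glued_actE.
split; first exact: glued_muE hT hD.
split.
- exact: glued_manifold hT hD.
- exact: glued_compact hT hD.
- exact: glued_connected hT hD.
- exact: glued_symplectic hT hD.
- exact: glued_hamiltonian hT hD.
- exact: glued_effective hT hD.
- exact: glued_mu_image hT hD.
Qed.
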